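(* Let $\mathcal{F}\in\{\mathcal{A},\mathcal{S}\}$ and let $a,b$ be non-negative integers. Then \[\zeta_{\mathcal{F}_1}(\{2\}^a,3,\{2\}^b)=\frac{(-1)^{a+b}2(a-b)}{a+1}\binom{2a+2b+3}{2b+2}\mathfrak{Z}_{\mathcal{F}_1}(2a+2b+3),\] \[\zeta^\star_{\mathcal{F}_1}(\{2\}^a,3,\{2\}^b)=\frac{2(b-a)}{a+1}\binom{2a+2b+3}{2b+2}\mathfrak{Z}_{\mathcal{F}_1}(2a+2b+3).\]
   Context: $\{2\}^a$ denotes $a$ repetitions of $2$. An index is a finite tuple of positive integers. Let $\mathcal{A}_1=\prod_p\mathbb{Z}/p\mathbb{Z}\big/\bigoplus_p\mathbb{Z}/p\mathbb{Z}$ ($p$ over all primes), $\zeta_{\mathcal{A}_1}(\boldsymbol{k})=\bigl(\sum_{0<m_1<\cdots<m_r<p}m_1^{-k_1}\cdots m_r^{-k_r}\bmod p\bigr)_p$ and $\zeta^\star_{\mathcal{A}_1}(\boldsymbol{k})=\bigl(\sum_{1\le m_1\le\cdots\le m_r\le p-1}m_1^{-k_1}\cdots m_r^{-k_r}\bmod p\bigr)_p$. Let $\mathcal{Z}\subset\mathbb{R}$ be the $\mathbb{Q}$-algebra generated by all multiple zeta values $\zeta(k_1,\dots,k_r)=\sum_{0<m_1<\cdots<m_r}m_1^{-k_1}\cdots m_r^{-k_r}$ ($k_r\ge2$), and $\overline{\mathcal{Z}}=\mathcal{Z}/\zeta(2)\mathcal{Z}$. For $\bullet\in\{*,\text{sh}\}$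 let $\zeta^\bullet(\boldsymbol{k})$ be the harmonic (stuffle), resp. shuffle, regularized multiple zeta value (with $\zeta^\bullet(1)=0$, $\zeta^\bullet(\varnothing)=1$). The symmetric multiple zeta value is $\zeta_{\mathcal{S}_1}(\boldsymbol{k})=\sum_{i=0}^r(-1)^{k_{i+1}+\cdots+k_r}\zeta^\bullet(k_1,\dots,k_i)\zeta^\bullet(k_r,\dots,k_{i+1})\bmod\zeta(2)\in\overline{\mathcal{Z}}$ (independent of $\bullet$), and $\zeta^\star_{\mathcal{S}_1}(k_1,\dots,k_r)=\sum\zeta_{\mathcal{S}_1}(k_1\square\cdots\square k_r)$, the sum over all ways of replacing each $\square$ by a comma or a plus. $\mathfrak{Z}_{\mathcal{A}_1}(k)=\bigl(\frac{B_{p-k}}{k}\bmod p\bigr)_p$ ($B_j$ Bernoulli numbers), $\mathfrak{Z}_{\mathcal{S}_1}(k)=\zeta(k)\bmod\zeta(2)\in\overline{\mathcal{Z}}$. *)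

(* Defs.v *)
From HB Require Import structures.
From mathcomp Require Import all_boot all_order all_algebra.
From mathcomp Require Import generic_quotient ring_quotient.
From mathcomp Require Import boolp classical_sets cardinality reals.
From mathcomp Require Import topology normedtype sequences.

Set Implicit Arguments.
Unset Strict Implicit.
Unset Printing Implicit Defensive.

Import Order.TTheory GRing.Theory Num.Theory numFieldNormedType.Exports.

Local Open Scope ring_scope.
Local Open Scope quotient_scope.

(* Indices are written (k_1, ..., k_r) with 0 < m_1 < ... < m_r, so that
   convergence is governed by the last entry. *)
Definition admissible (k : seq nat) : bool :=
  all (leq 1) k && (2 <= last 2 k)%N.

(* The sums over 0 < m_1 < ... < m_r < N and 1 <= m_1 <= ... <= m_r < N. *)
Section TruncatedSums.
Variables (F : fieldType) (N : nat) (k : seq nat).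

Definition trunc_zeta : F :=
  \sum_(m : (size k).-tuple 'I_N | path ltn 0 [seq val i | i <- m])
    \prod_(j < size k) (tnth m j)%:R ^- nth 0%N k j.

Definition trunc_zeta_star : F :=
  \sum_(m : (size k).-tuple 'I_N | path leq 1 [seq val i | i <- m])
    \prod_(j < size k) (tnth m j)%:R ^- nth 0%N k j.

End TruncatedSums.

Fixpoint bernoulli_seq (n : nat) : seq rat :=
  if n is m.+1 then
    let s := bernoulli_seq m in
    rcons s (((m == 0%N)%:R - \sum_(j < m) 'C(m.+1, j)%:R * s`_j) / m.+1%:R)
  else [::].

Definition bernoulli (n : nat) : rat := (bernoulli_seq n.+1)`_n.

Lemma size_bernoulli_seq n : size (bernoulli_seq n) = n.
Proof. by elim: n => //= n IHn; rewrite size_rcons IHn. Qed.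

Lemma nth_bernoulli_seq n j :
  (j < n)%N -> (bernoulli_seq n)`_j = bernoulli j.
Proof.
elim: n => // n IHn; rewrite ltnS leq_eqVlt => /predU1P[-> //|ltjn].
by rewrite /= nth_rcons size_bernoulli_seq ltjn IHn.
Qed.

Lemma sum_bernoulli n :
  \sum_(j < n.+1) 'C(n.+1, j)%:R * bernoulli j = (n == 0%N)%:R.
Proof.
rewrite big_ord_recr /= {2}/bernoulli /= nth_rcons size_bernoulli_seq ltnn eqxx.
rewrite binSn mulrC divfK ?pnatr_eq0 // addrC.
under [X in _ - X + _]eq_bigr do rewrite nth_bernoulli_seq //.
by rewrite subrK.
Qed.

Definition primes_prod : Type := forall p : {p : nat | prime p}, 'F_(val p).

HB.instance Definition _ := Choice.on primes_prod.

Section PrimesProdRing.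
Implicit Types x y z : primes_prod.

Let addp x y : primes_prod := fun p => x p + y p.
Let oppp x : primes_prod := fun p => - x p.
Let mulp x y : primes_prod := fun p => x p * y p.
Let zerop : primes_prod := fun p => 0.
Let onep : primes_prod := fun p => 1.

Let addpA : associative addp.
Proof. by move=> x y z; apply: functional_extensionality_dep => p; apply: addrA. Qed.
Let addpC : commutative addp.
Proof. by move=> x y; apply: functional_extensionality_dep => p; apply: addrC. Qed.
Let add0p : left_id zerop addp.
Proof. by move=> x; apply: functional_extensionality_dep => p; apply: add0r. Qed.
Let addNp : left_inverse zerop oppp addp.
Proof. by move=> x; apply: functional_extensionality_dep => p; apply: addNr. Qed.

HB.instance Definition _ :=
  GRing.isZmodule.Build primes_prod addpA addpC add0p addNp.

Let mulpA : associative mulp.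
Proof. by move=> x y z; apply: functional_extensionality_dep => p; apply: mulrA. Qed.
Let mulpC : commutative mulp.
Proof. by move=> x y; apply: functional_extensionality_dep => p; apply: mulrC. Qed.
Let mul1p : left_id onep mulp.
Proof. by move=> x; apply: functional_extensionality_dep => p; apply: mul1r. Qed.
Let mulpDl : left_distributive mulp +%R.
Proof. by move=> x y z; apply: functional_extensionality_dep => p; apply: mulrDl. Qed.
Let onep_neq0 : onep != 0.
Proof.
apply/eqP => /(congr1 (fun x : primes_prod => x (exist _ 2%N isT)))/eqP.
by rewrite oner_eq0.
Qed.

HB.instance Definition _ := GRing.Zmodule_isComNzRing.Build primes_prod
  mulpA mulpC mul1p mulpDl onep_neq0.

End PrimesProdRing.

Definition primes_sum : {pred primes_prod} :=
  fun x => `[< finite_set [set p | x p != 0] >].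

Lemma primes_sumP (x : primes_prod) :
  x \in primes_sum <->
  exists N, forall p : {p : nat | prime p}, (N <= val p)%N -> x p = 0.
Proof.
rewrite unfold_in; split=> [/asboolP fx|[N xN]].
  have /finite_seqP[s s_def] := finite_image val fx.
  exists (\max_(i <- s) i).+1 => p ltp; apply/eqP; apply: contraLR ltp => xp0.
  rewrite -leqNgt; apply: leq_bigmax_seq => //.
  suff : [set` s]%classic (val p) by [].
  by rewrite -s_def; exists p.
apply/asboolP; apply: sub_finite_set (finite_preimage _ (finite_II N)).
  by move=> p /=; apply: contraNT; rewrite -leqNgt => /xN ->.
by move=> p q _ _; apply: val_inj.
Qed.

Lemma primes_sum_idealr : idealr_closed primes_sum.
Proof.
split=> [||x y z /primes_sumP[N yN] /primes_sumP[M zM]].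
- by apply/primes_sumP; exists 0%N.
- apply/negP => /primes_sumP[N oneN]; have [p ltNp p_pr] := prime_above N.
  by have /eqP := oneN (exist _ p p_pr) (ltnW ltNp); rewrite oner_eq0.
- apply/primes_sumP; exists (maxn N M) => p; rewrite geq_max => /andP[lNp lMp].
  have -> : (x * y + z) p = x p * y p + z p by [].
  by rewrite yN // zM // mulr0 addr0.
Qed.

HB.instance Definition _ :=
  isIdealr.Build primes_prod primes_sum primes_sum_idealr.

Definition A1 : Type := {ideal_quot primes_sum}.

HB.instance Definition _ := GRing.ComNzRing.on A1.

Definition toA1 (x : primes_prod) : A1 := \pi_({ideal_quot primes_sum}) x.

Lemma toA1_eq (x y : primes_prod) :
  toA1 x = toA1 y <->
  exists N, forall p : {p : nat | prime p}, (N <= val p)%N -> x p = y p.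
Proof.
have -> : toA1 x = toA1 y <-> x - y \in primes_sum.
  by rewrite Quotient.idealrBE; split=> [xy|/eqP //]; apply/eqP.
have xyE p : (x - y) p = x p - y p by [].
split=> [/primes_sumP[N xyN]|[N xyN]].
  by exists N => p /xyN /eqP; rewrite xyE subr_eq0 => /eqP.
by apply/primes_sumP; exists N => p /xyN; rewrite xyE => ->; rewrite subrr.
Qed.

(* A_1 is a Q-algebra: a rational number is reduced modulo all the primes that
   do not divide its denominator. *)
Definition ratA1 (c : rat) : A1 := toA1 (fun p => ratr c).

Lemma ratr_frac (F : fieldType) (n d : int) : (d%:~R : F) != 0 ->
  ratr (n%:~R / d%:~R) = n%:~R / d%:~R :> F.
Proof.
move=> dF0; have d0 : d != 0 by apply: contraNneq dF0 => ->.
set q : rat := n%:~R / d%:~R.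
have nE : n * denq q = numq q * d.
  apply/eqP; rewrite -(eqr_int rat) !intrM numqE mulrAC /q divfK ?intr_eq0 //.
have /dvdzP[e dE] : (denq q %| d)%Z.
  rewrite -(@Gauss_dvdzr _ (numq q)); last first.
    by rewrite coprimezE coprime_sym; apply: coprime_num_den.
  by rewrite -nE dvdz_mull.
have qF0 : (denq q)%:~R != 0 :> F.
  by apply: contraNneq dF0 => q0; rewrite dE intrM q0 mulr0.
apply/eqP; rewrite /ratr eqr_div // -!intrM; apply/eqP; congr (_%:~R).
by rewrite nE.
Qed.

Section RatrPartialMorphism.
Variables (F : fieldType) (x y : rat).
Hypotheses (xF0 : ((denq x)%:~R : F) != 0) (yF0 : ((denq y)%:~R : F) != 0).

Let dF0 : ((denq x * denq y)%:~R : F) != 0.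
Proof. by rewrite intrM mulf_neq0. Qed.

Lemma ratrD_partial : ratr (x + y) = ratr x + ratr y :> F.
Proof.
rewrite -{1}(divq_num_den x) -{1}(divq_num_den y) addf_div ?intr_eq0 ?denq_neq0 //.
by rewrite -!intrM -intrD ratr_frac // /ratr addf_div // !(intrM, intrD).
Qed.

Lemma ratrM_partial : ratr (x * y) = ratr x * ratr y :> F.
Proof.
rewrite -{1}(divq_num_den x) -{1}(divq_num_den y) mulf_div.
by rewrite -!intrM ratr_frac // /ratr mulf_div !intrM.
Qed.

End RatrPartialMorphism.

Lemma denq_Fp_neq0 (c : rat) (p : {p : nat | prime p}) :
  (`|denq c| < val p)%N -> ((denq c)%:~R : 'F_(val p)) != 0.
Proof.
move=> ltp; rewrite -(gez0_abs (denq_ge0 c)) -pmulrn.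
rewrite -(dvdn_pcharf (pchar_Fp (valP p))).
by apply/negP => /dvdn_leq; rewrite absz_gt0 denq_neq0 leqNgt ltp => /(_ isT).
Qed.

Lemma ratA1D c d : ratA1 (c + d) = ratA1 c + ratA1 d.
Proof.
rewrite /ratA1 /toA1 -rmorphD; apply/toA1_eq.
exists (maxn `|denq c| `|denq d|).+1 => p; rewrite gtn_max => /andP[ltc ltd].
by apply: ratrD_partial; apply: denq_Fp_neq0.
Qed.

Lemma ratA1M c d : ratA1 (c * d) = ratA1 c * ratA1 d.
Proof.
rewrite /ratA1 /toA1 -rmorphM; apply/toA1_eq.
exists (maxn `|denq c| `|denq d|).+1 => p; rewrite gtn_max => /andP[ltc ltd].
by apply: ratrM_partial; apply: denq_Fp_neq0.
Qed.

Lemma ratA1_1 : ratA1 1 = 1.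
Proof.
rewrite /ratA1 /toA1 -(rmorph1 (\pi_({ideal_quot primes_sum}))).
by apply/toA1_eq; exists 0%N => p _; rewrite /ratr divr1.
Qed.

Definition scaleA1 (c : rat) (x : A1) : A1 := ratA1 c * x.

Lemma scaleA1A c d x : scaleA1 c (scaleA1 d x) = scaleA1 (c * d) x.
Proof. by rewrite /scaleA1 mulrA ratA1M. Qed.
Lemma scaleA11 : left_id 1 scaleA1.
Proof. by move=> x; rewrite /scaleA1 ratA1_1 mul1r. Qed.
Lemma scaleA1Dr : right_distributive scaleA1 +%R.
Proof. by move=> c x y; apply: mulrDr. Qed.
Lemma scaleA1Dl x : {morph scaleA1^~ x : c d / c + d}.
Proof. by move=> c d; rewrite /scaleA1 ratA1D mulrDl. Qed.

HB.instance Definition _ := GRing.Zmodule_isLmodule.Build rat A1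
  scaleA1A scaleA11 scaleA1Dr scaleA1Dl.

Definition zetaA1 (k : seq nat) : A1 :=
  toA1 (fun p => trunc_zeta 'F_(val p) (val p) k).

Definition zeta_starA1 (k : seq nat) : A1 :=
  toA1 (fun p => trunc_zeta_star 'F_(val p) (val p) k).

(* (B_{p-k} / k mod p)_p; the truncated subtraction and the division by p only
   affect the finitely many primes p <= k. *)
Definition frakZ_A1 (k : nat) : A1 :=
  toA1 (fun p => ratr (bernoulli (val p - k) / k%:R)).

Section MultipleZetaValues.
Variable R : realType.

(* The value is 0 by convention on the indices that are not admissible, where
   the series may diverge. *)
Definition mzv (k : seq nat) : R :=
  if admissible k then limn (fun N => trunc_zeta R N k : R) else 0.

Definition rat_subalgebra (S : set R) : Prop :=
  [/\ S 1, forall x y, S x -> S y -> S (x - y),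
      forall x y, S x -> S y -> S (x * y)
    & forall (c : rat) x, S x -> S (ratr c * x)].

Definition mzv_pred : {pred R} := fun x =>
  `[< forall S : set R, rat_subalgebra S ->
        (forall k, admissible k -> S (mzv k)) -> S x >].

Lemma mzv_pred_subalgebra : rat_subalgebra [set` mzv_pred]%classic.
Proof.
split=> [|x y /asboolP xS /asboolP yS|x y /asboolP xS /asboolP yS
        |c x /asboolP xS]; apply/asboolP => S algS zS;
  have [S1 SB SM SZ] := algS; [exact: S1|apply: SB|apply: SM|apply: SZ];
  by [apply: xS | apply: yS].
Qed.

Lemma mzv_pred_subring : subring_closed mzv_pred.
Proof. by have [? ? ? _] := mzv_pred_subalgebra. Qed.

HB.instance Definition _ :=
  GRing.isSubringClosed.Build R mzv_pred mzv_pred_subring.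

Record mzvalg : Type := MzvAlg { mzval : R; mzval_in : mzval \in mzv_pred }.

HB.instance Definition _ := [isSub for mzval].
HB.instance Definition _ := [Choice of mzvalg by <:].
HB.instance Definition _ := [SubChoice_isSubComNzRing of mzvalg by <:].

Lemma mzv_in k : mzv k \in mzv_pred.
Proof.
have [k_adm|kNadm] := boolP (admissible k).
  by apply/asboolP => S _; apply.
by rewrite /mzv (negPf kNadm) rpred0.
Qed.

Definition mzvZ (k : seq nat) : mzvalg := MzvAlg (mzv_in k).

Lemma ratr_mzval_in (c : rat) (x : mzvalg) : ratr c * mzval x \in mzv_pred.
Proof. by have [_ _ _] := mzv_pred_subalgebra; apply; apply: mzval_in. Qed.

Definition scale_mzvalg (c : rat) (x : mzvalg) : mzvalg :=
  MzvAlg (ratr_mzval_in c x).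

Lemma scale_mzvalgA c d x :
  scale_mzvalg c (scale_mzvalg d x) = scale_mzvalg (c * d) x.
Proof. by apply: val_inj; rewrite /= mulrA rmorphM. Qed.
Lemma scale_mzvalg1 : left_id 1 scale_mzvalg.
Proof. by move=> x; apply: val_inj; rewrite /= rmorph1 mul1r. Qed.
Lemma scale_mzvalgDr : right_distributive scale_mzvalg +%R.
Proof. by move=> c x y; apply: val_inj; apply: mulrDr. Qed.
Lemma scale_mzvalgDl x : {morph scale_mzvalg^~ x : c d / c + d}.
Proof. by move=> c d; apply: val_inj; rewrite /= rmorphD mulrDl. Qed.

HB.instance Definition _ := GRing.Zmodule_isLmodule.Build rat mzvalg
  scale_mzvalgA scale_mzvalg1 scale_mzvalgDr scale_mzvalgDl.

Definition zeta2_pred : {pred mzvalg} :=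
  fun x => `[< exists y, x = mzvZ [:: 2%N] * y >].

Lemma zeta2_pred_zmod : zmod_closed zeta2_pred.
Proof.
split=> [|x y /asboolP[x' ->] /asboolP[y' ->]]; apply/asboolP.
  by exists 0; rewrite mulr0.
by exists (x' - y'); rewrite mulrBr.
Qed.

HB.instance Definition _ :=
  GRing.isZmodClosed.Build mzvalg zeta2_pred zeta2_pred_zmod.

(* Z / zeta(2) Z as a Q-vector space.  It cannot be an {ideal_quot _}, which
   requires a proof that the ideal is proper: whether zeta(2) is invertible in
   Z is an open problem. *)
Definition mzvbar : Type := Quotient.quot zeta2_pred.

HB.instance Definition _ := GRing.Zmodule.on mzvbar.

Definition to_mzvbar (x : mzvalg) : mzvbar := \pi_(Quotient.quot zeta2_pred) x.

Lemma to_mzvbar_eq (x y : mzvalg) :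
  to_mzvbar x = to_mzvbar y <-> exists z, x - y = mzvZ [:: 2%N] * z.
Proof.
have -> : to_mzvbar x = to_mzvbar y <-> x - y \in zeta2_pred.
  by rewrite Quotient.idealrBE; split=> [xy|/eqP //]; apply/eqP.
by split=> /asboolP.
Qed.

Lemma to_mzvbarD x y : to_mzvbar (x + y) = to_mzvbar x + to_mzvbar y.
Proof. exact: raddfD. Qed.

Definition scale_mzvbar (c : rat) (x : mzvbar) : mzvbar :=
  to_mzvbar (c *: repr x).

Lemma to_mzvbar_repr (x : mzvbar) : to_mzvbar (repr x) = x.
Proof. exact: reprK. Qed.

Lemma scale_to_mzvbar c x : scale_mzvbar c (to_mzvbar x) = to_mzvbar (c *: x).
Proof.
have /to_mzvbar_eq[z zE] := to_mzvbar_repr (to_mzvbar x).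
apply/to_mzvbar_eq; exists (c *: z); rewrite -scalerBr zE.
by apply: val_inj; rewrite /= mulrCA.
Qed.

Lemma scale_mzvbarA c d x :
  scale_mzvbar c (scale_mzvbar d x) = scale_mzvbar (c * d) x.
Proof. by rewrite -(to_mzvbar_repr x) !scale_to_mzvbar scalerA. Qed.
Lemma scale_mzvbar1 : left_id 1 scale_mzvbar.
Proof. by move=> x; rewrite -(to_mzvbar_repr x) scale_to_mzvbar scale1r. Qed.
Lemma scale_mzvbarDr : right_distributive scale_mzvbar +%R.
Proof.
move=> c x y; rewrite -(to_mzvbar_repr x) -(to_mzvbar_repr y) -to_mzvbarD.
by rewrite !scale_to_mzvbar scalerDr to_mzvbarD.
Qed.
Lemma scale_mzvbarDl x : {morph scale_mzvbar^~ x : c d / c + d}.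
Proof.
move=> c d; rewrite -(to_mzvbar_repr x).
by rewrite !scale_to_mzvbar scalerDl to_mzvbarD.
Qed.

HB.instance Definition _ := GRing.Zmodule_isLmodule.Build rat mzvbar
  scale_mzvbarA scale_mzvbar1 scale_mzvbarDr scale_mzvbarDl.

End MultipleZetaValues.

(* A product of two indices is a sum of indices, given here as the list of its
   terms, with repetitions. *)

Inductive regularization := Harmonic | Shuffle.

Fixpoint harmonic_product (u : seq nat) : seq nat -> seq (seq nat) :=
  if u is x :: u' then
    fix harmonic_u (v : seq nat) :=
      if v is y :: v' then
        [seq x :: w | w <- harmonic_product u' v] ++
        [seq y :: w | w <- harmonic_u v'] ++
        [seq (x + y)%N :: w | w <- harmonic_product u' v']
      else [:: u]
  else fun v => [:: v].

Fixpoint word_shuffle (T : Type) (u : seq T) : seq T -> seq (seq T) :=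
  if u is x :: u' then
    fix shuffle_u (v : seq T) :=
      if v is y :: v' then
        [seq x :: w | w <- word_shuffle u' v] ++
        [seq y :: w | w <- shuffle_u v']
      else [:: u]
  else fun v => [:: v].

(* With true for x_1 = dt/(1-t) and false for x_0 = dt/t, the iterated integral
   of zeta(k_1, ..., k_r) over 0 < t_1 < t_2 < ... < 1 has the word
   x_1 x_0^(k_1 - 1) ... x_1 x_0^(k_r - 1). *)
Definition word_of_index (k : seq nat) : seq bool :=
  flatten [seq true :: nseq x.-1 false | x <- k].

Definition index_of_word (w : seq bool) : seq nat :=
  (foldr (fun b nk => if b then (0%N, nk.1.+1 :: nk.2) else (nk.1.+1, nk.2))
    (0%N, [::]) w).2.

Definition shuffle_product (u v : seq nat) : seq (seq nat) :=
  [seq index_of_word w | w <- word_shuffle (word_of_index u) (word_of_index v)].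

Definition index_product (reg : regularization) :=
  match reg with
  | Harmonic => harmonic_product
  | Shuffle => shuffle_product
  end.

Definition trailing_ones (k : seq nat) : nat := find (predC1 1%N) (rev k).

(* zeta^reg is the homomorphism for index_product reg that extends zeta and
   vanishes on the index (1).  If k ends with exactly n > 0 ones and k' is k
   without its last entry, (1) times k' is n k plus indices with fewer trailing
   ones, and its image is 0; this determines zeta^reg(k) recursively. *)
Section SymmetricMultipleZetaValues.
Variables (R : realType) (reg : regularization).

Fixpoint zeta_reg_rec (n : nat) (k : seq nat) : mzvalg R :=
  if n is n'.+1 then
    if trailing_ones k == 0%N then mzvZ R k
    else - ((trailing_ones k)%:R^-1 : rat) *:
      \sum_(l <- index_product reg [:: 1%N] (take (size k).-1 k) | l != k)
        zeta_reg_rec n' l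
  else mzvZ R k.

Definition zeta_reg (k : seq nat) : mzvalg R :=
  zeta_reg_rec (trailing_ones k) k.

Lemma zeta_reg_admissible k : admissible k -> zeta_reg k = mzvZ R k.
Proof.
rewrite /zeta_reg /trailing_ones.
case/lastP: k => [|k x] // /andP[_]; rewrite last_rcons rev_rcons /= => x_gt1.
by rewrite (gtn_eqF x_gt1).
Qed.

Lemma zeta_reg_nil : zeta_reg [::] = 1.
Proof.
rewrite zeta_reg_admissible //; apply: val_inj; rewrite /= /mzv /admissible /=.
apply: lim_near_cst => //; near=> N.
rewrite /trunc_zeta (big_pred1 [tuple]) ?big_ord0 // => m.
by rewrite tuple0 /= eqxx.
Unshelve. all: by end_near. Qed.

Lemma zeta_reg_one : zeta_reg [:: 1%N] = 0.
Proof.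
have prod1 : index_product reg [:: 1%N] [::] = [:: [:: 1%N]] by case: reg.
by rewrite /zeta_reg /= prod1 big_cons big_nil scaler0.
Qed.

Definition zetaS1 (k : seq nat) : mzvbar R :=
  to_mzvbar (\sum_(i < (size k).+1)
    (-1) ^+ sumn (drop i k) * zeta_reg (take i k) * zeta_reg (rev (drop i k))).

(* All the indices k_1 [] ... [] k_r with each [] replaced by a comma or a
   plus. *)
Fixpoint box_sums_from (x : nat) (k : seq nat) : seq (seq nat) :=
  if k is y :: k' then
    [seq x :: l | l <- box_sums_from y k'] ++ box_sums_from (x + y)%N k'
  else [:: [:: x]].

Definition box_sums (k : seq nat) : seq (seq nat) :=
  if k is x :: k' then box_sums_from x k' else [:: [::]].

Definition zeta_starS1 (k : seq nat) : mzvbar R :=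
  \sum_(l <- box_sums k) zetaS1 l.

End SymmetricMultipleZetaValues.

Definition frakZ_S1 (R : realType) (k : nat) : mzvbar R :=
  to_mzvbar (mzvZ R [:: k]).

(* Main.v *)
(** Writing P_m(z) for the product of the 1 - z / j^2 over 0 < j < m, and Q_m(t) for
    the product of the 1 - t / j^2 over m < j < N, the sum of ({2}^a, 3, {2}^b)
    truncated at N is, up to sign, the coefficient of z^a t^b in the sum of
    m^-3 P_m(z) Q_m(t).

    Modulo a prime p = 2h + 1, the reflection m -> p - m reduces this sum to m <= h,
    where the complete product is 1 - z^h and Q_m is recovered by interpolation from
    its values at the squares k^2.  The values at t = k^2 telescope in m and in k,
    which leaves double power sums that Faulhaber's formula evaluates.

    For the symmetric values, put t = u^2 and let N go to infinity.  Following Zagier's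
    method, the function T(y), a sum of m^-3 P_m(z) divided by the product of the
    1 - y^2 / j^2 over j <= m, satisfies a first-order difference equation in y.
    Summing it over y = u + n and y = -u + n expresses the generating function
    through {2}^i values and the power sums of (n + u)^-s and (n - u)^-s; comparing
    the coefficients of u^(2b+1) and dropping the multiples of zeta(2) leaves a
    rational multiple of zeta(2a + 2b + 3).

    The star values follow in both cases from the antipode relation between sums
    with weak and strict inequalities, modulo the values at {2}^n with n > 0. *)

Require Import Defs.
From mathcomp Require Import all_boot all_order all_algebra reals.
From mathcomp Require Import boolp classical_sets topology normedtype sequences.
From mathcomp Require Import finfield zify ring lra.

Set Implicit Arguments.
Unset Strict Implicit.
Unset Printing Implicit Defensive.

Import Order.TTheory GRing.Theory Num.Theory numFieldNormedType.Exports.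

Local Open Scope ring_scope.

(** * Truncated sums *)

(** Neither pi nor the sine function occurs. The limit q(u) of the product of the 1 - u^2 / j^2
    enters only through bounds, its Taylor coefficients (signed values at {2}^i) and the sign change
    of u q(u) under u -> u + 1. This keeps all identities over Q among multiple zeta values, as
    membership in zeta(2) Z demands; for the same reason zeta(2n) reaches the ideal through the
    convolution of the products zeta(2k) zeta(2n - 2k). Three limits follow each other: the
    truncation n to infinity, the number M of shifts to infinity, u to 0. So the remainder after M
    shifts must be O(1 / M) uniformly in n, and the Taylor errors O(u^B) uniformly in M. Both halves
    use one telescoping certificate, at an integer k modulo p and at a non-integer y over R; modulo
    p its boundary term closes up because 2h + 1 = 0. Modulo zeta(2), a single zeta({2}^a, 3, {2}^b)
    of weight w still carries the factor 2^(1-w) of the alternating sums. That part is symmetric in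
    a and b, up to the common sign, and cancels against the reversed index. *)

Section MultipleHarmonicSums.
Variable F : fieldType.
Implicit Types (star : bool) (N L m n x y : nat) (k l u v : seq nat).

(* The entries of the index are read from the largest summation variable down,
   the opposite of the convention for trunc_zeta. *)
Fixpoint mhs star N k : F :=
  if k is x :: k' then
    \sum_(1 <= m < N) m%:R ^- x * mhs star (m + star) k'
  else 1.

Fixpoint mhs_from star L N k : F :=
  if k is x :: k' then
    \sum_(L <= m < N) m%:R ^- x * mhs_from star (m + ~~ star) N k'
  else 1.

Lemma exchange_big_chain star L N (f : nat -> nat -> F) :
  \sum_(L <= m < N) \sum_(m + ~~ star <= n < N) f m n =
  \sum_(L <= n < N) \sum_(L <= m < n + star) f m n.
Proof.
transitivity (\sum_(L <= m < N) \sum_(L <= n < N | (m + ~~ star <= n)%N) f m n).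
  apply: eq_big_nat => m /andP[leLm _]; rewrite (@big_nat_widenl _ _ _ _ L) //.
  by apply: leq_trans leLm _; apply: leq_addr.
rewrite (exchange_big_dep_nat predT) //=.
apply: eq_big_nat => n /andP[leLn ltnN].
rewrite [RHS](@big_nat_widen _ _ _ _ _ N); last by case: star; lia.
by apply: eq_bigl => m; case: star; lia.
Qed.

Lemma mhs_from_rcons star L N k x :
  mhs_from star L N (rcons k x) =
  \sum_(L <= m < N) m%:R ^- x * mhs_from star L (m + star) k.
Proof.
elim: k L => [|y k IHk] L //=.
transitivity (\sum_(L <= m < N) \sum_(m + ~~ star <= n < N)
   m%:R ^- y * (n%:R ^- x * mhs_from star (m + ~~ star) (n + star) k)).
  by apply: eq_bigr => m _; rewrite IHk mulr_sumr.
rewrite exchange_big_chain; apply: eq_bigr => n _; rewrite mulr_sumr.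
by apply: eq_bigr => m _; rewrite mulrCA.
Qed.

Lemma mhs_from_rev star N k : mhs_from star 1 N (rev k) = mhs star N k.
Proof.
elim: k N => [|x k IHk] N //=; rewrite rev_cons mhs_from_rcons.
by apply: eq_bigr => m _; rewrite IHk.
Qed.

(** One relation [m + ~~ star <= n] covers both kinds of chains. [L] stands for the entry before the
    chain: 0 in the strict case and 1 in the weak one, so that [L + ~~ star] is 1 in both. *)
Lemma sum_path star L N k :
  \sum_(t : (size k).-tuple 'I_N |
      path (fun m n => (m + ~~ star <= n)%N) L [seq val i | i <- t])
    \prod_(j < size k) (tnth t j)%:R ^- nth 0%N k j =
  mhs_from star (L + ~~ star) N k.
Proof.
elim: k L => [|x k IHk] L /=.
  by rewrite (big_pred1 [tuple]) ?big_ord0 // => t; rewrite tuple0 /= eqxx.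
pose cons2 (p : 'I_N * (size k).-tuple 'I_N) := [tuple of p.1 :: p.2].
rewrite (reindex cons2); last first.
  exists (fun t => (thead t, [tuple of behead t])).
    by move=> [i t] _; congr pair; apply: val_inj.
  by move=> t _; rewrite /cons2 /= [RHS]tuple_eta.
rewrite (eq_bigl (fun p : 'I_N * (size k).-tuple 'I_N => (L + ~~ star <= p.1)%N &&
    path (fun m n => (m + ~~ star <= n)%N) p.1 [seq val i | i <- p.2])) //.
rewrite -(pair_big_dep (fun i : 'I_N => (L + ~~ star <= i)%N)
   (fun i (t : (size k).-tuple 'I_N) =>
    path (fun m n => (m + ~~ star <= n)%N) i [seq val i | i <- t])
   (fun i t => \prod_(j < (size k).+1)
     (tnth (cons2 (i, t)) j)%:R ^- nth 0%N (x :: k) j)) /=.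
transitivity (\sum_(i < N | (L + ~~ star <= i)%N)
    (i%:R : F) ^- x * mhs_from star (i + ~~ star) N k).
  apply: eq_bigr => i _; rewrite -IHk mulr_sumr; apply: eq_bigr => t _.
  rewrite big_ord_recl tnth0; congr (_ * _).
  by apply: eq_bigr => j _; rewrite tnthS.
rewrite -(big_mkord (fun i => (L + ~~ star <= i)%N)
  (fun i => i%:R ^- x * mhs_from star (i + ~~ star) N k)).
by rewrite [RHS](@big_nat_widenl _ _ _ _ 0%N).
Qed.

Lemma trunc_zeta_mhs N k : trunc_zeta F N k = mhs false N (rev k).
Proof.
rewrite -mhs_from_rev revK -(sum_path false 0); apply: eq_bigl => t.
by apply: eq_path => m n; rewrite addn1.
Qed.

Lemma trunc_zeta_star_mhs N k : trunc_zeta_star F N k = mhs true N (rev k).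
Proof.
rewrite -mhs_from_rev revK -(sum_path true 1); apply: eq_bigl => t.
by apply: eq_path => m n; rewrite addn0.
Qed.

(** Compare the largest variable of the weak chain with that of the strict one: each product splits
    in two, according to the chain that owns the top variable, and the alternating sum
    telescopes. *)
Lemma mhs_antipode N k : k != [::] ->
  \sum_(j < (size k).+1)
    (-1) ^+ j * (mhs true N (rev (take j k)) * mhs false N (drop j k)) = 0.
Proof.
(* [B u x v] has the variable [m] of [x] on top, a weak chain for [u] up to [m] and a strict chain
   for [v] below [m]. *)
pose B u x v := \sum_(1 <= m < N)
  m%:R ^- x * (mhs true m.+1 u * mhs false m v).
have mulB x u y v : mhs true N (x :: u) * mhs false N (y :: v) =
    B (x :: u) y v + B u x (y :: v).
  rewrite /= big_distrlr /=.
  transitivity (\sum_(1 <= m < N) (\sum_(m <= n < N)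
      m%:R ^- x * mhs true (m + 1) u * (n%:R ^- y * mhs false (n + 0) v) +
      \sum_(1 <= n < m)
      m%:R ^- x * mhs true (m + 1) u * (n%:R ^- y * mhs false (n + 0) v))).
    apply: eq_big_nat => m /andP[m1 mN].
    by rewrite addrC -big_cat_nat //; apply: ltnW.
  rewrite big_split /=; congr (_ + _).
    transitivity (\sum_(1 <= m < N) \sum_(m + ~~ true <= n < N)
        m%:R ^- x * mhs true (m + 1) u * (n%:R ^- y * mhs false n v)).
      by apply: eq_bigr => m _; rewrite addn0; apply: eq_bigr => n _; rewrite addn0.
    rewrite exchange_big_chain; apply: eq_bigr => n _.
    rewrite -mulr_suml mulrCA addn1; congr (_ * (_ * _)).
  by apply: eq_bigr => m _; rewrite -mulr_sumr addn1 !mulrA.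
have sumB u x v : \sum_(j < (size v).+1) (-1) ^+ j *
    (mhs true N (catrev (take j v) (x :: u)) * mhs false N (drop j v)) =
    B u x v.
  elim: v u x => [|y v IHv] u x.
    rewrite big_ord_recl big_ord0 /= addr0 mul1r mulr1.
    by apply: eq_bigr => m _; rewrite addn1 mulr1.
  rewrite big_ord_recl expr0 mul1r take0 drop0 mulB -[RHS]addr0 addrAC addrC.
  congr (_ + _); rewrite -[X in X + _]IHv -big_split big1 // => j _ /=.
  by rewrite exprS mulN1r mulNr subrr.
case: k => [//|y v _]; rewrite big_ord_recl expr0 mul1r take0 drop0 mul1r.
have -> : mhs false N (y :: v) = B [::] y v.
  by apply: eq_bigr => m _; rewrite addn0 mul1r.
rewrite -sumB -big_split big1 // => j _ /=.
by rewrite exprS mulN1r mulNr subrr.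
Qed.

End MultipleHarmonicSums.

Section BoxSums.
Variable F : fieldType.
Implicit Types (N L m n x y : nat) (k l : seq nat).

(** A weak inequality is a strict one or an equality, and equal variables add their exponents, which
    is the plus. *)
Lemma mhs_box N k :
  \sum_(l <- box_sums k) mhs F false N l = mhs F true N k.
Proof.
case: k => [|x k]; first by rewrite big_seq1.
elim: k x N => [|y k IHk] x N; first by rewrite big_seq1.
rewrite /= big_cat big_map /= exchange_big /=.
have /= -> := IHk (x + y)%N N.
rewrite -big_split /=; apply: eq_big_nat => m /andP[m1 _].
rewrite -mulr_sumr exprD invfM -mulrA -mulrDr; congr (_ * _).
have /= -> := IHk y (m + 0)%N.
by rewrite addn0 [in RHS]addn1 big_nat_recr.
Qed.

Lemma mhs_from_box L N k :
  \sum_(l <- box_sums k) mhs_from F false L N l = mhs_from F true L N k.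
Proof.
case: k => [|x k]; first by rewrite big_seq1.
elim: k x L => [|y k IHk] x L; first by rewrite big_seq1.
rewrite /= big_cat big_map /= exchange_big /=.
have /= -> := IHk (x + y)%N L.
rewrite -big_split /=; apply: eq_big_nat => m /andP[_ ltmN].
rewrite -mulr_sumr exprD invfM -mulrA -mulrDr; congr (_ * _).
have /= -> := IHk y (m + 1)%N.
by rewrite addn0 addrC addn1 [in RHS]big_ltn // addn0.
Qed.

Lemma mhs_rev_box N k :
  \sum_(l <- box_sums k) mhs F false N (rev l) = mhs F true N (rev k).
Proof.
rewrite -mhs_from_rev revK -mhs_from_box; apply: eq_bigr => l _.
by rewrite -mhs_from_rev revK.
Qed.

(** A cut of a box sum falls on one of its commas or at an end, so it comes from exactly one cut of
    [k], and the boxes on the two sides are filled independently. *)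
Lemma box_sums_split (V : nmodType) (phi : seq nat -> seq nat -> V) k :
  \sum_(l <- box_sums k) \sum_(i < (size l).+1) phi (take i l) (drop i l) =
  \sum_(j < (size k).+1) \sum_(u <- box_sums (take j k))
    \sum_(v <- box_sums (drop j k)) phi u v.
Proof.
case: k => [|x k].
  by rewrite big_seq1 !big_ord1 /= !big_seq1.
rewrite [RHS]big_ord_recl /= big_seq1.
elim: k x phi => [|y k IHk] x phi.
  by rewrite /= !big_seq1 big_ord_recl !big_ord1.
rewrite [in LHS]/= big_cat big_map /= IHk.
under eq_bigr do rewrite big_ord_recl /=.
rewrite big_split /= (IHk y (fun u v => phi (x :: u) v)).
rewrite [in RHS]big_ord_recl /= big_seq1.
under [X in _ = _ + (_ + X)]eq_bigr do rewrite big_cat big_map /=.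
rewrite [X in _ = _ + (_ + X)]big_split [X in _ = X + _]big_cat big_map /=.
rewrite -!addrA; congr (_ + _).
by rewrite [RHS]addrCA; congr (_ + _); rewrite addrCA.
Qed.

End BoxSums.

Section SineProduct.
Variable F : fieldType.
Implicit Types (L N m n a b : nat) (k l : seq nat).

Definition sine_prod L N : {poly F} :=
  \prod_(L <= j < N) (1 - j%:R ^- 2 *: 'X).

Lemma sine_prod_recr L N : (L <= N)%N ->
  sine_prod L N.+1 = sine_prod L N * (1 - N%:R ^- 2 *: 'X).
Proof. exact: big_nat_recr. Qed.

Lemma sine_prod_nil L N : (N <= L)%N -> sine_prod L N = 1.
Proof. exact: big_geq. Qed.

Lemma coef_mul_sub1X (p : {poly F}) c n :
  (p * (1 - c *: 'X))`_n.+1 = p`_n.+1 - c * p`_n.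
Proof. by rewrite mulrBr mulr1 -scalerAr coefB coefZ coefMX. Qed.

Lemma coef0_mul_sub1X (p : {poly F}) c : (p * (1 - c *: 'X))`_0 = p`_0.
Proof. by rewrite mulrBr mulr1 -scalerAr coefB coefZ coefMX mulr0 subr0. Qed.

Lemma coef0_sine_prod L N : (sine_prod L N)`_0 = 1.
Proof.
rewrite /sine_prod coef0_prod big1 // => j _.
by rewrite coefB coef1 coefZ coefX mulr0 subr0.
Qed.

(** The left side is the elementary symmetric function of degree [a] in the [j^-2]. *)
Lemma mhs_twos N a :
  mhs F false N (nseq a 2%N) = (-1) ^+ a * (sine_prod 1 N)`_a.
Proof.
elim: a N => [|a IHa] N; first by rewrite coef0_sine_prod mulr1.
case: N => [|N]; first by rewrite /= big_geq // sine_prod_nil // coef1 mulr0.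
elim: N => [|N IHN]; first by rewrite /= big_geq // sine_prod_nil // coef1 mulr0.
rewrite sine_prod_recr // coef_mul_sub1X mulrBr -IHN /= big_nat_recr //=.
by rewrite addn0 IHa [in RHS]exprS mulN1r mulNr opprK [in RHS]mulrCA.
Qed.

(** The [b] leading twos have variables above the variable [m] of [x], hence the product over
    [m < j < N]. *)
Lemma mhs_twos_cat N b x l :
  mhs F false N (nseq b 2%N ++ x :: l) =
  (-1) ^+ b *
    \sum_(1 <= m < N) m%:R ^- x * (sine_prod m.+1 N)`_b * mhs F false m l.
Proof.
elim: b N => [|b IHb] N.
  rewrite mul1r; apply: eq_bigr => m _.
  by rewrite addn0 coef0_sine_prod mulr1.
case: N => [|N]; first by rewrite /= !big_geq // mulr0.
elim: N => [|N IHN]; first by rewrite /= !big_geq // mulr0.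
have -> : mhs F false N.+2 (nseq b.+1 2%N ++ x :: l) =
  mhs F false N.+1 (nseq b.+1 2%N ++ x :: l) +
  N.+1%:R ^- 2 * mhs F false N.+1 (nseq b 2%N ++ x :: l).
  by rewrite /= big_nat_recr //= addn0.
rewrite IHN IHb [in RHS]big_nat_recr //= sine_prod_nil // coef1 mulr0 mul0r addr0.
rewrite exprS !mulN1r !mulNr (mulrCA (N.+1%:R ^- 2)) -[X in _ + X]opprK -opprD.
congr (- _); rewrite -mulrBr; congr (_ * _).
rewrite mulr_sumr -sumrB; apply: eq_big_nat => m /andP[_ ltmN].
rewrite (@sine_prod_recr _ N.+1) // coef_mul_sub1X mulrBr mulrBl; congr (_ - _).
by rewrite -!mulrA mulrCA.
Qed.

Lemma mhs_twos_three_twos N a b :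
  mhs F false N (nseq b 2%N ++ 3%N :: nseq a 2%N) =
  (-1) ^+ (a + b) * \sum_(1 <= m < N)
    m%:R ^- 3 * (sine_prod 1 m)`_a * (sine_prod m.+1 N)`_b.
Proof.
rewrite mhs_twos_cat addnC exprD -mulrA; congr (_ * _); rewrite mulr_sumr.
apply: eq_bigr => m _; rewrite mhs_twos.
by rewrite mulrCA -!mulrA; congr (_ * (_ * _)); rewrite mulrC.
Qed.

End SineProduct.

(** * Sums modulo a prime *)

Section PrimeField.
Variables (p : nat) (p_pr : prime p).
Local Notation F := 'F_p.
Implicit Types (m n j k a b e : nat).

Lemma Fp_nat_eq0 n : (n%:R == 0 :> F) = (p %| n)%N.
Proof. by rewrite (dvdn_pcharf (pchar_Fp p_pr)). Qed.

Lemma Fp_nat_neq0 n : (0 < n < p)%N -> n%:R != 0 :> F.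
Proof. by move=> /andP[n0 np]; rewrite Fp_nat_eq0 gtnNdvd. Qed.

Lemma Fp_nat_sub n : (n <= p)%N -> (p - n)%:R = - n%:R :> F.
Proof.
move=> le_np; rewrite natrB // (_ : p%:R = 0) ?sub0r //.
by apply/eqP; rewrite Fp_nat_eq0.
Qed.

Lemma Fp_fermat (x : F) : x != 0 -> x ^+ p.-1 = 1.
Proof.
move=> x0; apply: (mulfI x0); rewrite -exprS prednK ?prime_gt0 // mulr1.
by rewrite -[RHS]expf_card card_Fp.
Qed.

Lemma uniq_Fp_nats : uniq [seq m%:R : F | m <- index_iota 1 p].
Proof.
rewrite map_inj_in_uniq ?iota_uniq // => m n; rewrite !mem_index_iota.
move=> /andP[_ mp] /andP[_ np] /(congr1 val) /=.
by rewrite !val_Fp_nat // !modn_small.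
Qed.

Lemma sum_Fp_neq0 (f : F -> F) :
  \sum_(x : F | x != 0) f x = \sum_(1 <= m < p) f m%:R.
Proof.
have p0 := prime_gt0 p_pr.
transitivity (\sum_(x <- [seq m%:R : F | m <- index_iota 1 p]) f x); last first.
  by rewrite big_map.
rewrite -big_filter; apply: perm_big; apply: uniq_perm.
- by rewrite filter_uniq // index_enum_uniq.
- exact: uniq_Fp_nats.
move=> x; rewrite mem_filter mem_index_enum andbT.
apply/idP/mapP => [x0|[m]]; last first.
  by rewrite mem_index_iota => /Fp_nat_neq0 m0 ->.
exists (val x); last by rewrite natr_Zp.
rewrite mem_index_iota; apply/andP; split.
  by rewrite lt0n; apply: contraNneq x0 => x0; apply/eqP/val_inj.
by have := ltn_ord x; rewrite [X in (_ < X)%N]Fp_cast.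
Qed.

(** Otherwise all [p - 1] nonzero residues would be roots of unity of the smaller order
    [e %% p.-1]. *)
Lemma ex_Fp_expr_neq1 e : ~~ (p.-1 %| e)%N -> exists2 c : F, c != 0 & c ^+ e != 1.
Proof.
move=> Ndv; apply/exists_inP; apply: contraNT Ndv; rewrite negb_exists_in => /forall_inP all1.
have p1 : (0 < p.-1)%N by have := prime_gt1 p_pr; lia.
have {}all1 (c : F) : c != 0 -> c ^+ (e %% p.-1) = 1.
  move=> c0; have /negPn/eqP <- := all1 c c0.
  by rewrite [in RHS](divn_eq e p.-1) exprD mulnC exprM Fp_fermat // expr1n mul1r.
rewrite /dvdn -leqn0 leqNgt; apply/negP => e0.
have : (size [seq m%:R : F | m <- index_iota 1 p] <= e %% p.-1)%N.
  apply: max_unity_roots e0 _ uniq_Fp_nats.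
  apply/allP => x /mapP[m]; rewrite mem_index_iota => /Fp_nat_neq0 m0 ->.
  by rewrite unity_rootE all1.
by rewrite size_map size_iota subn1 leqNgt ltn_pmod.
Qed.

(** If [p - 1] does not divide [e], multiplication by some [c] with [c^e != 1] permutes the nonzero
    residues and multiplies the sum by [c^e]. *)
Lemma sum_powers_Fp e :
  \sum_(1 <= m < p) (m%:R : F) ^+ e = - (p.-1 %| e)%N%:R.
Proof.
have [/dvdnP[q ->]|Ndv] := boolP (p.-1 %| e)%N.
  transitivity (\sum_(1 <= m < p) (1 : F)).
    apply: eq_big_nat => m mp; rewrite mulnC exprM Fp_fermat ?expr1n //.
    exact: Fp_nat_neq0.
  rewrite sumr_const_nat natrB ?prime_gt0 // (_ : p%:R = 0) ?sub0r //.
  by apply/eqP; rewrite Fp_nat_eq0.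
have [c c0 ce] := ex_Fp_expr_neq1 Ndv.
rewrite -(sum_Fp_neq0 (fun x => x ^+ e)) oppr0.
set S := \sum_(x | _) _.
have : c ^+ e * S = S.
  rewrite /S mulr_sumr [RHS](reindex_inj (mulfI c0)) /=.
  apply: eq_big => [x|x _]; first by rewrite mulf_eq0 (negPf c0).
  by rewrite exprMn.
move/eqP; rewrite -subr_eq0 -{2}(mul1r S) -mulrBl mulf_eq0 subr_eq0.
by rewrite (negPf ce) => /eqP.
Qed.

End PrimeField.

Lemma sine_prod_recl (F : fieldType) L N : (L < N)%N ->
  sine_prod F L N = (1 - L%:R ^- 2 *: 'X) * sine_prod F L.+1 N.
Proof. by move=> ltLN; rewrite /sine_prod big_ltn. Qed.

Lemma size_sine_prod (F : fieldType) L N : (size (sine_prod F L N) <= (N - L).+1)%N.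
Proof.
rewrite /sine_prod; elim: N => [|N IHN]; first by rewrite big_geq // size_poly1.
have [leLN|ltNL] := leqP L N; last by rewrite big_geq // size_poly1.
rewrite big_nat_recr //= subSn //; apply: leq_trans (size_polyMleq _ _) _.
set q := (1 - _); have : (size q <= 2)%N.
  apply: leq_trans (size_polyD _ _) _; rewrite size_poly1 size_polyN geq_max /=.
  by apply: leq_trans (size_scale_leq _ _) _; rewrite size_polyX.
rewrite -/(sine_prod F L N) in IHN *.
by move: IHN; move: (size (sine_prod F L N)) (size q) => s t; lia.
Qed.

Lemma sum_nat_reflect (V : nmodType) h (f : nat -> V) :
  \sum_(1 <= m < h.*2.+1) f m = \sum_(1 <= m < h.+1) (f m + f (h.*2.+1 - m)%N).
Proof.
rewrite big_split /= (@big_cat_nat _ _ _ h.+1) //=; last by lia.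
congr (_ + _); rewrite -[in LHS](add1n h) big_addn.
rewrite (_ : h.*2.+1 - h = h.+1)%N; last by lia.
rewrite big_nat_rev /=; apply: eq_big_nat => m /andP[m1 mh].
by congr f; lia.
Qed.

(** * Half-range sums and interpolation at the squares *)

Section HalfRange.
Variables (p : nat) (p_pr : prime p) (h : nat) (pE : p = h.*2.+1).
Local Notation F := 'F_p.
Local Notation P := (sine_prod F 1).
Local Notation Q := (fun m => sine_prod F m.+1 h.+1).
Implicit Types (m n j k a b e : nat).

Let neq0 n : (0 < n < p)%N -> n%:R != 0 :> F.
Proof. exact: Fp_nat_neq0. Qed.

Let h_gt0 : (0 < h)%N.
Proof. by move: p_pr; rewrite pE; case: h. Qed.

Let two_h : 2 * h%:R + 1 = 0 :> F.
Proof.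
rewrite -natrM natr1 mul2n -pE; apply/eqP; rewrite Fp_nat_eq0 //.
Qed.

Lemma sqr_half k : (0 < k < p)%N -> ((k%:R : F) ^+ 2) ^+ h = 1.
Proof.
move=> kp; rewrite -exprM mul2n (_ : h.*2 = p.-1) ?pE //.
by rewrite -pE Fp_fermat // neq0.
Qed.

Lemma half_sum_powers e :
  2 * \sum_(1 <= k < h.+1) ((k%:R : F) ^+ 2) ^+ e = - (h %| e)%N%:R.
Proof.
transitivity (\sum_(1 <= m < p) (m%:R : F) ^+ e.*2).
  rewrite pE sum_nat_reflect -pE mulr_sumr; apply: eq_big_nat => k /andP[_ kh].
  rewrite Fp_nat_sub; [|done|by lia].
  by rewrite -mul2n !exprM sqrrN mulrDl mul1r.
by rewrite sum_powers_Fp // pE /= -!mul2n dvdn_pmul2l.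
Qed.

(** The squares [k^2] with [0 < k <= h] are the [h]-th roots of unity, so this is the inverse
    discrete Fourier transform; the factor -2 is [1 / h] modulo [p]. *)
Lemma coef_half_interpolation (q : {poly F}) b : (size q <= h)%N -> (b < h)%N ->
  q`_b = - 2 * \sum_(1 <= k < h.+1) k%:R ^- (2 * b) * q.[k%:R ^+ 2].
Proof.
move=> q_h b_h.
have -> : \sum_(1 <= k < h.+1) k%:R ^- (2 * b) * q.[k%:R ^+ 2] =
    \sum_(i < h) q`_i * \sum_(1 <= k < h.+1) ((k%:R : F) ^+ 2) ^+ (i + (h - b)).
  under [RHS]eq_bigr do rewrite mulr_sumr.
  rewrite exchange_big /=; apply: eq_big_nat => k /andP[k0 kh].
  have kp : (0 < k < p)%N by rewrite k0 pE; lia.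
  rewrite (horner_coef_wide _ q_h) mulr_sumr; apply: eq_bigr => i _.
  rewrite mulrCA exprD; congr (_ * _); rewrite mulrC; congr (_ * _).
  apply: (mulIf (expf_neq0 (2 * b) (neq0 kp))).
  rewrite mulVf ?expf_neq0 ?neq0 // -!exprM -exprD -mulnDr subnK ?(ltnW b_h) //.
  by rewrite exprM sqr_half.
rewrite mulNr mulr_sumr (bigD1 (Ordinal b_h)) //= mulrCA half_sum_powers.
rewrite subnKC ?(ltnW b_h) // dvdnn mulrN1 big1 ?addr0 ?opprK // => i neq_ib.
rewrite mulrCA half_sum_powers (negPf (_ : ~~ (h %| _)%N)) ?oppr0 ?mulr0 //.
apply/negP => /dvdnP[r rE]; move/eqP: neq_ib; apply; apply: val_inj => /=.
have := ltn_ord i; case: r rE => [|[|r]]; nia.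
Qed.

(** The squares [k^2] are distinct and exhaust the roots of [X^h - 1]; the constant coefficient 1
    then fixes the scalar. *)
Lemma sine_prod_half : P h.+1 = 1 - 'X^h.
Proof.
pose rs : seq F := [seq k%:R ^+ 2 | k <- index_iota 1 h.+1].
have rs_uniq : uniq rs.
  rewrite map_inj_in_uniq ?iota_uniq // => k l; rewrite !mem_index_iota.
  wlog lt_kl : k l / (k < l)%N => [wlg|] kh lh kl.
    have [lt_kl|lt_lk|//] := ltngtP k l; first exact: wlg.
    by apply/esym/wlg.
  have : (l + k)%:R * (l - k)%:R == 0 :> F.
    by rewrite natrD natrB ?(ltnW lt_kl) // mulrC -subr_sqr kl subrr.
  by rewrite mulf_eq0 !(negPf (neq0 _)) // pE; lia.
have size_h : size ('X^h - 1 : {poly F}) = h.+1 by rewrite size_XnsubC.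
have := @all_roots_prod_XsubC _ ('X^h - 1) rs.
rewrite size_h /rs size_map size_iota subn1 => /(_ erefl).
have -> : lead_coef ('X^h - 1 : {poly F}) = 1.
  by rewrite -[X in _ - X]polyC1 lead_coefXnsubC.
rewrite scale1r big_map => E.
have {}E : 'X^h - 1 = \prod_(1 <= k < h.+1) ('X - ((k%:R : F) ^+ 2)%:P).
  apply: E; last by rewrite uniq_rootsE.
  apply/allP => _ /mapP[k + ->]; rewrite mem_index_iota => kh.
  by rewrite rootE !hornerE sqr_half ?subrr // pE; lia.
pose c : F := \prod_(1 <= k < h.+1) - k%:R ^- 2.
have PE : P h.+1 = c *: ('X^h - 1).
  rewrite E /c -scaler_prod /sine_prod; apply: eq_big_nat => k kh.
  have k0 : (k%:R : F) ^+ 2 != 0 by rewrite expf_neq0 // neq0 // pE; lia.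
  rewrite scalerBr !scaleNr opprK [RHS]addrC; congr (_ - _).
  by rewrite -mul_polyC -polyCM mulVf.
have := coef0_sine_prod F 1 h.+1.
rewrite PE coefZ coefB coefXn coef1 eq_sym (gtn_eqF h_gt0) sub0r mulrN1 => cE.
by rewrite -(opprK c) cE scaleN1r opprB.
Qed.

End HalfRange.

Section HalfRangeInterpolation.
Variables (F : fieldType) (h : nat).
Hypothesis two_h : 2 * h%:R + 1 = 0 :> F.
Hypothesis neq0 : forall n, (0 < n < h.*2.+1)%N -> n%:R != 0 :> F.
Hypothesis sqr_h : forall k, (0 < k < h.*2.+1)%N -> ((k%:R : F) ^+ 2) ^+ h = 1.
Hypothesis sine_h : sine_prod F 1 h.+1 = 1 - 'X^h.
Local Notation P := (sine_prod F 1).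
Local Notation Q := (fun m => sine_prod F m.+1 h.+1).
Implicit Types (m n j k a b e : nat).

(* In characteristic 2h + 1 the product over m < j <= h behaves like a quotient
   of Gamma functions under the shift of y by 1. *)
Lemma sine_prod_shift m (y : F) : (m <= h)%N ->
  (m%:R + y + 1) * (Q m).[(y + 1) ^+ 2] = (y - m%:R) * (Q m).[y ^+ 2].
Proof.
move=> mh; rewrite -(subKn mh); move: (h - m)%N (leq_subr m h) => d.
elim: d => [|d IHd] dh.
  rewrite subn0 sine_prod_nil // !hornerC !mulr1.
  by apply/eqP; rewrite -subr_eq0; apply/eqP; rewrite -two_h; ring.
have := IHd (ltnW dh); rewrite (_ : h - d = (h - d.+1).+1)%N; last by lia.
move: (erefl (h - d.+1)%N); move: {-1}(h - d.+1)%N => n nE {}IHd.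
rewrite (@sine_prod_recl _ n.+1); last by lia.
have n0 : n.+1%:R != 0 :> F by apply: neq0; lia.
rewrite !hornerM !hornerD !hornerN !hornerZ !hornerX !hornerC.
move: IHd; set q0 := (sine_prod _ _ _).[_]; set q1 := _.[y ^+ 2].
move=> IHd; apply: (mulfI (expf_neq0 2 n0)).
rewrite -natr1 in n0 IHd *.
transitivity ((n%:R + 1 + y) * (n%:R - y) * ((n%:R + 1 + y + 1) * q0)).
  by field.
by rewrite IHd; field.
Qed.

(** The expansion of [1 / (k^2 - X)] cut at degree [h]. Since [k^(2h) = 1], the cut amounts exactly
    to the factor [1 - X^h]. *)
Let V k : {poly F} := \poly_(a < h) k%:R ^- (2 * a + 2).

Lemma mul_geom_poly k : (0 < k < h.*2.+1)%N ->
  ((k%:R ^+ 2)%:P - 'X) * V k = 1 - 'X^h.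
Proof.
move=> kh; have k0 := neq0 kh; apply/polyP => i.
have h_gt0 : (0 < h)%N by lia.
rewrite mulrBl coefB coefCM coefXM !coef_poly coefB coef1 coefXn.
case: i => [|i] /=.
  by rewrite h_gt0 add0n mulfV ?expf_neq0 // eq_sym (gtn_eqF h_gt0).
rewrite sub0r; have [lt_ih|lt_hi|eq_ih] := ltngtP i.+1 h.
- rewrite oppr0 (_ : 2 * i.+1 + 2 = 2 + (2 * i + 2))%N; last by lia.
  by rewrite exprD invfM mulrA mulfV ?expf_neq0 // mul1r subrr.
- by rewrite mulr0 subrr oppr0.
- rewrite mulr0 sub0r; congr (- _).
  by rewrite (_ : 2 * i + 2 = 2 * h)%N ?exprM ?sqr_h ?invr1 //; lia.
Qed.

(* The telescoping certificate of the recursion in k, with K = k (k + 1). *)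
Lemma half_telescope k n : (0 < k < h)%N -> (n <= h)%N ->
  let c : {poly F} := (k%:R ^+ 2)%:P - 'X in
  let d : {poly F} := (k.+1%:R ^+ 2)%:P - 'X in
  c * d * \sum_(1 <= m < n.+1)
     ((m%:R ^- 2 * (Q m).[k%:R ^+ 2]) / (m + k.+1)%:R) *: P m =
  ((n.+1 + k * k.+1)%:R - 'X) * P n.+1 * ((Q n).[k%:R ^+ 2] / (n + k.+1)%:R)%:P.
Proof.
move=> kh nh c d.
have sz m : (m <= h)%N -> (m + k.+1)%:R != 0 :> F by move=> mh; apply: neq0; lia.
elim: n nh => [|n IHn] nh.
  (* The lower boundary vanishes: the factor [j = k] of [Q 0] is zero at [k^2]. *)
  rewrite big_geq // mulr0 (_ : (Q 0%N).[_] = 0) ?mul0r ?polyC0 ?mulr0 //.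
  apply/eqP; rewrite horner_prod prodf_seq_eq0; apply/hasP; exists k.
    by rewrite mem_index_iota; lia.
  have k0 : k%:R != 0 :> F by apply: neq0; lia.
  by rewrite /= hornerD hornerN hornerZ hornerX hornerC mulVf ?expf_neq0 // subrr.
rewrite big_nat_recr //= mulrDr IHn ?(ltnW nh) //.
rewrite (@sine_prod_recl _ n.+1) // (@sine_prod_recr _ 1 n.+1) //.
rewrite hornerM !hornerD !hornerN !hornerZ !hornerX !hornerC.
set q := _.[_]; set Pn := P n.+1.
have n0 : n.+1%:R != 0 :> F by apply: neq0; lia.
have s0 := sz n (ltnW nh); have s1 := sz n.+1 nh.
have E0 : (1 - n.+1%:R ^- 2 * k%:R ^+ 2) * q / (n + k.+1)%:R =
   n.+1%:R ^- 2 * (n.+1%:R - k%:R) * q.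
  rewrite natrD -!natr1 in n0 s0 *.
  by field; rewrite s0 n0.
rewrite E0 -!mul_polyC !polyCM !polyCB /c /d.
have iE : (n.+1%:R ^- 2)%:P * (n%:R + 1) ^+ 2 = 1 :> {poly F}.
  by rewrite natr1 -polyC_natr -polyC_exp -polyCM mulVf // expf_neq0.
have rE : ((n.+1 + k.+1)%:R^-1)%:P * (n%:R + k%:R + 2) = 1 :> {poly F}.
  rewrite (_ : _ + 2 = (n.+1 + k.+1)%:R); last by rewrite natrD -!natr1; ring.
  by rewrite -polyC_natr -polyCM mulVf.
move: iE rE; set i := (_ ^- 2)%:P; set r := (_^-1)%:P => iE rE.
rewrite !polyC_exp !polyC_natr !natrD !natrM -!natr1.
set N : {poly F} := n%:R; set kk : {poly F} := k%:R; set X := 'X.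
rewrite -/N -/kk in iE rE.
transitivity (i * q%:P * r * Pn * ((N + 1 + kk * (kk + 1) - X) * (N + 1 - kk) *
  (N + kk + 2) + (kk ^+ 2 - X) * ((kk + 1) ^+ 2 - X))).
  rewrite [in RHS]mulrDr; congr (_ + _); last by ring.
  set A := (_ - X); transitivity (A * Pn * (i * (N + 1 - kk) * q%:P) * (r * (N + kk + 2))).
    by rewrite rE mulr1.
  by rewrite /A; ring.
rewrite -[X in Pn * (X - _)]iE; ring.
Qed.

(** By [sine_prod_shift], [Q m] at [(k + 1)^2] is [(k - m) / (m + k + 1)] times its value at [k^2].
    The difference of the two multiples of [g] therefore has the weights [(2k + 1) m / (m + k + 1)],
    which [half_telescope] sums. At [n = h] the denominator goes away because
    [2k + 1 = 2 (h + k + 1)]. *)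
Lemma half_step k : (0 < k < h)%N ->
  let g k := \sum_(1 <= m < h.+1) (m%:R ^- 3 * (Q m).[k%:R ^+ 2]) *: P m in
  k%:R *: g k = k.+1%:R *: g k.+1 + V k + V k.+1.
Proof.
move=> kh g.
pose c : {poly F} := (k%:R ^+ 2)%:P - 'X.
pose d : {poly F} := (k.+1%:R ^+ 2)%:P - 'X.
have cd0 : c * d != 0.
  by rewrite mulf_neq0 // /c /d -opprB oppr_eq0 polyXsubC_eq0.
apply/eqP; rewrite -subr_eq0; apply/eqP/(mulfI cd0); rewrite mulr0.
have gE : k%:R *: g k - k.+1%:R *: g k.+1 = (2 * k + 1)%:R *: \sum_(1 <= m < h.+1)
     ((m%:R ^- 2 * (Q m).[k%:R ^+ 2]) / (m + k.+1)%:R) *: P m.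
  rewrite /g !scaler_sumr -sumrB; apply: eq_big_nat => m mh.
  rewrite !scalerA -scalerBl; congr (_ *: _).
  have m0 : m%:R != 0 :> F by apply: neq0; lia.
  have s0 : (m + k.+1)%:R != 0 :> F by apply: neq0; lia.
  have := @sine_prod_shift m k%:R; rewrite natr1.
  
  set q0 := _.[k.+1%:R ^+ 2]; set q1 := _.[k%:R ^+ 2] => H.
  have {}H : q0 = (k%:R - m%:R) * q1 / (m + k.+1)%:R.
    apply: (mulIf s0); rewrite mulfVK // -H; last by lia.
    by rewrite natrD -natr1; ring.
  rewrite H natrD -natr1 in s0 *; rewrite natrD natrM.
  by field; rewrite s0.
rewrite -addrA opprD addrA gE mulrBr -mul_polyC mulrCA half_telescope //.
rewrite (@sine_prod_nil _ h.+1) // hornerC mul1r sine_h.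
have -> : c * d * (V k + V k.+1) = (c + d) * (1 - 'X^h).
  have cV : c * V k = 1 - 'X^h by apply: mul_geom_poly; lia.
  have dV : d * V k.+1 = 1 - 'X^h by apply: mul_geom_poly; lia.
  by rewrite [RHS]mulrDl -{1}dV -cV; ring.
have s0 : (h + k.+1)%:R != 0 :> F by apply: neq0; lia.
have tE : ((2 * k + 1)%:R : F)%:P * ((h + k.+1)%:R^-1)%:P = 2 :> {poly F}.
  rewrite -polyCM (_ : (2 * k + 1)%:R = 2 * (h + k.+1)%:R).
    by rewrite mulfK // polyC_natr.
  rewrite (natrD _ (2 * k)) (natrM _ 2 k) (natrD _ h) -natr1.
  by apply/eqP; rewrite -subr_eq0; apply/eqP; rewrite -oppr0 -two_h; ring.
have two_hP : 2 * h%:R + 1 = 0 :> {poly F}.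
  by rewrite -polyC_natr -polyC1 -(polyC_natr _ h) -polyCM -polyCD two_h.
rewrite mulrCA tE /c /d !polyC_exp !polyC_natr.
rewrite natrD (natrM _ k) -!natr1; move: ('X^h) => Xh.
transitivity ((1 - Xh) * (2 * h%:R + 1)); first by ring.
by rewrite two_hP mulr0.
Qed.

(** Descending recursion from [k = h], where [Q m] vanishes at [h^2] for every [m < h] and only the
    term [m = h] remains. *)
Lemma half_interpolation k : (0 < k <= h)%N ->
  k%:R *: \sum_(1 <= m < h.+1) (m%:R ^- 3 * (Q m).[k%:R ^+ 2]) *: P m =
  V k + 2 *: \sum_(k.+1 <= i < h.+1) V i.
Proof.
move=> /andP[k0 kh]; rewrite -(subKn kh) in k0 *.
move: (h - k)%N k0 => d {k kh}; elim: d => [|d IHd] dh.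
  have h0 : (0 < h)%N by lia.
  rewrite subn0 (big_geq (leqnn _)) scaler0 addr0 big_nat_recr //= big_nat big1.
    rewrite add0r sine_prod_nil // hornerC mulr1 scalerA.
    have hX0 : (h%:R ^+ 2)%:P - 'X != 0 :> {poly F}.
      by rewrite -opprB oppr_eq0 polyXsubC_eq0.
    apply: (mulfI hX0); rewrite mul_geom_poly; last by lia.
    have n0 : h%:R != 0 :> F by apply: neq0; lia.
    rewrite -sine_h sine_prod_recr // (_ : h%:R * h%:R ^- 3 = h%:R ^- 2 :> F); last by field.
    have iE : (h%:R ^- 2)%:P * (h%:R ^+ 2)%:P = 1 :> {poly F}.
      by rewrite -polyCM mulVf // expf_neq0.
    by rewrite -!mul_polyC -[X in _ = _ * (X - _)]iE; ring.
  move=> m /andP[m0 mh]; rewrite (_ : (Q m).[_] = 0) ?mulr0 ?scale0r //.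
  apply/eqP; rewrite horner_prod prodf_seq_eq0; apply/hasP; exists h.
    by rewrite mem_index_iota; lia.
  have n0 : h%:R != 0 :> F by apply: neq0; lia.
  by rewrite /= hornerD hornerN hornerZ hornerX hornerC mulVf ?expf_neq0 // subrr.
have kE : (h - d = (h - d.+1).+1)%N by lia.
rewrite half_step; last by lia.
rewrite -kE IHd; last by lia.
rewrite [in RHS]big_ltn -?kE; last by lia.
rewrite scalerDr -!mul_polyC polyC_natr.
move: (\sum_(_ <= i < _) _) => S; ring.
Qed.

(** Interpolation replaces the coefficient of [Q m] by its values at the squares, for which
    [half_interpolation] evaluates the sum over [m]; the coefficient of [X^a] is then read off from
    the [V i]. *)
Lemma half_sum_coef a b : (a < h)%N -> (b < h)%N ->
  (forall q : {poly F}, (size q <= h)%N -> q`_b =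
     - 2 * \sum_(1 <= k < h.+1) k%:R ^- (2 * b) * q.[k%:R ^+ 2]) ->
  \sum_(1 <= m < h.+1) m%:R ^- 3 * (P m)`_a * (Q m)`_b =
  - 2 * \sum_(1 <= k < h.+1) k%:R ^- (2 * b + 1) *
     (k%:R ^- (2 * a + 2) + 2 * \sum_(k.+1 <= i < h.+1) i%:R ^- (2 * a + 2)).
Proof.
move=> ah bh coef_b.
transitivity (- 2 * \sum_(1 <= k < h.+1) k%:R ^- (2 * b) *
   (\sum_(1 <= m < h.+1) (m%:R ^- 3 * (Q m).[k%:R ^+ 2]) *: P m)`_a).
  rewrite mulr_sumr.
  under [RHS]eq_bigr do rewrite coef_sum mulr_sumr mulr_sumr.
  rewrite exchange_big /=; apply: eq_big_nat => m /andP[m0 mh].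
  rewrite coef_b; last by apply: leq_trans (size_sine_prod _ _ _) _; lia.
  rewrite mulrCA !mulr_sumr; apply: eq_bigr => k _; rewrite coefZ.
  by ring.
congr (_ * _); apply: eq_big_nat => k kh.
have k0 : k%:R != 0 :> F by apply: neq0; lia.
have kh' : (0 < k <= h)%N by lia.
have := congr1 (fun q : {poly F} => q`_a) (half_interpolation kh').
rewrite /= coefZ coefD coefZ coef_poly ah => kg.
rewrite exprD expr1 invfM -mulrA; congr (_ * _); apply: (mulfI k0).
rewrite mulVKf // kg; congr (_ + 2 * _); rewrite coef_sum.
by apply: eq_bigr => i _; rewrite coef_poly ah.
Qed.

End HalfRangeInterpolation.

(** * Bernoulli numbers and power sums modulo a prime *)

Lemma bin_mul_swap n i l : (i + l <= n)%N ->
  ('C(n, i) * 'C(n - i, l) = 'C(n, l) * 'C(n - l, i))%N.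
Proof.
move=> il; have H1 : _ = n`! := @bin_fact n i ltac:(lia).
have H2 : _ = (n - i)`! := @bin_fact (n - i) l ltac:(lia).
have H3 : _ = n`! := @bin_fact n l ltac:(lia).
have H4 : _ = (n - l)`! := @bin_fact (n - l) i ltac:(lia).
have xyz : (0 < i`! * l`! * (n - i - l)`!)%N by rewrite !muln_gt0 !fact_gt0.
apply/eqP; rewrite -(eqn_pmul2r xyz); apply/eqP; move: H1 H2 H3 H4 {xyz}.
rewrite (subnAC n l i).
move: ('C(n, i)) ('C(n - i, l)) ('C(n, l)) ('C(n - l, i)) (i`!) (l`!)
  ((n - i - l)`!) ((n - i)`!) ((n - l)`!) (n`!)
  => A B C D x y z u v t H1 H2 H3 H4.
transitivity t; first by rewrite -H1 -H2; ring.
by rewrite -H3 -H4; ring.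
Qed.

Section Faulhaber.
Variable F : fieldType.
Variable beta : nat -> F.
Implicit Types (n m i l q N : nat).

(** Only the recursion up to [q] is asked of [beta], so Bernoulli numbers reduced modulo [p] qualify
    when [q < p - 1]. In the increment from [N] to [N + 1], the coefficient of [N^l] is a multiple
    of the recursion at [q - l], which is zero unless [l = q]. *)
Lemma faulhaber q N :
  (forall n, (n <= q)%N -> \sum_(j < n.+1) 'C(n.+1, j)%:R * beta j = (n == 0%N)%:R) ->
  q.+1%:R * \sum_(0 <= m < N) m%:R ^+ q =
  \sum_(i < q.+1) 'C(q.+1, i)%:R * beta i * N%:R ^+ (q.+1 - i).
Proof.
move=> betaP; elim: N => [|N IHN].
  rewrite big_geq // mulr0 big1 // => i _.
  by rewrite expr0n subn_eq0 leqNgt ltn_ord mulr0.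
rewrite big_nat_recr //= mulrDr IHN; apply/eqP; rewrite addrC eq_sym -subr_eq -sumrB; apply/eqP.
have addn1X n : N.+1%:R ^+ n = N%:R ^+ n + \sum_(l < n) 'C(n, l)%:R * (N%:R : F) ^+ l.
  rewrite -natr1 addrC exprDn big_ord_recr /= subnn expr0 mul1r binn mulr1n.
  rewrite addrC; congr (_ + _); apply: eq_bigr => l _.
  by rewrite expr1n mul1r mulr_natl.
transitivity (\sum_(i < q.+1) \sum_(l < q.+1 | (l < q.+1 - i)%N)
   'C(q.+1, i)%:R * beta i * ('C(q.+1 - i, l)%:R * (N%:R : F) ^+ l)).
  apply: eq_bigr => i _; rewrite -mulrBr addn1X addrAC subrr add0r mulr_sumr.
  rewrite (big_ord_widen q.+1 (fun l => 'C(q.+1, i)%:R * beta i *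
    ('C(q.+1 - i, l)%:R * (N%:R : F) ^+ l))) //.
  exact: leq_subr.
rewrite (exchange_big_dep predT) //= (bigD1 ord_max) //= [X in _ + X]big1 ?addr0 => [|l].
  rewrite (big_pred1 ord0) => [|i].
    have b0 : beta 0%N = 1 by have := betaP 0%N isT; rewrite big_ord1 bin0 mul1r.
    by rewrite /= b0 bin0 subn0 binSn !mul1r.
  by rewrite -[RHS]val_eqE /=; lia.
rewrite -val_eqE /= => l_neq; have lq : (l < q)%N by have := ltn_ord l; lia.
transitivity ('C(q.+1, l)%:R * (N%:R : F) ^+ l *
   \sum_(i < (q - l).+1) 'C((q - l).+1, i)%:R * beta i).
  rewrite mulr_sumr (big_ord_widen q.+1 (fun i => 'C(q.+1, l)%:R * (N%:R : F) ^+ l *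
    ('C((q - l).+1, i)%:R * beta i))); last by lia.
  apply: eq_big => [i|i]; first by have := ltn_ord i; lia.
  move=> i_lt; have := ltn_ord l => lq'.
  rewrite mulrACA -natrM bin_mul_swap; last by lia.
  rewrite subSn ?(ltnW lq) // natrM; ring.
rewrite betaP; last by lia.
by rewrite (_ : (q - l == 0)%N = false) ?mulr0 //; lia.
Qed.

End Faulhaber.

Section RatrIntegral.
Variable F : fieldType.
Implicit Types (c d : rat) (n j : nat).

(** [ratr] divides by the image of the denominator, so over a field of characteristic [p] it
    respects sums and products on these rationals, the [p]-integral ones. *)
Definition ratr_integral c := ((denq c)%:~R : F) != 0.

Lemma ratr_integral_frac (n d : int) :
  (d%:~R : F) != 0 -> ratr_integral (n%:~R / d%:~R).
Proof.
move=> dF0; have d0 : d != 0 by apply: contraNneq dF0 => ->.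
set q : rat := n%:~R / d%:~R; rewrite /ratr_integral -/q.
have nE : n * denq q = numq q * d.
  apply/eqP; rewrite -(eqr_int rat) !intrM numqE mulrAC /q divfK ?intr_eq0 //.
have /dvdzP[e dE] : (denq q %| d)%Z.
  rewrite -(@Gauss_dvdzr _ (numq q)); last first.
    by rewrite coprimezE coprime_sym; apply: coprime_num_den.
  by rewrite -nE dvdz_mull.
by apply: contraNneq dF0 => q0; rewrite dE intrM q0 mulr0.
Qed.

Lemma ratr_integralD c d :
  ratr_integral c -> ratr_integral d -> ratr_integral (c + d).
Proof.
move=> ic id; rewrite -(divq_num_den c) -(divq_num_den d).
rewrite addf_div ?intr_eq0 ?denq_neq0 // -!intrM -intrD.
by apply: ratr_integral_frac; rewrite intrM mulf_neq0.
Qed.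

Lemma ratr_integralM c d :
  ratr_integral c -> ratr_integral d -> ratr_integral (c * d).
Proof.
move=> ic id; rewrite -(divq_num_den c) -(divq_num_den d) mulf_div -!intrM.
by apply: ratr_integral_frac; rewrite intrM mulf_neq0.
Qed.

Lemma ratr_integral_int (n : int) : ratr_integral n%:~R.
Proof. by rewrite -[n%:~R]divr1; apply: (@ratr_integral_frac n 1); rewrite oner_neq0. Qed.

Lemma ratr_integralVnat n : n%:R != 0 :> F -> ratr_integral n%:R^-1.
Proof.
by move=> n0; rewrite -[_^-1]mul1r; apply: (@ratr_integral_frac 1 n).
Qed.

Lemma ratr_sum_partial n (f : nat -> rat) :
  (forall j, (j < n)%N -> ratr_integral (f j)) ->
  ratr_integral (\sum_(j < n) f j) /\
  ratr (\sum_(j < n) f j) = \sum_(j < n) ratr (f j) :> F.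
Proof.
elim: n => [|n IHn] fn.
  rewrite !big_ord0; split; first exact: (ratr_integral_int 0).
  by rewrite /ratr /= mul0r.
have [|i1 i2] := IHn; first by move=> j jn; apply: fn; rewrite (leq_trans jn).
rewrite !big_ord_recr /=; split; first by apply: ratr_integralD => //; apply: fn.
by rewrite ratrD_partial ?i2 //; apply: fn.
Qed.

Lemma ratr_nat_partial n : ratr n%:R = n%:R :> F.
Proof.
rewrite -[n%:R in LHS]divr1; have := @ratr_frac F n 1; rewrite oner_neq0 => /(_ isT).
by rewrite !divr1.
Qed.

(** The recursion that defines [bernoulli n] divides only by integers up to [n + 1]. *)
Lemma bernoulli_integral n :
  (forall j, (0 < j <= n.+1)%N -> j%:R != 0 :> F) -> ratr_integral (bernoulli n).
Proof.
elim/ltn_ind: n => n IHn n0.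
have := sum_bernoulli n; rewrite big_ord_recr /= binSn => /eqP.
rewrite addrC eq_sym -subr_eq eq_sym => /eqP bE.
have -> : bernoulli n = ((n == 0%N)%:R -
    \sum_(i < n) 'C(n.+1, i)%:R * bernoulli i) * n.+1%:R^-1.
  by rewrite -bE mulrC mulKf // pnatr_eq0.
apply: ratr_integralM; last by apply: ratr_integralVnat; apply: n0; rewrite /=.
apply: ratr_integralD; first exact: (ratr_integral_int (n == 0%N)).
rewrite -mulN1r; apply: ratr_integralM; first exact: (ratr_integral_int (-1)).
have [] // := @ratr_sum_partial n (fun i => 'C(n.+1, i)%:R * bernoulli i).
move=> j jn; apply: ratr_integralM; first exact: (ratr_integral_int 'C(n.+1, j)).
by apply: IHn => // i ij; apply: n0; lia.
Qed.

Lemma sum_ratr_bernoulli n :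
  (forall j, (0 < j <= n.+1)%N -> j%:R != 0 :> F) ->
  \sum_(j < n.+1) 'C(n.+1, j)%:R * ratr (bernoulli j) = (n == 0%N)%:R :> F.
Proof.
move=> n0; have b_int j : (j < n.+1)%N -> ratr_integral (bernoulli j).
  by move=> jn; apply: bernoulli_integral => i ij; apply: n0; lia.
rewrite -(ratr_nat_partial (n == 0%N)) -sum_bernoulli.
have [|_ ->] := @ratr_sum_partial n.+1 (fun i => 'C(n.+1, i)%:R * bernoulli i).
  move=> j jn; apply: ratr_integralM; first exact: (ratr_integral_int 'C(n.+1, j)).
  exact: b_int.
apply: eq_bigr => j _; rewrite ratrM_partial ?ratr_nat_partial //.
  exact: (ratr_integral_int 'C(n.+1, j)).
exact: b_int.
Qed.

End RatrIntegral.

Section FiniteZeta.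
Variables (p : nat) (p_pr : prime p) (h : nat) (pE : p = h.*2.+1).
Local Notation F := 'F_p.
Implicit Types (m n j k a b l s t w : nat).

Let neq0 n : (0 < n < p)%N -> n%:R != 0 :> F.
Proof. exact: Fp_nat_neq0. Qed.

Let sum_p (V : nmodType) (f : nat -> V) :
  \sum_(1 <= m < p) f m = \sum_(1 <= m < h.+1) (f m + f (p - m)%N).
Proof. by rewrite pE sum_nat_reflect. Qed.

(** Modulo [p], each factor [p - (s + i)] of the falling factorial becomes [- (s + i)]. *)
Lemma bin_pred_sub s t : (s + t < p)%N ->
  'C(p.-1 - s, t)%:R = (-1) ^+ t * 'C(s + t, t)%:R :> F.
Proof.
move=> stp; have t0 : t`!%:R != 0 :> F.
  elim: (t) stp => [|u IHu] up; first by rewrite oner_neq0.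
  by rewrite factS natrM mulf_neq0 //; [apply: neq0 | apply: IHu]; lia.
apply: (mulIf t0); rewrite -mulrA -!natrM !bin_ffact.
elim: t stp {t0} => [|t IHt] stp; first by rewrite !ffactn0 mulr1.
rewrite ffactnSr natrM IHt; last by lia.
rewrite addnS ffactSS natrM (_ : p.-1 - s - t = p - (s + t).+1)%N; last by lia.
rewrite Fp_nat_sub //; last by lia.
by rewrite exprS; ring.
Qed.

(** The reflection [j -> p - j] preserves [j^2] modulo [p]. *)
Lemma sine_prod_reflect L N : (L <= N)%N -> (N <= p)%N ->
  sine_prod F (p - N).+1 (p - L).+1 = sine_prod F L N.
Proof.
move=> LN; elim: N LN => [|N IHN] LN Np.
  by rewrite !sine_prod_nil //; lia.
move: LN; rewrite leq_eqVlt => /predU1P[->|]; first by rewrite !sine_prod_nil.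
rewrite ltnS => LN; rewrite [RHS]sine_prod_recr // -IHN ?(ltnW Np) //.
rewrite (_ : (p - N) = (p - N.+1).+1)%N; last by lia.
rewrite [LHS]sine_prod_recl; last by lia.
rewrite mulrC; congr (_ * (1 - _^-1 *: _)).
rewrite (_ : (p - N.+1).+1 = p - N)%N; last by lia.
by rewrite Fp_nat_sub ?sqrrN //; lia.
Qed.

(** The factors with [h < j < p] are the reflections of those with [0 < j <= h], whose product is
    [1 - X^h]. *)
Lemma sine_prod_upper m : (m <= h)%N ->
  sine_prod F m.+1 p = sine_prod F m.+1 h.+1 * (1 - 'X^h).
Proof.
move=> mh; rewrite -(sine_prod_half p_pr pE).
rewrite -[sine_prod _ 1 _]sine_prod_reflect; [|by []|by lia].
rewrite (_ : p - h.+1 = h)%N; last by lia.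
rewrite (_ : (p - 1).+1 = p)%N; last by lia.
by rewrite /sine_prod -big_cat_nat //; lia.
Qed.

Lemma coef_mul_sub1Xn (q : {poly F}) e : (e < h)%N -> (q * (1 - 'X^h))`_e = q`_e.
Proof. by move=> eh; rewrite mulrBr mulr1 coefB coefMXn eh subr0. Qed.

Lemma mhs_twos_Fp i : (0 < i < h)%N -> mhs F false p (nseq i 2%N) = 0.
Proof.
move=> /andP[i0 ih]; rewrite mhs_twos sine_prod_upper // coef_mul_sub1Xn //.
rewrite (sine_prod_half p_pr pE) coefB coef1 coefXn (gtn_eqF i0) (ltn_eqF ih).
by rewrite subrr mulr0.
Qed.

(** The reflection [m -> p - m] changes the sign of [m^-3] and exchanges the product below [m] with
    the one above it; the factors [1 - X^h] do not affect coefficients below degree [h]. *)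
Lemma finite_zeta_half a b : (a < h)%N -> (b < h)%N ->
  \sum_(1 <= m < p)
    m%:R ^- 3 * (sine_prod F 1 m)`_a * (sine_prod F m.+1 p)`_b =
  \sum_(1 <= m < h.+1)
    m%:R ^- 3 * (sine_prod F 1 m)`_a * (sine_prod F m.+1 h.+1)`_b -
  \sum_(1 <= m < h.+1)
    m%:R ^- 3 * (sine_prod F 1 m)`_b * (sine_prod F m.+1 h.+1)`_a.
Proof.
move=> ah bh; rewrite sum_p -sumrB.
apply: eq_big_nat => m mh; rewrite sine_prod_upper; last by lia.
rewrite coef_mul_sub1Xn // Fp_nat_sub //; last by lia.
have <- : sine_prod F 1 m = sine_prod F (p - m).+1 p.
  rewrite -[LHS]sine_prod_reflect; [|by lia|by lia].
  by rewrite (_ : (p - 1).+1 = p)%N //; lia.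
have -> : sine_prod F 1 (p - m) = sine_prod F m.+1 h.+1 * (1 - 'X^h).
  rewrite -(sine_prod_half p_pr pE) mulrC -[X in _ * X]sine_prod_reflect; [|by lia|by lia].
  rewrite (_ : (p - m.+1).+1 = p - m)%N; last by lia.
  rewrite (_ : p - h.+1 = h)%N; last by lia.
  by rewrite /sine_prod -big_cat_nat //; lia.
by rewrite coef_mul_sub1Xn // exprNn -signr_odd /= expr1 mulN1r invrN; ring.
Qed.

(** Odd powers cancel in pairs, so the sum of the [l^-(2b+1)] over [l < p - i] equals that over
    [l <= i]. Together, [i] and [p - i] count the diagonal [l = i] once and each smaller [l] twice,
    as the left side does. *)
Lemma double_sum_half a b :
  \sum_(1 <= k < h.+1) (k%:R : F) ^- (2 * b + 1) *
    (k%:R ^- (2 * a + 2) + 2 * \sum_(k.+1 <= i < h.+1) i%:R ^- (2 * a + 2)) =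
  \sum_(1 <= m < p) m%:R ^- (2 * a + 2) * \sum_(1 <= l < m) l%:R ^- (2 * b + 1).
Proof.
pose u m : F := m%:R ^- (2 * a + 2).
pose v m : F := m%:R ^- (2 * b + 1).
rewrite -[LHS]/(\sum_(1 <= k < h.+1) v k * (u k + 2 * \sum_(k.+1 <= i < h.+1) u i)).
rewrite -[RHS]/(\sum_(1 <= m < p) u m * \sum_(1 <= l < m) v l).
have uN m : (m <= p)%N -> u (p - m)%N = u m.
  move=> mp; rewrite /u Fp_nat_sub // exprNn -signr_odd (_ : odd _ = false) ?mul1r //.
  by lia.
have vN m : (m <= p)%N -> v (p - m)%N = - v m.
  move=> mp; rewrite /v Fp_nat_sub // exprNn -signr_odd (_ : odd _ = true) ?mulN1r ?invrN //.
  by lia.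
have sumv i : (i <= h)%N -> \sum_(1 <= l < p - i) v l = \sum_(1 <= l < i.+1) v l.
  elim: i => [|i IHi] ih.
    rewrite subn0 [RHS]big_geq // sum_p big_nat big1 // => l lh.
    by rewrite vN ?subrr //; lia.
  rewrite [RHS]big_nat_recr //= -IHi ?(ltnW ih) //.
  rewrite (_ : p - i = (p - i.+1).+1)%N; last by lia.
  rewrite [in RHS]big_nat_recr /=; last by lia.
  by rewrite vN ?subrK //; lia.
rewrite [RHS]sum_p.
transitivity (\sum_(1 <= k < h.+1) (v k * u k) +
   \sum_(1 <= k < h.+1) \sum_(k + ~~ false <= i < h.+1) 2 * (v k * u i)).
  rewrite -big_split; apply: eq_bigr => k _.
  by rewrite addn1 mulrDr mulrCA !mulr_sumr.
rewrite exchange_big_chain -big_split; apply: eq_big_nat => i ih.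
rewrite uN; last by lia.
rewrite sumv; last by lia.
rewrite big_nat_recr //=; last by lia.
by rewrite addn0 -mulr_sumr -mulr_suml; ring.
Qed.

(** Fermat makes the exponents positive and Faulhaber evaluates the inner sum. Of the resulting
    power sums over [m], only that with exponent [p - 1] survives, and it carries the Bernoulli
    number of index [p - w]. *)
Lemma double_sum_bernoulli a b : let w := (2 * a + 2 * b + 3)%N in (w < p)%N ->
  w%:R * (\sum_(1 <= m < p)
    m%:R ^- (2 * a + 2) * \sum_(1 <= l < m) l%:R ^- (2 * b + 1)) =
  'C(w, 2 * a + 2)%:R * ratr (bernoulli (p - w)) :> F.
Proof.
move=> w wp; set Y := \sum_(1 <= m < p) _.
have expr_inv m e : (0 < m < p)%N -> (e <= p.-1)%N ->
    (m%:R : F) ^- e = m%:R ^+ (p.-1 - e).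
  move=> mp ep; have m0 := neq0 mp; apply: (mulIf (expf_neq0 e m0)).
  by rewrite mulVf ?expf_neq0 // -exprD subnK // Fp_fermat.
(* The exponent [p - 1 - (2b + 1)], so that [q + 1] is [- (2b + 1)] modulo [p]. *)
pose q := (p - 2 - 2 * b)%N.
have qE : q.+1 = (p - (2 * b + 1))%N by rewrite /q /w in wp *; lia.
have faul m : (q.+1%:R : F) * \sum_(0 <= l < m) l%:R ^+ q =
    \sum_(i < q.+1) 'C(q.+1, i)%:R * ratr (bernoulli i) * m%:R ^+ (q.+1 - i).
  apply: (@faulhaber _ (fun i => ratr (bernoulli i))) => n nq.
  by apply: sum_ratr_bernoulli => j jn; apply: neq0; lia.
have qY : q.+1%:R * Y = - ('C(q.+1, p - w)%:R * ratr (bernoulli (p - w))).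
  transitivity (\sum_(1 <= m < p) \sum_(i < q.+1)
      'C(q.+1, i)%:R * ratr (bernoulli i) *
      (m%:R : F) ^+ (q.+1 - i + (p.-1 - (2 * a + 2)))).
    rewrite mulr_sumr; apply: eq_big_nat => m mp.
    rewrite mulrCA expr_inv //; last by lia.
    have -> : \sum_(1 <= l < m) (l%:R : F) ^- (2 * b + 1) = \sum_(0 <= l < m) l%:R ^+ q.
      rewrite [RHS]big_ltn ?expr0n; last by lia.
      rewrite (_ : (q == 0%N) = false) ?add0r; last by lia.
      apply: eq_big_nat => l lm; rewrite expr_inv; [|by lia|by lia].
      by congr (_ ^+ _); lia.
    rewrite faul mulr_sumr; apply: eq_bigr => i _.
    by rewrite exprD [LHS]mulrC [RHS]mulrA.
  rewrite exchange_big /=.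
  have pw : (p - w < q.+1)%N by rewrite qE /w in wp *; lia.
  rewrite (bigD1 (Ordinal pw)) //= [X in _ + X]big1 ?addr0 => [|i i_neq].
    rewrite -mulr_sumr sum_powers_Fp // (_ : (p.-1 %| _)%N) ?mulrN1 //.
    rewrite (_ : _ + _ = p.-1)%N ?dvdnn //.
    by rewrite qE /w in wp *; lia.
  rewrite -mulr_sumr sum_powers_Fp // (_ : (p.-1 %| _)%N = false) ?oppr0 ?mulr0 //.
  (* The exponent lies strictly between 0 and [2 (p - 1)], so the only multiple of [p - 1] it can be
     is [p - 1], reached at [i = p - w]. *)
  apply/negP => /dvdnP[r rE]; move: i_neq; rewrite -val_eqE /= => /eqP; apply.
  have := ltn_ord i; rewrite /w in wp rE *; case: r rE => [|[|r]]; [lia|lia|].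
  by rewrite !mulSn; lia.
have b0 : (2 * b + 1)%:R != 0 :> F by apply: neq0; rewrite /w in wp; lia.
apply: (mulfI b0); rewrite mulrCA.
have -> : (2 * b + 1)%:R * Y = 'C(w.-1, 2 * a + 2)%:R * ratr (bernoulli (p - w)).
  apply: oppr_inj; rewrite -mulNr -Fp_nat_sub; [|by []|by rewrite /w in wp; lia].
  rewrite -qE qY; congr (- (_ * _)).
  rewrite (_ : p - w = q.+1 - (2 * a + 2))%N; last by rewrite qE /w in wp *; lia.
  rewrite bin_sub; last by rewrite qE /w in wp *; lia.
  rewrite (_ : q.+1 = p.-1 - 2 * b)%N; last by lia.
  rewrite bin_pred_sub; last by rewrite /w in wp; lia.
  rewrite -signr_odd (_ : odd _ = false) ?mul1r; last by lia.
  by congr ('C(_, _)%:R); rewrite /w; lia.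
rewrite [LHS]mulrA -natrM mul_bin_down natrM -mulrA; congr (_%:R * _).
by rewrite /w; lia.
Qed.

Lemma finite_zeta_twos_three_twos a b :
  let w := (2 * a + 2 * b + 3)%N in (w < p)%N ->
  trunc_zeta F p (nseq a 2%N ++ 3%N :: nseq b 2%N) =
  (-1) ^+ (a + b) * 2 * ('C(w, 2 * b + 2)%:R - 'C(w, 2 * a + 2)%:R) *
  ratr (bernoulli (p - w) / w%:R).
Proof.
move=> w wp; have w0 : w%:R != 0 :> F by apply: neq0; rewrite /w; lia.
have two_h : 2 * h%:R + 1 = 0 :> F.
  by rewrite -natrM natr1 mul2n -pE; apply/eqP; rewrite Fp_nat_eq0.
have neq0h n : (0 < n < h.*2.+1)%N -> n%:R != 0 :> F by rewrite -pE; apply: neq0.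
have sqr_h k : (0 < k < h.*2.+1)%N -> ((k%:R : F) ^+ 2) ^+ h = 1.
  by rewrite -pE; apply: sqr_half.
have half a' b' : (a' < h)%N -> (b' < h)%N -> _ := fun ah bh =>
  etrans (half_sum_coef two_h neq0h sqr_h (sine_prod_half p_pr pE) ah bh
           (fun q qh => coef_half_interpolation p_pr pE qh bh))
         (congr1 (fun t : F => - 2 * t) (double_sum_half a' b')).
rewrite trunc_zeta_mhs rev_cat rev_cons !rev_nseq cat_rcons mhs_twos_three_twos.
rewrite finite_zeta_half; [|by rewrite /w in wp; lia|by rewrite /w in wp; lia].
rewrite !half; try by rewrite /w in wp; lia.
have := @double_sum_bernoulli a b wp.
have := @double_sum_bernoulli b a; rewrite (addnC (2 * b)) => /(_ wp).
set Yab := \sum_(1 <= m < p) m%:R ^- (2 * a + 2) * _.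
set Yba := \sum_(1 <= m < p) m%:R ^- (2 * b + 2) * _; rewrite -/w => ba ab.
rewrite ratrM_partial; last by apply: ratr_integralVnat.
  have -> : ratr w%:R^-1 = w%:R^-1 :> F.
    have := @ratr_frac F 1 w w0; rewrite !mul1r; exact.
  move: ba ab; move: (ratr (bernoulli (p - w))) => beta ba ab.
  rewrite -!mulrA; congr (_ * _); apply: (mulfI w0).
  transitivity (2 * (w%:R * Yba - w%:R * Yab)); first by ring.
  rewrite ba ab -mulrBl [RHS]mulrCA; congr (_ * _).
  by rewrite [RHS]mulrCA; congr (_ * _); rewrite mulrCA mulfV // mulr1.
by apply: bernoulli_integral => j jw; apply: neq0; rewrite /w in wp jw; lia.
Qed.

End FiniteZeta.

(** * The antipode relation modulo an ideal *)

Section AntipodeModulo.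
Variables (A : comNzRingType) (I : A -> Prop).
Hypotheses (I0 : I 0) (ID : forall x y, I x -> I y -> I (x + y)).
Hypothesis IM : forall x y, I x -> I (y * x).
Variables (s t : seq nat -> A).
Hypotheses (s0 : s [::] = 1) (t0 : t [::] = 1).
Hypothesis antipode : forall k, all (leq 2) k -> k != [::] ->
  \sum_(j < (size k).+1) (-1) ^+ j * (s (rev (take j k)) * t (drop j k)) = 0.
Variable n : nat.
Hypothesis t_twos : forall i, (0 < i <= n)%N -> I (t (nseq i 2%N)).

Let IN x : I x -> I (- x).
Proof. by rewrite -mulN1r; apply: IM. Qed.

Let Isum m (f : 'I_m -> A) : (forall i, I (f i)) -> I (\sum_i f i).
Proof. by move=> If; elim/big_ind: _. Qed.

Lemma star_twos_mod i : (0 < i <= n)%N -> I (s (nseq i 2%N)).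
Proof.
elim/ltn_ind: i => i IHi /andP[i0 ni].
have := antipode (k := nseq i 2%N).
rewrite all_nseq orbT -size_eq0 size_nseq -lt0n i0 => /(_ isT isT).
rewrite big_ord_recr /= take_oversize ?size_nseq // drop_oversize ?size_nseq //.
rewrite rev_nseq t0 mulr1 => /eqP; rewrite addr_eq0 eq_sym => /eqP sE.
have -> : s (nseq i 2%N) = (-1) ^+ i * - (- ((-1) ^+ i * s (nseq i 2%N))).
  by rewrite opprK mulrA -exprMn mulrNN mulr1 expr1n mul1r.
rewrite sE; apply: IM; apply: IN; apply: Isum => j; apply: IM.
rewrite drop_nseq; apply: IM; apply: t_twos.
by have := ltn_ord j; lia.
Qed.

(** Every cut other than the two extreme ones leaves only twos on the side without the 3, so that
    its term lies in [I]. The bound [n] serves the prime fields, where the sums over {2}^i are shown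
    to vanish for [0 < i < h]. *)
Lemma antipode_twos_three_twos a b : (a <= n)%N -> (b <= n)%N ->
  let k := nseq a 2%N ++ 3%N :: nseq b 2%N in
  I (s (rev k) - (-1) ^+ (a + b) * t k).
Proof.
move=> an bn k; have k_size : size k = (a + b).+1.
  by rewrite size_cat /= !size_nseq addnS.
have := antipode (k := k); rewrite all_cat /= !all_nseq !orbT => /(_ isT).
rewrite -size_eq0 k_size => /(_ isT).
rewrite big_ord_recl big_ord_recr /= take0 drop0 s0 !mul1r.
rewrite /bump /= add1n -k_size take_size drop_size t0 mulr1.
set S := \sum_(i < _) _; move=> /eqP; rewrite addr_eq0 => /eqP tE.
have -> : s (rev k) - (-1) ^+ (a + b) * t k = (-1) ^+ (a + b) * S.
  rewrite tE mulrN opprK k_size mulrDr exprS mulN1r mulNr mulrN mulrA -exprMn.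
  by rewrite mulrNN mulr1 expr1n mul1r addrC addrNK.
apply: IM; apply: Isum => j; apply: IM; rewrite /bump /= add1n.
have [ja|aj] := leqP j.+1 a.
  rewrite mulrC; apply: IM; rewrite takel_cat ?size_nseq // take_nseq // rev_nseq.
  by apply: star_twos_mod; lia.
apply: IM; rewrite drop_cat size_nseq ltnNge (ltnW aj) /=.
have -> : (j.+1 - a = (j - a).+1)%N by lia.
rewrite /= drop_nseq; apply: t_twos.
by have := ltn_ord j; lia.
Qed.

End AntipodeModulo.

(** * The values in [A1] *)

Section FiniteTheorem.
Implicit Types a b w : nat.

(** The complement of [2a + 2] in [w] is [2b + 1], and the neighbouring binomials satisfy [(b + 1)
    C(w, 2b + 2) = (a + 1) C(w, 2b + 1)]. *)
Lemma coef_three_twos a b : let w := (2 * a + 2 * b + 3)%N in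
  2 * (a%:R - b%:R) / (a%:R + 1) * 'C(w, 2 * b + 2)%:R =
  2 * ('C(w, 2 * b + 2)%:R - 'C(w, 2 * a + 2)%:R) :> rat.
Proof.
move=> w; have a0 : a%:R + 1 != 0 :> rat by rewrite natr1 pnatr_eq0.
have -> : 'C(w, 2 * a + 2) = 'C(w, 2 * b + 1).
  by rewrite -bin_sub; [congr 'C(_, _)|]; rewrite /w; lia.
have : (b%:R + 1) * 'C(w, 2 * b + 2)%:R = (a%:R + 1) * 'C(w, 2 * b + 1)%:R :> rat.
  apply: (@mulfI _ 2); first by rewrite pnatr_eq0.
  rewrite !mulrA; have := congr1 (fun m => m%:R : rat) (mul_bin_left w (2 * b + 1)).
  rewrite /= !natrM (_ : (2 * b + 1).+1 = 2 * (b + 1))%N; last by lia.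
  rewrite (_ : w - (2 * b + 1) = 2 * (a + 1))%N; last by rewrite /w; lia.
  rewrite !natrM !natrD; rewrite (_ : 2 * (b + 1) = 2 * b + 2)%N //; last by lia.
move: ('C(_, _)%:R) ('C(_, _)%:R) => u v uv.
apply: (mulIf a0); rewrite mulrAC divfK //.
transitivity (2 * ((a%:R + 1) * v - (b%:R + 1) * v)); first by ring.
by rewrite uv; ring.
Qed.

Lemma scale_toA1 (z : int) (x : primes_prod) :
  (z%:~R : rat) *: toA1 x = toA1 (fun p => z%:~R * x p).
Proof.
rewrite -[LHS]/(scaleA1 _ _) /scaleA1 /ratA1 /toA1 -rmorphM; congr (\pi_({ideal_quot primes_sum})%qT _).
apply: functional_extensionality_dep => p.
rewrite -[LHS]/(ratr z%:~R * x p) -[z%:~R in LHS]divr1.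
by have := @ratr_frac 'F_(val p) z 1; rewrite oner_neq0 => /(_ isT) ->; rewrite divr1.
Qed.

Lemma prime_half p : prime p -> (2 < p)%N -> p = p./2.*2.+1.
Proof.
move=> p_pr p2; have [p_eq2|p_odd] := even_prime p_pr; first by lia.
by rewrite -[LHS]odd_double_half p_odd.
Qed.

(** Written as an integer, the coefficient acts on [A1] through its image modulo every prime,
    without exceptional primes from a denominator. *)
Definition coef_int a b : int :=
  let w := (2 * a + 2 * b + 3)%N in
  (-1) ^+ (a + b) * 2 * ('C(w, 2 * b + 2)%:R - 'C(w, 2 * a + 2)%:R).

Lemma coef_intE (R : nzRingType) a b : let w := (2 * a + 2 * b + 3)%N in
  (coef_int a b)%:~R =
  (-1) ^+ (a + b) * 2 * ('C(w, 2 * b + 2)%:R - 'C(w, 2 * a + 2)%:R) :> R.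
Proof. by move=> w; rewrite /coef_int -/w !rmorphM rmorphXn rmorphB !rmorph_nat rmorphN1. Qed.

Lemma zetaA1_twos_three_twos a b :
  zetaA1 (nseq a 2%N ++ 3%N :: nseq b 2%N) =
  (coef_int a b)%:~R *: frakZ_A1 (2 * a + 2 * b + 3).
Proof.
rewrite scale_toA1; apply/toA1_eq; exists (2 * a + 2 * b + 4)%N => -[p p_pr] /= wp.
rewrite coef_intE (finite_zeta_twos_three_twos p_pr (h := p./2)) //; last by lia.
by apply: prime_half => //; lia.
Qed.

(** The antipode lemma with the zero ideal of each large prime field; the reversal in it exchanges
    [a] and [b]. *)
Lemma zeta_starA1_twos_three_twos a b :
  zeta_starA1 (nseq a 2%N ++ 3%N :: nseq b 2%N) =
  ((-1) ^+ (a + b) * coef_int b a)%:~R *: frakZ_A1 (2 * a + 2 * b + 3).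
Proof.
rewrite scale_toA1; apply/toA1_eq; exists (2 * a + 2 * b + 4)%N => -[p p_pr] /= wp.
have pE : p = p./2.*2.+1 by apply: prime_half => //; lia.
have := finite_zeta_twos_three_twos p_pr pE (a := b) (b := a).
rewrite (addnC (2 * b)) => /(_ ltac:(lia)) H.
rewrite (intrM _ _ (coef_int b a)) coef_intE (addnC (2 * b)) -mulrA -H.
rewrite rmorphXn rmorphN1.
rewrite trunc_zeta_star_mhs trunc_zeta_mhs; apply/eqP; rewrite -subr_eq0; apply/eqP.
rewrite [X in mhs _ false _ X]rev_cat rev_cons !rev_nseq cat_rcons.
apply: (@antipode_twos_three_twos 'F_p (eq^~ 0) erefl _ _
  (mhs _ true p) (mhs _ false p) erefl erefl
  (fun k _ kn => mhs_antipode _ p kn) (a + b) _ a b).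
- by move=> x y -> ->; rewrite addr0.
- by move=> x y ->; rewrite mulr0.
- by move=> i ih; apply: (mhs_twos_Fp p_pr pE); lia.
- exact: leq_addr.
- exact: leq_addl.
Qed.

End FiniteTheorem.

(** * Multiple zeta values modulo zeta(2) *)

Section SequenceLimits.
Variable R : realType.
Implicit Types (u v : nat -> R) (a b l : R).

Variant tendsto u l : Prop := Tendsto of (u @ \oo --> l)%classic.

Lemma tendstoP u l :
  tendsto u l <-> forall e, 0 < e -> exists N, forall n, (N <= n)%N -> `|u n - l| <= e.
Proof.
split=> [[/cvgrPdist_le ul] e e0|ul].
  have [N _ NP] := ul e e0; exists N => n Nn.
  by rewrite distrC; apply: NP.
split; apply/cvgrPdist_le => e /ul[N NP]; exists N => // n Nn.
by rewrite distrC; apply: NP.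
Qed.

Lemma tendsto_unique u a b : tendsto u a -> tendsto u b -> a = b.
Proof. by move=> [ua] [ub]; apply: cvg_unique ua ub; apply: norm_hausdorff. Qed.

Lemma tendsto_ext u v l : tendsto u l -> (forall n, u n = v n) -> tendsto v l.
Proof. by move=> ul uv; rewrite (_ : v = u) //; apply/funext => n. Qed.

Lemma tendsto_cst l : tendsto (fun=> l) l.
Proof. by split; apply: cvg_cst. Qed.

Lemma tendstoD u v a b :
  tendsto u a -> tendsto v b -> tendsto (fun n => u n + v n) (a + b).
Proof. by move=> [ua] [vb]; split; apply: cvgD. Qed.

Lemma tendstoN u a : tendsto u a -> tendsto (fun n => - u n) (- a).
Proof. by move=> [ua]; split; apply: cvgN. Qed.

Lemma tendstoB u v a b :
  tendsto u a -> tendsto v b -> tendsto (fun n => u n - v n) (a - b).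
Proof. by move=> [ua] [vb]; split; apply: cvgB. Qed.

Lemma tendstoM u v a b :
  tendsto u a -> tendsto v b -> tendsto (fun n => u n * v n) (a * b).
Proof. by move=> [ua] [vb]; split; apply: cvgM. Qed.

Lemma tendstoZ c u a : tendsto u a -> tendsto (fun n => c * u n) (c * a).
Proof. by move=> ua; apply: tendstoM => //; apply: tendsto_cst. Qed.

Lemma tendstoV u a : a != 0 -> tendsto u a -> tendsto (fun n => (u n)^-1) a^-1.
Proof. by move=> a0 [ua]; split; apply: cvgV. Qed.

Lemma tendsto_sum (I : Type) (r : seq I) (P : pred I) (f : I -> nat -> R) (l : I -> R) :
  (forall i, P i -> tendsto (f i) (l i)) ->
  tendsto (fun n => \sum_(i <- r | P i) f i n) (\sum_(i <- r | P i) l i).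
Proof.
move=> fl; elim: r => [|i r IHr].
  rewrite big_nil; apply: tendsto_ext (tendsto_cst _) _ => n.
  by rewrite big_nil.
rewrite big_cons; case: ifP => Pi; last first.
  by apply: (tendsto_ext IHr) => n; rewrite big_cons Pi.
by apply: (tendsto_ext (tendstoD (fl i Pi) IHr)) => n; rewrite big_cons Pi.
Qed.

Lemma tendsto_comp u l (f : nat -> nat) :
  (forall n, (n <= f n)%N) -> tendsto u l -> tendsto (fun n => u (f n)) l.
Proof.
move=> fn /tendstoP ul; apply/tendstoP => e /ul[N NP].
by exists N => n Nn; apply: NP; apply: leq_trans Nn (fn n).
Qed.

Lemma tendsto_bound u l c N0 :
  tendsto u l -> (forall n, (N0 <= n)%N -> `|u n| <= c) -> `|l| <= c.
Proof.
move=> /tendstoP ul uc; apply/ler_addgt0Pr => e e0.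
have [N NP] := ul e e0; have := NP (maxn N N0) (leq_maxl _ _).
have := uc (maxn N N0) (leq_maxr _ _); set x := u _ => xc xl.
have -> : l = x - (x - l) by rewrite opprB addrC subrK.
by apply: le_trans (ler_normB _ _) _; apply: lerD.
Qed.

Lemma tendsto_monotone u c :
  (forall n, u n <= u n.+1) -> (forall n, u n <= c) -> tendsto u (limn u).
Proof.
move=> u_inc uc; split; apply: nondecreasing_is_cvgn; first by apply/nondecreasing_seqP.
by exists c => _ [n _ <-].
Qed.

Lemma tendsto_harmonic u l c :
  (forall n, `|u n - l| <= c / n.+1%:R) -> tendsto u l.
Proof.
move=> ul; apply/tendstoP => e e0.
have [c0|c0] := leP c 0.
  exists 0%N => n _; apply: le_trans (ul n) _; apply: le_trans (ltW e0).
  by rewrite pmulr_lle0 // invr_gt0.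
exists (Num.bound (c / e)) => n Nn; apply: le_trans (ul n) _.
rewrite ler_pdivrMr // mulrC -ler_pdivrMr //.
apply: le_trans (ltW (archi_boundP _)) _; first by rewrite divr_ge0 ?ltW.
by rewrite ler_nat; apply: leqW.
Qed.

End SequenceLimits.

Section ConvergentSums.
Variable R : realType.
Implicit Types (N m n x : nat) (k l : seq nat).
Local Notation mhs := (mhs R).

Lemma sum_inv_sqr_le N : \sum_(1 <= m < N) (m%:R : R) ^- 2 <= 2.
Proof.
suff H n : \sum_(1 <= m < n.+2) (m%:R : R) ^- 2 <= 2 - n.+1%:R^-1.
  case: N => [|[|n]]; [by rewrite big_geq|by rewrite big_geq|].
  by apply: le_trans (H n) _; rewrite lerBlDr lerDl invr_ge0.
elim: n {N} => [|N IHN]; first by rewrite big_nat1 invr1 expr1n invr1; lra.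
rewrite big_nat_recr //=; apply: le_trans (lerD IHN (lexx _)) _.
rewrite -addrA lerD2l -(natr1 N.+1); have : 0 < N.+1%:R :> R by [].
move: (N.+1%:R) => n n0.
rewrite -subr_ge0 (_ : _ - _ = (n * (n + 1) ^+ 2)^-1).
  by rewrite invr_ge0 mulr_ge0 ?exprn_ge0 ?addr_ge0 ?ltW.
by field; apply/andP; split; rewrite gt_eqF ?addr_gt0.
Qed.

Lemma inv_exp_ge0 m x : 0 <= (m%:R : R) ^- x.
Proof. by rewrite invr_ge0 exprn_ge0. Qed.

Lemma inv_exp_le m x : (1 < x)%N -> (0 < m)%N -> (m%:R : R) ^- x <= m%:R ^- 2.
Proof.
move=> x2 m0; rewrite lef_pV2 ?posrE ?exprn_gt0 ?ltr0n //.
by rewrite ler_weXn2l // ler1n.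
Qed.

Lemma mhs_ge0 star N k : 0 <= mhs star N k.
Proof.
elim: k N => [|x k IHk] N //=; apply: sumr_ge0 => m _.
by rewrite mulr_ge0 ?inv_exp_ge0.
Qed.

(** Each variable costs at most the sum of the [m^-2]. Being uniform in [N], the bound gives
    convergence and also controls the tails of the generating functions. *)
Lemma mhs_le star N k : all (leq 2) k -> mhs star N k <= 2 ^+ size k.
Proof.
elim: k N => [|x k IHk] N //= /andP[x2 k2].
apply: le_trans (_ : (\sum_(1 <= m < N) (m%:R : R) ^- 2) * 2 ^+ size k <= _).
  rewrite mulr_suml; apply: ler_sum_nat => m /andP[m0 _].
  by apply: ler_pM; rewrite ?inv_exp_ge0 ?mhs_ge0 ?inv_exp_le ?IHk.
by rewrite exprS ler_wpM2r ?exprn_ge0 ?sum_inv_sqr_le.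
Qed.

Lemma mhs_recr star N k : mhs star N k <= mhs star N.+1 k.
Proof.
case: k => [|x k] //=; case: N => [|N]; first by rewrite !big_geq.
by rewrite [leRHS]big_nat_recr //= lerDl mulr_ge0 ?inv_exp_ge0 ?mhs_ge0.
Qed.

Lemma admissible_ge2 k : all (leq 2) k -> admissible k.
Proof.
move=> k2; apply/andP; split; first by apply: sub_all k2 => x /ltnW.
by case/lastP: k k2 => [|k x] //; rewrite all_rcons last_rcons => /andP[].
Qed.

Lemma tendsto_mzv k : all (leq 2) k -> tendsto (fun N => mhs false N (rev k)) (mzv R k).
Proof.
move=> k2; rewrite /mzv admissible_ge2 //.
rewrite (_ : (fun N => trunc_zeta R N k) = (fun N => mhs false N (rev k))).
  apply: (@tendsto_monotone _ _ (2 ^+ size k)) => N; first exact: mhs_recr.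
  by rewrite -size_rev mhs_le // all_rev.
by apply/funext => N; rewrite trunc_zeta_mhs.
Qed.

Lemma all_box_sums k : all (leq 2) k -> all (all (leq 2)) (box_sums k).
Proof.
case: k => [|x k] //=; elim: k x => [|y k IHk] x /=; first by rewrite andbT => ->.
move=> /and3P[x2 y2 k2]; rewrite all_cat all_map IHk ?andbT ?y2 //; last first.
  by rewrite /= k2 (leq_trans x2) // leq_addr.
have := IHk y; rewrite /= y2 k2 => /(_ isT).
by apply: sub_all => l /= ->; rewrite x2.
Qed.

Lemma sumn_box_sums k : all (fun l => sumn l == sumn k) (box_sums k).
Proof.
case: k => [|x k] //=; elim: k x => [|y k IHk] x /=; first by rewrite eqxx.
rewrite all_cat all_map addnA IHk andbT.
by apply: sub_all (IHk y) => l /= /eqP ->; rewrite addnA.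
Qed.

End ConvergentSums.

(** * Newton's identities and even zeta values *)

Section NewtonIdentity.
Variable F : fieldType.
Implicit Types (N n i : nat).

(** Newton's identities for the [j^-2], by adding one variable [c] at a time: the powers of [c] form
    a geometric series that cancels the new factor [1 - c X]. *)
Lemma sine_prod_newton N n :
  n%:R * (sine_prod F 1 N)`_n =
  - \sum_(i < n) (\sum_(1 <= m < N) m%:R ^- (2 * i.+1)) * (sine_prod F 1 N)`_(n - i.+1).
Proof.
case: N => [|N].
  rewrite sine_prod_nil // coef1 big1 => [|i _]; last by rewrite big_geq // mul0r.
  by case: n => [|n]; rewrite ?mul0r ?mulr0 oppr0.
elim: N n => [|N IHN] n.
  rewrite sine_prod_nil // coef1 big1 => [|i _]; last by rewrite big_geq // mul0r.
  by case: n => [|n]; rewrite ?mul0r ?mulr0 oppr0.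
case: n => [|n]; first by rewrite big_ord0 mul0r oppr0.
rewrite sine_prod_recr //; set P := sine_prod F 1 N.+1 in IHN *; set c := N.+1%:R ^- 2.
pose q i := \sum_(1 <= m < N.+1) (m%:R : F) ^- (2 * i.+1).
have cE i : N.+1%:R ^- (2 * i.+1) = c ^+ i.+1 by rewrite /c exprM exprVn.
have qE i : \sum_(1 <= m < N.+2) (m%:R : F) ^- (2 * i.+1) = q i + c ^+ i.+1.
  by rewrite big_nat_recr //= cE.
under eq_bigr do rewrite qE mulrDl.
rewrite big_split /= coef_mul_sub1X.
have tele : \sum_(i < n.+1) c ^+ i.+1 * (P * (1 - c *: 'X))`_(n.+1 - i.+1) = c * P`_n.
  elim: n => [|n IHn]; first by rewrite big_ord1 expr1 coef0_mul_sub1X.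
  rewrite big_ord_recl expr1 subSS subn0 coef_mul_sub1X.
  under eq_bigr do rewrite exprS -mulrA.
  by rewrite -mulr_sumr IHn mulrBr addrNK.
rewrite tele.
have IH1 : \sum_(i < n.+1) q i * P`_(n.+1 - i.+1) = - (n.+1%:R * P`_n.+1).
  by rewrite IHN opprK.
have IH0 : \sum_(i < n) q i * P`_(n - i.+1) = - (n%:R * P`_n) by rewrite IHN opprK.
have -> : \sum_(i < n.+1) q i * (P * (1 - c *: 'X))`_(n.+1 - i.+1) =
    - (n.+1%:R * P`_n.+1) + c * n%:R * P`_n.
  rewrite -IH1 -[c * _ * _]opprK -mulrA -mulrN -IH0 mulr_sumr.
  rewrite !big_ord_recr /= subnn coef0_mul_sub1X addrAC -sumrB.
  congr (_ + _); apply: eq_bigr => i _.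
  rewrite subSS -subnSK // coef_mul_sub1X mulrBr; congr (_ - _).
  by rewrite mulrCA.
by rewrite -[n.+1%:R in LHS]natr1 -natr1; ring.
Qed.

End NewtonIdentity.

Section EvenZeta.
Variable R : realType.
Implicit Types (M N n x y k i : nat).

(** Partial fractions into [1 / (y - x)] and [1 / (y + x)], up to the factor [1 / (2x)]: the two
    harmonic sums cancel except for [1 / x + 1 / (2x)] and a window of [2x] terms at the far end. *)
Lemma sum_inv_sqr_sub x N : (0 < x)%N ->
  \sum_(1 <= y < x + N.+1 | y != x) ((y%:R : R) ^+ 2 - x%:R ^+ 2)^-1 =
  3 / (4 * x%:R ^+ 2) - (2 * x%:R)^-1 * \sum_(N.+1 <= i < N.+1 + 2 * x) i%:R^-1.
Proof.
move=> x0; have X0 : x%:R != 0 :> R by rewrite pnatr_eq0 -lt0n.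
elim: N => [|N IHN]; last first.
  rewrite addnS big_mkcond big_nat_recr /=; last by lia.
  rewrite -big_mkcond ifT; last by lia.
  rewrite IHN (@big_ltn _ _ _ N.+1); last by lia.
  rewrite (_ : N.+2 + 2 * x = (N.+1 + 2 * x).+1)%N // [in RHS]big_nat_recr /=; last by lia.
  move: (\sum_(_ <= _ < _) _) => S.
  have N0 : N.+1%:R != 0 :> R by rewrite pnatr_eq0.
  have s0 : N.+1%:R + 2 * x%:R != 0 :> R by rewrite -(natrM _ 2) -(natrD _ N.+1) pnatr_eq0.
  rewrite (natrD _ x) (natrD _ N.+1) (natrM _ 2); move: (N.+1%:R) N0 s0 => n n0 s0.
  have d0 : (x%:R + n) ^+ 2 - x%:R ^+ 2 != 0.
    by rewrite (_ : _ - _ = n * (n + 2 * x%:R)) ?mulf_neq0 //; ring.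
  by field; rewrite ?d0 ?n0 ?s0 ?X0.
rewrite addn1 big_mkcond big_nat_recr //= eqxx addr0 -big_mkcond /=.
transitivity (\sum_(1 <= y < x) - (2 * x%:R)^-1 * ((x - y)%:R^-1 + (x + y)%:R^-1) : R).
  rewrite big_nat_cond [RHS]big_nat_cond; apply: eq_big => y; first by lia.
  move=> /andP[/andP[y0 yx] _]; have s0 : (x + y)%:R != 0 :> R by rewrite pnatr_eq0; lia.
  have : (x - y)%:R != 0 :> R by rewrite pnatr_eq0; lia.
  rewrite natrB ?(ltnW yx) // natrD in s0 * => d0.
  have e0 : (y%:R : R) ^+ 2 - x%:R ^+ 2 != 0.
    by rewrite (_ : _ - _ = - ((x%:R - y%:R) * (x%:R + y%:R))) ?oppr_eq0 ?mulf_neq0 //; ring.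
  by field; rewrite ?d0 ?e0 ?s0 ?X0.
rewrite -mulr_sumr big_split /=.
have -> : \sum_(1 <= y < x) (x - y)%:R^-1 = \sum_(1 <= i < x) i%:R^-1 :> R.
  rewrite [RHS]big_nat_rev /=; apply: eq_big_nat => y xy; congr (_%:R^-1); lia.
have -> : \sum_(1 <= y < x) (x + y)%:R^-1 = \sum_(x.+1 <= i < 2 * x) i%:R^-1 :> R.
  rewrite -(add1n x) big_addn (_ : 2 * x - x = x)%N; last by lia.
  by apply: eq_bigr => y _; rewrite addnC.
rewrite add1n [in RHS]big_nat_recr /=; last by lia.
rewrite (@big_cat_nat _ _ _ x 1 (2 * x)) /=; [|by lia|by lia].
rewrite (@big_ltn _ _ _ x (2 * x)); last by lia.
move: (\sum_(_ <= _ < _) _) (\sum_(_ <= _ < _) _) => S T; rewrite natrM.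
by field.
Qed.

Lemma geometric_convolution n (u v : R) : u != v ->
  \sum_(1 <= k < n) u ^+ k * v ^+ (n - k) = u * v * (u ^+ n.-1 - v ^+ n.-1) / (u - v).
Proof.
move=> uv; have d0 : u - v != 0 by rewrite subr_eq0.
case: n => [|n]; first by rewrite big_geq // !expr0 subrr mulr0 mul0r.
elim: n => [|n IHn]; first by rewrite big_geq // !expr0 subrr mulr0 mul0r.
rewrite big_nat_recr //= subSnn expr1.
transitivity (v * \sum_(1 <= k < n.+1) u ^+ k * v ^+ (n.+1 - k) + u ^+ n.+1 * v).
  rewrite mulr_sumr; congr (_ + _); apply: eq_big_nat => k /andP[_ kn].
  by rewrite (_ : n.+2 - k = (n.+1 - k).+1)%N ?exprS 1?mulrCA //; lia.
rewrite IHn /= !exprS; by field.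
Qed.

(** Summing over [k] first gives a geometric series for each pair [x != y], with two parts exchanged
    by the symmetry. The diagonal contributes [n - 1] and each part [3/4], whence [n + 1/2]. *)
Lemma even_zeta_trunc n N : (1 < n)%N ->
  \sum_(1 <= k < n) mhs R false N.+2 [:: (2 * k)%N] * mhs R false N.+2 [:: 2 * (n - k)]%N =
  (n%:R + 2^-1) * mhs R false N.+2 [:: (2 * n)%N] -
  \sum_(1 <= x < N.+2) x%:R ^- (2 * n - 1) *
    \sum_(N.+2 - x <= i < N.+2 + x) i%:R^-1.
Proof.
move=> n1; pose M := N.+2.
pose f x y : R := x%:R ^- (2 * n - 2) * (y%:R ^+ 2 - x%:R ^+ 2)^-1.
have fE x : (0 < x < M)%N -> \sum_(1 <= y < M | y != x) f x y =
    3 / 4 * x%:R ^- (2 * n) - 2^-1 * x%:R ^- (2 * n - 1) *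
      \sum_(M - x <= i < M + x) i%:R^-1.
  move=> xM; have X0 : x%:R != 0 :> R by rewrite pnatr_eq0; lia.
  rewrite -mulr_sumr {1}(_ : M = x + (N.+1 - x).+1)%N; last by rewrite /M; lia.
  rewrite sum_inv_sqr_sub; last by lia.
  rewrite (_ : (N.+1 - x).+1 = M - x)%N; last by rewrite /M; lia.
  rewrite (_ : M - x + 2 * x = M + x)%N; last by rewrite /M; lia.
  rewrite (_ : 2 * n = 2 * n - 2 + 2)%N; last by lia.
  rewrite (_ : 2 * n - 2 + 2 - 1 = 2 * n - 2 + 1)%N; last by lia.
  rewrite addnK !exprD expr1; move: (\sum_(_ <= _ < _) _) => S.
  have : x%:R ^+ (2 * n - 2) != 0 :> R by rewrite expf_neq0.
  by move: (x%:R ^+ (2 * n - 2)) => e e0; field; rewrite e0 X0.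
have gE x y : (0 < x)%N -> (0 < y)%N -> y != x ->
    \sum_(1 <= k < n) (x%:R : R) ^- (2 * k) * y%:R ^- (2 * (n - k)) = f x y + f y x.
  move=> x0 y0 yx; have X0 : x%:R != 0 :> R by rewrite pnatr_eq0 -lt0n.
  have Y0 : y%:R != 0 :> R by rewrite pnatr_eq0 -lt0n.
  have d0 : (y%:R : R) ^+ 2 - x%:R ^+ 2 != 0.
    by rewrite subr_eq0 eqrXn2 // eqr_nat.
  have d0' : (x%:R : R) ^+ 2 - y%:R ^+ 2 != 0 by rewrite -opprB oppr_eq0.
  have uv : (x%:R : R) ^- 2 != y%:R ^- 2.
    by rewrite (inj_eq invr_inj) eq_sym -subr_eq0.
  transitivity (\sum_(1 <= k < n) ((x%:R : R) ^- 2) ^+ k * (y%:R ^- 2) ^+ (n - k)).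
    by apply: eq_bigr => k _; rewrite !exprM !exprVn.
  rewrite (geometric_convolution _ uv) /f.
  rewrite (_ : 2 * n - 2 = 2 * n.-1)%N ?exprM ?exprVn; last by lia.
  have : (x%:R ^+ 2) ^+ n.-1 != 0 :> R by rewrite !expf_neq0.
  have : (y%:R ^+ 2) ^+ n.-1 != 0 :> R by rewrite !expf_neq0.
  have w0 : (x%:R : R) ^- 2 - y%:R ^- 2 != 0 by rewrite subr_eq0.
  move: (_ ^+ n.-1) (_ ^+ n.-1) => e1 e2 e20 e10.
  have -> : (x%:R : R) ^- 2 - y%:R ^- 2 = (y%:R ^+ 2 - x%:R ^+ 2) / (x%:R ^+ 2 * y%:R ^+ 2).
    by field; rewrite X0 Y0.
  by field; rewrite ?X0 ?Y0 ?d0 ?d0' ?e20 ?e10.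
have E1 s : mhs R false M [:: s] = \sum_(1 <= m < M) m%:R ^- s.
  by apply: eq_bigr => m _; rewrite /= mulr1.
rewrite -/M E1.
transitivity (\sum_(1 <= x < M) \sum_(1 <= y < M)
    \sum_(1 <= k < n) (x%:R : R) ^- (2 * k) * y%:R ^- (2 * (n - k))).
  under eq_bigr do rewrite !E1 big_distrlr /=.
  by rewrite exchange_big /=; apply: eq_bigr => x _; rewrite exchange_big.
transitivity (\sum_(1 <= x < M) ((n.-1%:R * x%:R ^- (2 * n)) +
    (\sum_(1 <= y < M | y != x) f x y + \sum_(1 <= y < M | y != x) f y x))).
  apply: eq_big_nat => x xM; rewrite -big_split /=.
  rewrite (bigD1_seq x) ?mem_index_iota ?iota_uniq //=.
  congr (_ + _).
    transitivity (\sum_(1 <= k < n) (x%:R : R) ^- (2 * n)).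
      apply: eq_big_nat => k /andP[_ kn]; rewrite -invfM -exprD -mulnDr subnKC //.
      exact: ltnW.
    by rewrite sumr_const_nat subn1 mulr_natl.
  rewrite [LHS]big_nat_cond [RHS]big_nat_cond; apply: eq_bigr => y /andP[/andP[y0 yM] yx].
  by rewrite gE //; case/andP: xM.
rewrite big_split /= [X in _ + X = _]big_split /=.
have -> : \sum_(1 <= x < M) \sum_(1 <= y < M | y != x) f y x =
    \sum_(1 <= x < M) \sum_(1 <= y < M | y != x) f x y.
  rewrite (exchange_big_dep_nat predT) //=; apply: eq_bigr => x _.
  by apply: eq_bigl => y; rewrite eq_sym.
rewrite -mulr_sumr.
have -> : \sum_(1 <= x < M) \sum_(1 <= y < M | y != x) f x y =
  3 / 4 * \sum_(1 <= x < M) x%:R ^- (2 * n) -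
  2^-1 * \sum_(1 <= x < M) x%:R ^- (2 * n - 1) * \sum_(M - x <= i < M + x) i%:R^-1.
  rewrite !mulr_sumr -sumrB; apply: eq_big_nat => x xM.
  by rewrite fE // mulrA.
have -> : n%:R = n.-1%:R + 1 :> R by rewrite natr1 prednK // ltnW.
by field.
Qed.

(** With [M = N + 2], the window has [2x] terms of size at most [1 / (M - x)]. Then [1 / (x^2 (M -
    x)) = (1 / x^2 + 1 / (x (M - x))) / M], and the bracket sums to at most [2 + 1] because
    [x (M - x) >= M - 1]. *)
Lemma even_zeta_trunc_error n N : (1 < n)%N ->
  `|\sum_(1 <= x < N.+2) (x%:R : R) ^- (2 * n - 1) *
    \sum_(N.+2 - x <= i < N.+2 + x) i%:R^-1| <= 6 / N.+1%:R.
Proof.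
move=> n1; rewrite ger0_norm; last first.
  apply: sumr_ge0 => x _; rewrite mulr_ge0 ?inv_exp_ge0 //.
  by apply: sumr_ge0 => i _; rewrite invr_ge0.
have N0 : 0 < N.+1%:R :> R by [].
have N2 : 0 < N.+2%:R :> R by [].
apply: le_trans (_ : 2 / N.+2%:R * \sum_(1 <= x < N.+2)
   ((x%:R : R) ^- 2 + N.+1%:R^-1) <= _); last first.
  rewrite big_split /= sumr_const_nat subn1 -[X in _ + X]mulr_natr mulVf ?gt_eqF //.
  apply: le_trans (_ : 2 / N.+2%:R * 3 <= _).
    apply: ler_wpM2l; first by rewrite divr_ge0.
    by have := sum_inv_sqr_le R N.+2; lra.
  rewrite mulrAC (_ : 2 * 3 = 6 :> R); last by ring.
  by rewrite ler_wpM2l // lef_pV2 ?posrE // ler_nat.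
rewrite mulr_sumr; apply: ler_sum_nat => x /andP[x0 xN].
have X0 : 0 < x%:R :> R by rewrite ltr0n.
have D0 : 0 < (N.+2 - x)%:R :> R by rewrite ltr0n; lia.
apply: le_trans (_ : x%:R ^- 3 * (2 * x%:R / (N.+2 - x)%:R) <= _).
  apply: ler_pM; rewrite ?inv_exp_ge0 //.
  - by apply: sumr_ge0 => i _; rewrite invr_ge0.
  - rewrite lef_pV2 ?posrE ?exprn_gt0 // ler_weXn2l ?ler1n //; lia.
  - apply: le_trans (_ : \sum_(N.+2 - x <= i < N.+2 + x) (N.+2 - x)%:R^-1 <= _).
      apply: ler_sum_nat => i /andP[iN _].
      by rewrite lef_pV2 ?posrE ?ler_nat // ltr0n; lia.
    rewrite sumr_const_nat -[leLHS]mulr_natl ler_pM2r ?invr_gt0 // -(natrM _ 2) ler_nat.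
    by lia.
have key : (x%:R * (N.+2 - x)%:R)^-1 <= N.+1%:R^-1 :> R.
  rewrite lef_pV2 ?posrE ?mulr_gt0 // -natrM ler_nat.
  by nia.
have NE : N.+2%:R = x%:R + (N.+2 - x)%:R :> R by rewrite -natrD subnKC // ltnW.
apply: le_trans (_ : 2 / N.+2%:R * (x%:R ^- 2 + (x%:R * (N.+2 - x)%:R)^-1) <= _).
  rewrite NE in N2 *; move: (_ - x)%:R D0 N2 {key NE} => d d0 s0.
  rewrite le_eqVlt; apply/orP; left; apply/eqP; field.
  by rewrite !gt_eqF.
by rewrite ler_wpM2l ?lerD2l // divr_ge0.
Qed.

(** Unlike Euler's evaluation by powers of pi, this formula stays inside the algebra of multiple
    zeta values and expresses [zeta(2n)] by products of smaller even values. *)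
Lemma even_zeta n : (1 < n)%N ->
  \sum_(1 <= k < n) mzv R [:: (2 * k)%N] * mzv R [:: 2 * (n - k)]%N =
  (n%:R + 2^-1) * mzv R [:: (2 * n)%N].
Proof.
move=> n1.
have lim k : (0 < k)%N -> tendsto (fun N => mhs R false N.+2 [:: (2 * k)%N])
    (mzv R [:: (2 * k)%N]).
  move=> k0; apply: (@tendsto_comp _ (fun N => mhs R false N [:: (2 * k)%N])
    _ (fun N => N.+2)); first by lia.
  by apply: (@tendsto_mzv R [:: (2 * k)%N]); rewrite /= andbT; lia.
apply: (@tendsto_unique R (fun N => \sum_(1 <= k < n)
   mhs R false N.+2 [:: (2 * k)%N] * mhs R false N.+2 [:: 2 * (n - k)]%N)).
  rewrite big_nat_cond; apply: tendsto_ext (_ : tendsto (fun N =>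
    \sum_(1 <= k < n | (1 <= k < n)%N && true)
    mhs R false N.+2 [:: (2 * k)%N] * mhs R false N.+2 [:: 2 * (n - k)]%N) _) _.
    apply: tendsto_sum => k /andP[/andP[k0 kn] _].
    by apply: tendstoM; apply: lim => //; rewrite subn_gt0.
  by move=> N; rewrite -big_nat_cond.
have E0 : tendsto (fun N => \sum_(1 <= x < N.+2) (x%:R : R) ^- (2 * n - 1) *
    \sum_(N.+2 - x <= i < N.+2 + x) i%:R^-1) 0.
  by apply: tendsto_harmonic => N; rewrite subr0; apply: even_zeta_trunc_error.
rewrite -[X in tendsto _ X]subr0.
apply: tendsto_ext (tendstoB (tendstoZ _ (lim n (ltnW n1))) E0) _ => N.
by rewrite even_zeta_trunc.
Qed.

End EvenZeta.

Lemma all_take (T : Type) (q : pred T) (s : seq T) n : all q s -> all q (take n s).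
Proof. by rewrite -{1}(cat_take_drop n s) all_cat => /andP[]. Qed.

Lemma all_drop (T : Type) (q : pred T) (s : seq T) n : all q s -> all q (drop n s).
Proof. by rewrite -{1}(cat_take_drop n s) all_cat => /andP[]. Qed.

(** * Reduction modulo the ideal of zeta(2) *)

Section ModuloZeta2.
Variable R : realType.
Implicit Types (N n a b : nat) (k l u v : seq nat) (x y : mzvalg R).
Local Notation zeta := (mzvZ R).

Definition zeta2_ideal x := exists y, x = zeta [:: 2%N] * y.

Lemma zeta2_ideal0 : zeta2_ideal 0.
Proof. by exists 0; rewrite mulr0. Qed.

Lemma zeta2_idealD x y : zeta2_ideal x -> zeta2_ideal y -> zeta2_ideal (x + y).
Proof. by move=> [x' ->] [y' ->]; exists (x' + y'); rewrite mulrDr. Qed.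

Lemma zeta2_idealM x y : zeta2_ideal x -> zeta2_ideal (y * x).
Proof. by move=> [x' ->]; exists (y * x'); rewrite mulrCA. Qed.

Lemma zeta2_idealZ (c : rat) x : zeta2_ideal x -> zeta2_ideal (c *: x).
Proof.
by move=> [x' ->]; exists (c *: x'); apply: val_inj; rewrite /= mulrCA.
Qed.

Lemma zeta2_idealN x : zeta2_ideal x -> zeta2_ideal (- x).
Proof. by rewrite -mulN1r; apply: zeta2_idealM. Qed.

Lemma zeta2_ideal_sum (I : Type) (r : seq I) (P : pred I) (f : I -> mzvalg R) :
  (forall i, P i -> zeta2_ideal (f i)) -> zeta2_ideal (\sum_(i <- r | P i) f i).
Proof.
by move=> If; elim/big_rec: _ => [|i x Pi]; [apply: zeta2_ideal0|apply/zeta2_idealD/If].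
Qed.

Lemma mzvalD x y : mzval (x + y) = mzval x + mzval y. Proof. by []. Qed.
Lemma mzvalM x y : mzval (x * y) = mzval x * mzval y. Proof. by []. Qed.

Lemma mzval_sum (I : Type) (r : seq I) (P : pred I) (f : I -> mzvalg R) :
  mzval (\sum_(i <- r | P i) f i) = \sum_(i <- r | P i) mzval (f i).
Proof. exact: (big_morph (@mzval R) mzvalD erefl). Qed.

Lemma mzval_scale (c : rat) x : mzval (c *: x) = ratr c * mzval x.
Proof. by []. Qed.

Lemma mzval_sign n : mzval ((-1) ^+ n : mzvalg R) = (-1) ^+ n.
Proof. by elim: n => [|n IHn] //; rewrite !exprS mzvalM IHn. Qed.

Lemma even_zeta_ideal n : (0 < n)%N -> zeta2_ideal (zeta [:: (2 * n)%N]).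
Proof.
elim/ltn_ind: n => -[|[|n]] // IHn _; first by exists 1; rewrite mulr1.
pose c : rat := (n.+2%:R + 2^-1)^-1.
have -> : zeta [:: (2 * n.+2)%N] = c *: \sum_(1 <= j < n.+2)
    zeta [:: (2 * j)%N] * zeta [:: (2 * (n.+2 - j))%N].
  apply: val_inj; rewrite [RHS]mzval_scale mzval_sum.
  rewrite (eq_bigr (fun j => mzv R [:: (2 * j)%N] * mzv R [:: 2 * (n.+2 - j)]%N)) //.
  rewrite even_zeta // /c fmorphV rmorphD fmorphV !rmorph_nat mulKf //.
  by rewrite gt_eqF // addr_gt0 // invr_gt0.
apply: zeta2_idealZ; rewrite big_nat_cond; apply: zeta2_ideal_sum => k /andP[/andP[k0 kn] _].
by apply/zeta2_idealM/IHn; rewrite ?subn_gt0 //; lia.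
Qed.

Lemma tendsto_mzv_rev k : all (leq 2) k ->
  tendsto (fun N => mhs R false N k) (mzv R (rev k)).
Proof.
by rewrite -all_rev => /tendsto_mzv; rewrite revK.
Qed.

Lemma tendsto_coef_sine_prod (i : nat) :
  tendsto (fun N => (sine_prod R 1 N)`_i) ((-1) ^+ i * mzv R (nseq i 2%N)).
Proof.
have := tendsto_mzv_rev (k := nseq i 2%N); rewrite all_nseq orbT rev_nseq => /(_ isT) H.
apply: tendsto_ext (tendstoZ ((-1) ^+ i) H) _ => N.
by rewrite mhs_twos mulrA -exprMn mulrNN mulr1 expr1n mul1r.
Qed.

Lemma zeta_twos_newton n :
  n%:R * ((-1) ^+ n * mzv R (nseq n 2%N)) = - \sum_(i < n)
    mzv R [:: (2 * i.+1)%N] * ((-1) ^+ (n - i.+1) * mzv R (nseq (n - i.+1) 2%N)).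
Proof.
apply: tendsto_unique (tendstoZ _ (tendsto_coef_sine_prod n)) _.
apply: tendsto_ext.
  apply: tendstoN; apply: (tendsto_sum _ (f := fun (i : 'I_n) N =>
    mhs R false N [:: (2 * i.+1)%N] * (sine_prod R 1 N)`_(n - i.+1))) => i _.
  apply: tendstoM (tendsto_coef_sine_prod _).
  by apply: (@tendsto_mzv R [:: (2 * i.+1)%N]); rewrite /= andbT; lia.
move=> N; rewrite sine_prod_newton; congr (- _); apply: eq_bigr => i _; congr (_ * _).
by apply: eq_bigr => m _; rewrite /= mulr1.
Qed.

(** Every term of Newton's identities contains an even zeta value. *)
Lemma zeta_twos_ideal n : (0 < n)%N -> zeta2_ideal (zeta (nseq n 2%N)).
Proof.
move=> n0; have -> : zeta (nseq n 2%N) = (-1) ^+ n * ((- n%:R^-1 : rat) *: \sum_(i < n)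
    ((-1) ^+ (n - i.+1) * zeta (nseq (n - i.+1) 2%N)) * zeta [:: (2 * i.+1)%N]).
  apply: val_inj; rewrite [RHS]mzvalM mzval_sign mzval_scale mzval_sum.
  rewrite (eq_bigr (fun i : 'I_n => mzv R [:: (2 * i.+1)%N] *
    ((-1) ^+ (n - i.+1) * mzv R (nseq (n - i.+1) 2%N)))); last first.
    by move=> i _; rewrite !mzvalM mzval_sign mulrC.
  rewrite -[X in _ * X]opprK -mulrN -zeta_twos_newton rmorphN fmorphV rmorph_nat.
  rewrite mulNr opprK mulKf ?pnatr_eq0 -?lt0n //.
  by rewrite mulrA -exprMn mulrNN mulr1 expr1n mul1r.
apply/zeta2_idealM/zeta2_idealZ/zeta2_ideal_sum => i _.
by apply/zeta2_idealM/even_zeta_ideal.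
Qed.

Definition zeta_star k : mzvalg R := \sum_(l <- box_sums k) zeta l.

Lemma tendsto_zeta_star k : all (leq 2) k ->
  tendsto (fun N => mhs R true N (rev k)) (mzval (zeta_star k)).
Proof.
move=> k2; rewrite mzval_sum big_seq_cond.
apply: tendsto_ext.
  apply: (tendsto_sum _ (f := fun l N => mhs R false N (rev l))) => l /andP[lk _].
  apply: tendsto_mzv.
  exact: (allP (all_box_sums k2)).
by move=> N; rewrite /= -big_seq_cond mhs_rev_box.
Qed.

(** Instead of a bijection between lists of box sums: both sides are limits of the same truncated
    sums. *)
Lemma zeta_star_rev k : all (leq 2) k ->
  \sum_(l <- box_sums k) zeta (rev l) = zeta_star (rev k).
Proof.
move=> k2; apply: val_inj; rewrite [LHS]mzval_sum big_seq_cond.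
apply: tendsto_unique (tendsto_zeta_star _); last by rewrite all_rev.
apply: tendsto_ext.
  apply: (tendsto_sum _ (f := fun l N => mhs R false N l)) => l /andP[lk _].
  apply: tendsto_mzv_rev.
  exact: (allP (all_box_sums k2)).
by move=> N; rewrite /= -big_seq_cond mhs_box revK.
Qed.

Lemma zeta_star_nil : zeta_star [::] = 1.
Proof. by rewrite /zeta_star /= big_seq1 -(zeta_reg_nil R Harmonic) zeta_reg_admissible. Qed.

Lemma zeta_nil : zeta [::] = 1.
Proof. by rewrite -(zeta_reg_nil R Harmonic) zeta_reg_admissible. Qed.

Lemma zeta_antipode k : all (leq 2) k -> k != [::] ->
  \sum_(j < (size k).+1) (-1) ^+ j *
    (zeta_star (take j k) * zeta (rev (drop j k))) = 0.
Proof.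
move=> k2 k0; apply: val_inj; rewrite [LHS]mzval_sum.
apply: tendsto_unique (tendsto_cst 0).
apply: tendsto_ext.
  apply: (tendsto_sum _ (f := fun (j : 'I_(size k).+1) N =>
    (-1) ^+ j * (mhs R true N (rev (take j k)) * mhs R false N (drop j k)))) => j _.
  rewrite !mzvalM mzval_sign; apply: tendstoZ; apply: tendstoM.
    by apply: tendsto_zeta_star; apply: all_take.
  by apply: tendsto_mzv_rev; apply: all_drop.
by move=> N; rewrite /= mhs_antipode.
Qed.

Lemma to_mzvbar_sum (I : Type) (r : seq I) (P : pred I) (f : I -> mzvalg R) :
  to_mzvbar (\sum_(i <- r | P i) f i) = \sum_(i <- r | P i) to_mzvbar (f i).
Proof.
apply: (big_morph (@to_mzvbar R)); first exact: to_mzvbarD.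
by apply: (@addrI _ (to_mzvbar 0)); rewrite -to_mzvbarD !addr0.
Qed.

Let summand u v : mzvalg R := (-1) ^+ sumn v * zeta u * zeta (rev v).

(** With all entries at least 2, every piece and its reversal is admissible, so either
    regularization returns the convergent series. *)
Lemma zetaS1_ge2 reg k : all (leq 2) k -> zetaS1 R reg k =
  to_mzvbar (\sum_(i < (size k).+1) summand (take i k) (drop i k)).
Proof.
move=> k2; congr to_mzvbar; apply: eq_bigr => i _; rewrite /summand.
by rewrite !zeta_reg_admissible // admissible_ge2 // ?all_rev ?all_take ?all_drop.
Qed.

(** Merging entries preserves the weight, so the sign depends only on the cut and the sum factors
    into its two sides. *)
Lemma zeta_starS1_ge2 reg k : all (leq 2) k -> zeta_starS1 R reg k =
  to_mzvbar (\sum_(j < (size k).+1) (-1) ^+ sumn (drop j k) *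
    zeta_star (take j k) * zeta_star (rev (drop j k))).
Proof.
move=> k2; rewrite /zeta_starS1 big_seq.
rewrite (eq_bigr (fun l => to_mzvbar (\sum_(i < (size l).+1)
  summand (take i l) (drop i l)))); last first.
  by move=> l lk; rewrite zetaS1_ge2 //; apply: (allP (all_box_sums k2)).
rewrite -big_seq -to_mzvbar_sum box_sums_split; congr to_mzvbar.
apply: eq_bigr => j _; rewrite -zeta_star_rev ?all_drop //.
rewrite /zeta_star -mulrA big_distrlr /= mulr_sumr; apply: eq_bigr => u _.
rewrite mulr_sumr big_seq [RHS]big_seq; apply: eq_bigr => v vk.
by rewrite /summand (eqP (allP (sumn_box_sums _) v vk)) mulrA.
Qed.

Section TwosThreeTwos.
Variables a b : nat.
Let k := nseq a 2%N ++ 3%N :: nseq b 2%N.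

Let k2 : all (leq 2) k.
Proof. by rewrite all_cat /= !all_nseq !orbT. Qed.

(* Each inner term has a factor whose index consists of 2s only. *)
Lemma symmetric_twos_three_twos (z : seq nat -> mzvalg R) :
  z [::] = 1 -> (forall n, (0 < n)%N -> zeta2_ideal (z (nseq n 2%N))) ->
  zeta2_ideal (\sum_(j < (size k).+1) (-1) ^+ sumn (drop j k) *
    z (take j k) * z (rev (drop j k)) - (z k - z (rev k))).
Proof.
move=> z0 z2; have k_size : size k = (a + b).+1.
  by rewrite size_cat /= !size_nseq addnS.
rewrite k_size big_ord_recl big_ord_recr /= take0 drop0 z0 mulr1.
have -> : (-1) ^+ sumn k = -1 :> mzvalg R.
  rewrite -signr_odd sumn_cat /= !sumn_nseq (_ : odd _ = true) ?expr1 //.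
  by lia.
rewrite /bump /= add1n -k_size take_size drop_size z0 !mul1r !mulr1.
set S := \sum_(i < _) _.
have -> : -1 * z (rev k) + (S + z k) - (z k - z (rev k)) = S by ring.
apply: zeta2_ideal_sum => j _; rewrite /bump /= add1n.
have [ja|aj] := leqP j.+1 a.
  rewrite mulrAC; apply: zeta2_idealM.
  by rewrite takel_cat ?size_nseq // take_nseq //; apply: z2.
apply: zeta2_idealM; rewrite drop_cat size_nseq ltnNge (ltnW aj) /=.
have -> : (j.+1 - a = (j - a).+1)%N by lia.
rewrite /= drop_nseq rev_nseq; apply: z2.
by have := ltn_ord j; lia.
Qed.

Lemma zeta_star_twos_ideal n : (0 < n)%N -> zeta2_ideal (zeta_star (nseq n 2%N)).
Proof.
move=> n0; have := @star_twos_mod _ _ zeta2_ideal0 zeta2_idealD zeta2_idealM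
  (fun l => zeta_star (rev l)) (fun l => zeta (rev l)) zeta_nil _ n _ n.
rewrite rev_nseq n0 leqnn; apply => // [l l2 l0|i /andP[i0 _]].
  by rewrite -[RHS](zeta_antipode l2 l0); apply: eq_bigr => j _; rewrite revK.
by rewrite rev_nseq; apply: zeta_twos_ideal.
Qed.

Lemma zeta_star_twos_three_twos :
  zeta2_ideal (zeta_star k - (-1) ^+ (a + b) * zeta (rev k)).
Proof.
have := @antipode_twos_three_twos _ _ zeta2_ideal0 zeta2_idealD zeta2_idealM
  (fun l => zeta_star (rev l)) (fun l => zeta (rev l)) zeta_star_nil zeta_nil
  _ (a + b) _ a b.
rewrite /= revK; apply; [move=> l l2 l0|move=> i /andP[i0 _]|exact: leq_addr|exact: leq_addl].
  by rewrite -[RHS](zeta_antipode l2 l0); apply: eq_bigr => j _; rewrite revK.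
by rewrite rev_nseq; apply: zeta_twos_ideal.
Qed.

End TwosThreeTwos.

Lemma zetaS1_twos_three_twos reg a b :
  let k := nseq a 2%N ++ 3%N :: nseq b 2%N in
  zetaS1 R reg k = to_mzvbar (zeta k - zeta (rev k)).
Proof.
move=> k; rewrite zetaS1_ge2; last by rewrite all_cat /= !all_nseq !orbT.
apply/to_mzvbar_eq; apply: symmetric_twos_three_twos; first exact: zeta_nil.
exact: zeta_twos_ideal.
Qed.

Lemma zeta_starS1_twos_three_twos reg a b :
  let k := nseq a 2%N ++ 3%N :: nseq b 2%N in
  zeta_starS1 R reg k = to_mzvbar ((-1) ^+ (a + b) * (zeta (rev k) - zeta k)).
Proof.
move=> k; rewrite zeta_starS1_ge2; last by rewrite all_cat /= !all_nseq !orbT.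
have kr : rev k = nseq b 2%N ++ 3%N :: nseq a 2%N.
  by rewrite rev_cat rev_cons !rev_nseq cat_rcons.
apply/to_mzvbar_eq; set S := \sum_(_ < _) _.
have H1 : zeta2_ideal (S - (zeta_star k - zeta_star (rev k))).
  apply: symmetric_twos_three_twos; first exact: zeta_star_nil.
  exact: zeta_star_twos_ideal.
have H2 := zeta_star_twos_three_twos a b.
have := zeta_star_twos_three_twos b a; rewrite -kr revK addnC => H3.
have := zeta2_idealD H1 (zeta2_idealD H2 (zeta2_idealN H3)).
rewrite -/k; congr zeta2_ideal; ring.
Qed.

End ModuloZeta2.

(** * Zagier's generating function *)

Section PowerSeriesInverse.
Variable F : fieldType.
Implicit Types (c d : F) (f g H : nat -> F) (a i : nat).

(* Multiplication of the power series with coefficients f by c - z. *)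
Definition mul_sub c f : nat -> F :=
  fun a => c * f a - (if a is a'.+1 then f a' else 0).

Lemma mul_sub_inj c f g : c != 0 -> mul_sub c f =1 mul_sub c g -> f =1 g.
Proof.
move=> c0 fg; elim=> [|a IHa]; have := fg; rewrite /mul_sub.
  by move=> /(_ 0%N); rewrite !subr0 => /(mulfI c0).
by move=> /(_ a.+1); rewrite IHa => /addIr /(mulfI c0).
Qed.

Lemma mul_subC c d f a : mul_sub c (mul_sub d f) a = mul_sub d (mul_sub c f) a.
Proof. by rewrite /mul_sub; case: a => [|[|a]]; ring. Qed.

Lemma coef_mul_sub c (q : {poly F}) a : ((c%:P - 'X) * q)`_a = mul_sub c (nth 0 q) a.
Proof.
rewrite mulrBl coefB coefCM coefXM /mul_sub.
by case: a => [|a].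
Qed.

(** The coefficients of the power series [H(z) / (c - z)]. *)
Definition div_sub c H : nat -> F := fun a => \sum_(i < a.+1) c ^- (a - i).+1 * H i.

Lemma div_subK c H a : c != 0 -> mul_sub c (div_sub c H) a = H a.
Proof.
move=> c0; rewrite /mul_sub /div_sub; case: a => [|a].
  by rewrite big_ord1 subr0 mulrA expr1 mulfV // mul1r.
rewrite big_ord_recr /= subnn expr1 mulrDr mulVKf // mulr_sumr addrAC -sumrB.
rewrite big1 ?add0r // => i _; rewrite subSn -1?ltnS // exprS invfM mulrA.
by rewrite (mulrA c) mulfV // mul1r subrr.
Qed.

(** Division by [(c - z)(d - z)], with [(d - c) / ((c - z)(d - z)) = 1 / (c - z) - 1 / (d - z)]. The
    candidate is checked by multiplying back by both factors, which is injective. *)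
Lemma div_sub_partial_fraction c d (q H : {poly F}) a : c != 0 -> d != 0 ->
  forall s t : F,
  (c%:P - 'X) * (d%:P - 'X) * q =
    (d - c) *: H - s *: (c%:P - 'X) - t *: (d%:P - 'X) ->
  q`_a = div_sub c (nth 0 H) a - div_sub d (nth 0 H) a -
    s * d ^- a.+1 - t * c ^- a.+1.
Proof.
move=> c0 d0 s t E; pose g a := div_sub c (nth 0 H) a - div_sub d (nth 0 H) a -
    s * d ^- a.+1 - t * c ^- a.+1.
have mul_geom e b : e != 0 -> mul_sub e (fun b => e ^- b.+1) b = (b == 0%N)%:R.
  move=> e0; rewrite /mul_sub; case: b => [|b]; first by rewrite expr1 mulfV // subr0.
  by rewrite (exprS e b.+1) invfM mulrA mulfV // mul1r subrr.
have gE b : mul_sub c (mul_sub d g) b = ((c%:P - 'X) * (d%:P - 'X) * q)`_b.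
  have H1 : mul_sub d g = fun b => mul_sub d (div_sub c (nth 0 H)) b - nth 0 H b -
      s * (b == 0%N)%:R - t * mul_sub d (fun b => c ^- b.+1) b.
    apply/funext => e; rewrite -(div_subK (nth 0 H) e d0) -(mul_geom d e d0).
    by rewrite /g /mul_sub; case: e => [|e]; ring.
  rewrite H1.
  transitivity (mul_sub c (mul_sub d (div_sub c (nth 0 H))) b - mul_sub c (nth 0 H) b -
     s * mul_sub c (fun b => (b == 0%N)%:R) b - t * mul_sub c (mul_sub d (fun b => c ^- b.+1)) b).
    by move: (mul_sub d _) (mul_sub d _) => u v; rewrite /mul_sub; case: b => [|b]; ring.
  rewrite !(mul_subC c d).
  have -> : mul_sub c (div_sub c (nth 0 H)) = nth 0 H.
    by apply/funext => e; rewrite div_subK.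
  have -> : mul_sub c (fun b => c ^- b.+1) = fun b => (b == 0%N)%:R.
    by apply/funext => e; rewrite mul_geom.
  rewrite E !coefB !coefZ !coefB !coefC coefX /mul_sub.
  by case: b => [|[|b]] /=; ring.
suff gq : g =1 nth 0 q by rewrite -gq.
apply: (mul_sub_inj d0); apply: (mul_sub_inj c0) => b.
rewrite gE -mulrA coef_mul_sub /mul_sub; case: b => [|b]; rewrite !coef_mul_sub //.
Qed.

End PowerSeriesInverse.

Section ShiftRecursion.
Variable F : fieldType.
Hypothesis natF_neq0 : forall n, (0 < n)%N -> n%:R != 0 :> F.
Implicit Types (m n j a : nat) (y : F).
Local Notation P := (sine_prod F 1).

Definition sine_val n y : F := (P n).[y ^+ 2].

(** The truncation of T(y), kept as a polynomial in [z]. Its denominators vanish only at integers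
    [y], hence [not_integer]. *)
Definition zagier_poly n y : {poly F} :=
  \sum_(1 <= m < n) (m%:R ^- 3 / sine_val m.+1 y) *: P m.

Definition not_integer y := forall j, (y != j%:R) && (y != - j%:R).

Lemma not_integer_succ y : not_integer y -> not_integer (y + 1).
Proof.
move=> yZ j; have yE x : y + 1 = x -> y = x - 1 by move=> <-; rewrite addrK.
have yN i : y + 1 != - i%:R.
  apply/eqP => /yE; rewrite -opprD natr1 => y_eq.
  by have := yZ i.+1; rewrite y_eq eqxx andbF.
rewrite yN andbT; case: j => [|j]; first by have := yN 0%N; rewrite oppr0.
apply/eqP => /yE; rewrite -natr1 addrK => y_eq.
by have := yZ j; rewrite y_eq eqxx.
Qed.

Lemma sine_val0 y : sine_val 1 y = 1.
Proof. by rewrite /sine_val sine_prod_nil // hornerC. Qed.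

Lemma sine_valS m y :
  sine_val m.+2 y = sine_val m.+1 y * (1 - m.+1%:R ^- 2 * y ^+ 2).
Proof.
rewrite /sine_val sine_prod_recr // hornerM hornerD hornerN hornerZ hornerX.
by rewrite hornerC.
Qed.

Lemma sine_val_factor m y : (0 < m)%N ->
  1 - m%:R ^- 2 * y ^+ 2 = m%:R ^- 2 * ((m%:R - y) * (m%:R + y)).
Proof. by move=> m0; have := natF_neq0 m0 => m0'; field. Qed.

Lemma sub_nat_neq0 y j : not_integer y -> j%:R - y != 0.
Proof. by move=> yZ; rewrite subr_eq0 eq_sym; case/andP: (yZ j). Qed.

Lemma add_nat_neq0 y j : not_integer y -> j%:R + y != 0.
Proof. by move=> yZ; rewrite addrC -[j%:R]opprK subr_eq0; case/andP: (yZ j). Qed.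

Lemma sine_val_neq0 n y : not_integer y -> sine_val n y != 0.
Proof.
move=> yZ; case: n => [|n]; first by rewrite /sine_val sine_prod_nil // hornerC oner_neq0.
elim: n => [|n IHn]; first by rewrite sine_val0 oner_neq0.
rewrite sine_valS sine_val_factor // !mulf_neq0 ?sub_nat_neq0 ?add_nat_neq0 //.
by rewrite invr_eq0 expf_neq0 // natF_neq0.
Qed.

Lemma sine_val_opp n y : sine_val n (- y) = sine_val n y.
Proof. by rewrite /sine_val sqrrN. Qed.

Lemma zagier_poly_opp n y : zagier_poly n (- y) = zagier_poly n y.
Proof. by apply: eq_bigr => m _; rewrite sine_val_opp. Qed.

(** Shifting [y] by 1 moves each factor [j - y] or [j + y] to its neighbour, so only the end factors
    change. *)
Lemma sine_val_shift m y :
  (m%:R - y) * (y + 1) * sine_val m.+1 (y + 1) =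
  - y * (y + m.+1%:R) * sine_val m.+1 y.
Proof.
elim: m => [|m IHm]; first by rewrite !sine_val0 sub0r mulr1n !mulr1.
rewrite !sine_valS !sine_val_factor //.
have m0 : m.+1%:R != 0 :> F by apply: natF_neq0.
transitivity (m.+1%:R ^- 2 * (m.+1%:R - y) * (y + m.+2%:R) *
  ((m%:R - y) * (y + 1) * sine_val m.+1 (y + 1))).
  by rewrite -!natr1; ring.
by rewrite IHm -!natr1; ring.
Qed.

(** The certificate of [half_telescope], with [y] for [k] and [1 / sine_val m.+1 y] for the values
    of [Q m]. As [y] is no integer, the lower boundary term stays. *)
Lemma zagier_telescope n y : not_integer y ->
  let c := (y ^+ 2)%:P - 'X in
  let d := ((y + 1) ^+ 2)%:P - 'X in
  c * d * \sum_(1 <= m < n.+1)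
     (m%:R ^- 2 / sine_val m.+1 y / (y + m.+1%:R)) *: P m =
  ((n.+1%:R + y * (y + 1))%:P - 'X) * P n.+1 *
    ((sine_val n.+1 y)^-1 / (y + n.+1%:R))%:P -
  ((1 + y * (y + 1))%:P - 'X) * ((y + 1)^-1)%:P.
Proof.
move=> yZ c d; elim: n => [|n IHn].
  by rewrite big_geq // mulr0 sine_val0 invr1 sine_prod_nil // mulr1 mul1r subrr.
rewrite big_nat_recr //= mulrDr IHn addrAC; congr (_ - _).
rewrite [in RHS]sine_prod_recr //; set Pn := P n.+1.
have n0 : n.+1%:R != 0 :> F by apply: natF_neq0.
have s0 : y + n.+1%:R != 0 by rewrite addrC add_nat_neq0.
have s1 : y + n.+2%:R != 0 by rewrite addrC add_nat_neq0.
have q0 := sine_val_neq0 n.+1 yZ; have q1 := sine_val_neq0 n.+2 yZ.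
have E0 : (sine_val n.+1 y)^-1 / (y + n.+1%:R) =
    n.+1%:R ^- 2 * (n.+1%:R - y) / sine_val n.+2 y.
  apply: (mulIf q1); rewrite mulfVK // {1}sine_valS sine_val_factor //.
  by move: (n.+1%:R : F) (sine_val _ _) n0 s0 q0 => N v n0 s0 v0; field; rewrite ?s0 ?n0 ?v0.
rewrite E0; move: (sine_val n.+2 y)^-1 => q.
have iE : (n.+1%:R ^- 2)%:P * (n%:R + 1) ^+ 2 = 1 :> {poly F}.
  by rewrite natr1 -polyC_natr -polyC_exp -polyCM mulVf // expf_neq0.
have rE : ((y + n.+2%:R)^-1)%:P * (y%:P + n%:R + 2) = 1 :> {poly F}.
  rewrite -addrA -[_ + 2]natrD addn2 -polyC_natr -polyCD -polyCM mulVf //.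
rewrite -!mul_polyC !(polyCM, polyCB, polyCD) /c /d !polyC_exp !(polyCM, polyCD) polyC1.
rewrite !polyC_natr; move: iE rE; set i := (_ ^- 2)%:P; set r := (_^-1)%:P => iE rE.
rewrite -!natr1; set N : {poly F} := n%:R; set X := 'X; set Y := y%:P.
rewrite -/N -/Y in iE rE.
set A := (_ - X).
transitivity (A * Pn * (i * (N + 1 - Y) * q%:P) * (r * (Y + N + 2)) +
  (Y ^+ 2 - X) * ((Y + 1) ^+ 2 - X) * (i * q%:P * r * Pn)).
  by rewrite rE mulr1.
transitivity ((N + 1 + 1 + Y * (Y + 1) - X) * (Pn * (i * (N + 1) ^+ 2 - i * X)) *
   (q%:P * r)).
  by rewrite /A; ring.
by rewrite iE (addrC 1 (N + 1)).
Qed.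

(** As in [half_step], the shift leaves the factor [(2y + 1) / y]. Here [2y + 1] is the difference
    of the poles [(y + 1)^2] and [y^2], just what the partial fractions require. *)
Lemma zagier_poly_shift n a y : not_integer y ->
  let H := ((n.+1%:R + y * (y + 1))%:P - 'X) * P n.+1 *
    ((sine_val n.+1 y)^-1 / (y + n.+1%:R) / y)%:P in
  (zagier_poly n.+1 y - zagier_poly n.+1 (y + 1))`_a =
  \sum_(i < a.+1) (y ^- (2 * (a - i) + 2) - (y + 1) ^- (2 * (a - i) + 2)) * H`_i -
  y ^- (2 * a + 3) - (y + 1) ^- (2 * a + 3).
Proof.
move=> yZ H.
have y0 : y != 0 by case/andP: (yZ 0%N).
have y1 : y + 1 != 0 by have := not_integer_succ yZ => /(_ 0%N)/andP[].
have c0 : y ^+ 2 != 0 by rewrite expf_neq0.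
have d0 : (y + 1) ^+ 2 != 0 by rewrite expf_neq0.
have pow b : (y ^+ 2) ^- b.+1 = y ^- (2 * b + 2).
  by rewrite -exprM; congr (_ ^- _); lia.
have pow1 b : ((y + 1) ^+ 2) ^- b.+1 = (y + 1) ^- (2 * b + 2).
  by rewrite -exprM; congr (_ ^- _); lia.
rewrite (@div_sub_partial_fraction _ (y ^+ 2) ((y + 1) ^+ 2) _ H a c0 d0 (y + 1)^-1 y^-1).
  rewrite /div_sub -sumrB addrAC; congr (_ - _ - _).
  - by apply: eq_bigr => i _; rewrite pow pow1 mulrBl.
  - by rewrite pow -invfM -exprS; congr (_ ^- _); lia.
  - by rewrite pow1 -invfM -exprS; congr (_ ^- _); lia.
have -> : zagier_poly n.+1 y - zagier_poly n.+1 (y + 1) = ((1 + 2 * y) / y) *: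
    \sum_(1 <= m < n.+1) (m%:R ^- 2 / sine_val m.+1 y / (y + m.+1%:R)) *: P m.
  rewrite -sumrB scaler_sumr; apply: eq_big_nat => m /andP[m0 _].
  rewrite scalerA -scalerBl; congr (_ *: _).
  have q0 := sine_val_neq0 m.+1 yZ; have q1 := sine_val_neq0 m.+1 (not_integer_succ yZ).
  have s0 : y + m.+1%:R != 0 by rewrite addrC add_nat_neq0.
  have t0 := sub_nat_neq0 m yZ; have n0 := natF_neq0 m0.
  have -> : (sine_val m.+1 (y + 1))^-1 =
      (m%:R - y) * (y + 1) / (- y * (y + m.+1%:R) * sine_val m.+1 y).
    by rewrite -sine_val_shift invfM mulrA mulfV ?mul1r // mulf_neq0.
  move: (sine_val _ _) q0 => v v0; rewrite -natr1 in s0 *.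
  by move: (m%:R : F) n0 s0 t0 => N n0 s0 t0; field; rewrite ?oppr_eq0 ?v0 ?s0 ?n0 ?y0.
rewrite -scalerAr zagier_telescope // scalerBr -[RHS]addrA -opprD; congr (_ - _).
  rewrite /H (polyCM (_ / _)) -!mul_polyC.
  have -> : ((1 + 2 * y) / y)%:P = ((y + 1) ^+ 2 - y ^+ 2)%:P * (y^-1)%:P :> {poly F}.
    by rewrite -polyCM; congr _%:P; field.
  by ring.
rewrite -!mul_polyC.
have tY : (y^-1)%:P * y%:P = 1 :> {poly F} by rewrite -polyCM mulVf.
have sY : ((y + 1)^-1)%:P * (y%:P + 1) = 1 :> {poly F}.
  by rewrite -polyC1 -polyCD -polyCM mulVf.
rewrite !(polyCM, polyCD, polyC_exp, polyC1).
move: tY sY; move: (y^-1)%:P ((y + 1)^-1)%:P y%:P => t s Y tY sY.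
transitivity (s * (Y ^+ 2 - 'X) * (t * Y) + t * ((Y + 1) ^+ 2 - 'X) * (s * (Y + 1))).
  by ring.
by rewrite tY sY !mulr1.
Qed.

End ShiftRecursion.

(** * The difference equation in the limit *)

Section ShiftLimit.
Variable R : realType.
Implicit Types (m n N i a : nat) (u y l x : R).
Local Notation P := (sine_prod R 1).
Local Notation sine_val := (@sine_val R).
Local Notation zagier_poly := (@zagier_poly R).

Let natR_neq0 n : (0 < n)%N -> n%:R != 0 :> R.
Proof. by rewrite pnatr_eq0 lt0n. Qed.

Lemma tendstoS (v : nat -> R) l : tendsto v l <-> tendsto (fun n => v n.+1) l.
Proof.
split=> [|/tendstoP vl]; first exact: (tendsto_comp (f := succn)).
apply/tendstoP => e /vl[N NP]; exists N.+1 => -[|n] // Nn.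
exact: NP.
Qed.

Lemma tendsto_inv_add y : tendsto (fun n => (n%:R + y)^-1) 0.
Proof.
apply/tendstoP => e e0; exists (Num.bound (`|y| + e^-1)) => n Nn; rewrite subr0.
have ei : 0 < e^-1 by rewrite invr_gt0.
have ny : e^-1 <= n%:R + y.
  have H : `|y| + e^-1 < (Num.bound (`|y| + e^-1))%:R.
    by apply: archi_boundP; rewrite addr_ge0 // ltW.
  have Hn : (Num.bound (`|y| + e^-1))%:R <= n%:R :> R by rewrite ler_nat.
  by have := ler_norm (- y); rewrite normrN; lra.
have ny0 : 0 < n%:R + y by apply: lt_le_trans ny.
by rewrite ger0_norm ?invr_ge0 ?(ltW ny0) // -[e]invrK lef_pV2 ?posrE.
Qed.

Lemma tendsto_ratio x y : tendsto (fun n => (n%:R + x) / (n%:R + y)) 1.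
Proof.
rewrite -[X in tendsto _ X]addr0 -[X in tendsto _ (_ + X)](mulr0 (x - y)).
apply/tendstoP => e e0.
have /tendstoP/(_ e e0)[N NP] := tendstoD (tendsto_cst 1) (tendstoZ (x - y) (tendsto_inv_add y)).
exists (maxn N (Num.bound `|y|)) => n; rewrite geq_max => /andP[Nn Bn].
have := NP n Nn; congr (`|_ - _| <= _).
have ny0 : n%:R + y != 0.
  have H : `|y| < (Num.bound `|y|)%:R by apply: archi_boundP.
  have Hn : (Num.bound `|y|)%:R <= n%:R :> R by rewrite ler_nat.
  have hy := ler_norm (- y); rewrite normrN in hy.
  by rewrite gt_eqF //; lra.
by apply: (mulIf ny0); rewrite mulfVK // mulrDl mul1r mulfVK //; ring.
Qed.

(** The product is at least [1 - u^2 S] with [S] the sum of the [m^-2], where [u^2 <= 1/4] and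
    [S <= 2]. *)
Lemma sine_val_bounds n u : `|u| <= 2^-1 -> 2^-1 <= sine_val n u <= 1.
Proof.
move=> u2; have uu : u ^+ 2 <= 4^-1.
  by rewrite -real_normK ?num_real //; move: `|u| (normr_ge0 u) u2 => v; nra.
have u0 : 0 <= u ^+ 2 by rewrite sqr_ge0.
suff H k : 1 - u ^+ 2 * (\sum_(1 <= m < k.+1) m%:R ^- 2) <= sine_val k.+1 u <= 1.
  case: n => [|n]; first by rewrite /sine_val sine_prod_nil // hornerC; lra.
  have /andP[H1 ->] := H n; rewrite andbT; apply: le_trans H1.
  have := sum_inv_sqr_le R n.+1.
  move: (\sum_(_ <= _ < _) _) => S S2; have : 0 <= u ^+ 2 * (2 - S).
    by rewrite mulr_ge0 // subr_ge0.
  by rewrite mulrBr; lra.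
elim: k => [|k /andP[IH1 IH2]].
  by rewrite big_geq // mulr0 subr0 sine_val0 lexx.
rewrite sine_valS big_nat_recr //=.
have := sum_inv_sqr_le R k.+1; move: (\sum_(_ <= _ < _) _) IH1 => S IH1 S2.
have k0 : 0 <= (k.+1%:R : R) ^- 2 by rewrite inv_exp_ge0.
have k1 : (k.+1%:R : R) ^- 2 <= 1.
  by rewrite invf_le1 ?exprn_gt0 ?ltr0n // exprn_ege1 // ler1n.
move: (_ ^- 2) (sine_val _ _) k0 k1 IH1 IH2 => t v t0 t1 IH1 IH2.
have w0 : 0 <= u ^+ 2 * t by rewrite mulr_ge0.
have w1 : u ^+ 2 * t <= 1 by nra.
have v0 : 0 <= v.
  by apply: le_trans IH1; have : 0 <= u ^+ 2 * (2 - S); [rewrite mulr_ge0 ?subr_ge0 | lra].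
rewrite mulrDr (mulrC t); move: (u ^+ 2 * t) w0 w1 => w w0 w1.
have : 0 <= w * (1 - v) by rewrite mulr_ge0 ?subr_ge0.
have : 0 <= w * v by rewrite mulr_ge0.
by move=> *; apply/andP; split; lra.
Qed.

Lemma sine_val_lim u : `|u| <= 2^-1 ->
  exists2 q, tendsto (fun n => sine_val n u) q & 2^-1 <= q <= 1.
Proof.
move=> u2; pose v n := - sine_val n u.
have vv : tendsto v (limn v).
  apply: (@tendsto_monotone _ _ 0) => n; last first.
    by have /andP[+ _] := sine_val_bounds n u2; rewrite /v; lra.
  rewrite /v lerN2; case: n => [|n].
    by rewrite sine_val0 /sine_val sine_prod_nil // hornerC.
  rewrite sine_valS -[leRHS]mulr1; apply: ler_wpM2l.
    by have /andP[+ _] := sine_val_bounds n.+1 u2; lra.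
  by rewrite gerBl mulr_ge0 ?inv_exp_ge0 ?sqr_ge0.
have vq : tendsto (fun n => sine_val n u) (- limn v).
  by apply: tendsto_ext (tendstoN vv) _ => n; rewrite /v opprK.
exists (- limn v) => //.
have := tendsto_bound (N0 := 0) (c := 4^-1) (tendstoB vq (tendsto_cst (3 / 4))).
rewrite ler_norml => H; suff : - 4^-1 <= - limn v - 3 / 4 <= 4^-1.
  by move=> /andP[h1 h2]; apply/andP; split; lra.
apply: H => n _; have /andP[h1 h2] := sine_val_bounds n u2.
by rewrite ler_norml; apply/andP; split; lra.
Qed.

(** [y] times the limit changes sign when [y] grows by 1, like sin(pi y). *)
Lemma sine_val_shift_lim y l : not_integer y ->
  tendsto (fun n => sine_val n.+1 y) l ->
  tendsto (fun n => sine_val n.+1 (y + 1)) (- (y * l) / (y + 1)).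
Proof.
move=> yZ yl.
have y1 : y + 1 != 0 by have := not_integer_succ yZ => /(_ 0%N)/andP[].
have H := tendstoM (tendstoZ (- y / (y + 1)) yl) (tendsto_ratio (y + 1) (- y)).
rewrite (_ : - (y * l) / (y + 1) = - y / (y + 1) * l * 1); last by field.
apply: tendsto_ext H _ => m; have m0 := sub_nat_neq0 m yZ.
apply: (mulfI m0); apply: (mulfI y1).
transitivity (- y * (y + m.+1%:R) * sine_val m.+1 y).
  by rewrite -natr1; field; rewrite m0 y1.
by rewrite -sine_val_shift //; ring.
Qed.

(** In [H], the part of order [n] meets the denominator [y + n + 1] and leaves the coefficient of
    [P], while the part multiplied by [X] tends to 0. *)
Lemma zagier_poly_shift_lim a y l : not_integer y -> l != 0 ->
  tendsto (fun n => sine_val n.+1 y) l ->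
  tendsto (fun n => (zagier_poly n.+1 y - zagier_poly n.+1 (y + 1))`_a)
   (\sum_(i < a.+1) (y ^- (2 * (a - i) + 2) - (y + 1) ^- (2 * (a - i) + 2)) *
       ((-1) ^+ i * mzv R (nseq i 2%N) / (y * l)) -
    y ^- (2 * a + 3) - (y + 1) ^- (2 * a + 3)).
Proof.
move=> yZ l0 yl; apply: tendsto_ext; last first.
  by move=> n; apply/esym; apply: zagier_poly_shift.
apply: tendstoB (tendsto_cst _); apply: tendstoB (tendsto_cst _).
apply: (tendsto_sum _ (f := fun (i : 'I_a.+1) n => _)) => i _; apply: tendstoZ.
have y0 : y != 0 by case/andP: (yZ 0%N).
have Plim j : tendsto (fun n => (P n.+1)`_j) ((-1) ^+ j * mzv R (nseq j 2%N)).
  exact: (iffLR (tendstoS _ _) (tendsto_coef_sine_prod R j)).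
have inv0 : tendsto (fun n => (y + n.+1%:R)^-1) 0.
  by apply: tendsto_ext (tendsto_inv_add (1 + y)) _ => n; rewrite -natr1; congr _^-1; ring.
have ratio : tendsto (fun n => (n.+1%:R + y * (y + 1)) / (y + n.+1%:R)) 1.
  apply: tendsto_ext (tendsto_ratio (1 + y * (y + 1)) (1 + y)) _ => n.
  by rewrite -natr1; congr (_ / _); ring.
have slope : tendsto (fun n => ((P n.+1)`_i * ((n.+1%:R + y * (y + 1)) / (y + n.+1%:R)) -
    (if (i : nat) is j.+1 then (P n.+1)`_j else 0) * (y + n.+1%:R)^-1) *
    ((sine_val n.+1 y)^-1 / y)) (((-1) ^+ i * mzv R (nseq i 2%N) * 1 -
     (if (i : nat) is j.+1 then (-1) ^+ j * mzv R (nseq j 2%N) else 0) * 0) * (l^-1 / y)).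
  apply: tendstoM; last by apply: tendstoM (tendsto_cst _); apply: tendstoV.
  apply: tendstoB; apply: tendstoM => //.
  by case: (nat_of_ord i) => [|j] //; apply: tendsto_cst.
rewrite (_ : _ / (y * l) = ((-1) ^+ i * mzv R (nseq i 2%N) * 1 -
     (if (i : nat) is j.+1 then (-1) ^+ j * mzv R (nseq j 2%N) else 0) * 0) * (l^-1 / y));
  last by field; rewrite y0 l0.
apply: tendsto_ext slope _ => n.
rewrite coefMC coef_mul_sub /mul_sub.
by case: (nat_of_ord i) => [|j]; ring.
Qed.

End ShiftLimit.

(** * A bound on the remainder, uniform in the truncation *)

Section ShiftBound.
Variable R : realType.
Implicit Types (m n N M a : nat) (u y l x : R).
Local Notation P := (sine_prod R 1).
Local Notation sine_val := (@sine_val R).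
Local Notation zagier_poly := (@zagier_poly R).

Let natR_neq0 n : (0 < n)%N -> n%:R != 0 :> R.
Proof. by rewrite pnatr_eq0 lt0n. Qed.

Lemma coef_sine_prod_le n a : `|(P n)`_a| <= 2 ^+ a.
Proof.
have -> : (P n)`_a = (-1) ^+ a * mhs R false n (nseq a 2%N).
  by rewrite mhs_twos mulrA -exprMn mulrNN mulr1 expr1n mul1r.
rewrite normrM normrX normrN1 expr1n mul1r ger0_norm ?mhs_ge0 //.
by have := mhs_le R false n (k := nseq a 2%N); rewrite all_nseq orbT size_nseq => ->.
Qed.

Lemma not_integer_half y N : 0 < `|y| <= 2^-1 -> not_integer (y + N%:R).
Proof.
move=> /andP[y0 y2]; elim: N => [|N IHN]; last first.
  by rewrite -natr1 addrA; apply: not_integer_succ.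
rewrite addr0 => -[|j]; first by rewrite oppr0 andbb -normr_gt0.
have j1 : 1 <= j.+1%:R :> R by rewrite ler1n.
by move: y2; rewrite ler_norml => /andP[h1 h2]; rewrite lt_eqF ?gt_eqF //; lra.
Qed.

Section LowerBound.
Variables (y0 : R) (m : nat).
Hypothesis y0_half : 0 < `|y0| <= 2^-1.
(** The factor [y0 + N] turns [sine_val_shift] into a pure ratio: at [y = y0 + N], [v] is multiplied
    by [(y + m + 1) / |m - y|]. *)
Let v N := `|(y0 + N%:R) * sine_val m.+1 (y0 + N%:R)|.

Let y0_bounds : - 2^-1 <= y0 <= 2^-1.
Proof. by rewrite -ler_norml; case/andP: y0_half. Qed.

Let vS N : v N.+1 * `|m%:R - (y0 + N%:R)| = v N * `|y0 + N%:R + m.+1%:R|.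
Proof.
rewrite /v -!normrM -natr1 addrA; set y := y0 + N%:R.
transitivity `|(m%:R - y) * (y + 1) * sine_val m.+1 (y + 1)|.
  by congr `|_|; ring.
rewrite sine_val_shift //; transitivity `|- (y * sine_val m.+1 y * (y + m.+1%:R))|.
  by congr `|_|; ring.
by rewrite normrN.
Qed.

Let v_ge0 N : 0 <= v N. Proof. exact: normr_ge0. Qed.

Let d_gt0 N : 0 < `|m%:R - (y0 + N%:R)|.
Proof. by rewrite normr_gt0 sub_nat_neq0 //; apply: not_integer_half. Qed.

Let v_incr N : v N <= v N.+1.
Proof.
rewrite -(ler_pM2r (d_gt0 N)) vS; apply: ler_wpM2l => //.
have N0 : 0 <= N%:R :> R by []. have m0 : 0 <= m%:R :> R by [].
have /andP[h1 h2] := y0_bounds; rewrite -natr1 [leRHS]ger0_norm; last by lra.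
by rewrite ler_norml; apply/andP; split; lra.
Qed.

Lemma sine_val_ge_base N : 2^-1 * `|y0| <= v N.
Proof.
elim: N => [|N IHN]; last exact: le_trans (v_incr N).
rewrite /v addr0 normrM mulrC; apply: ler_wpM2l => //.
have /andP[_ h2] := y0_half; have /andP[h _] := sine_val_bounds m.+1 h2.
by rewrite ger0_norm //; lra.
Qed.

(** Beyond [m], the ratio is [1 + (2m + 1) / (y - m)] with [2m + 1 >= 3] and [y - m <= N]. *)
Let v_step N : (0 < m < N)%N -> v N * (N%:R + 3) <= v N.+1 * N%:R.
Proof.
move=> mN; rewrite -(ler_pM2r (d_gt0 N)) [leRHS]mulrAC vS -!mulrA.
apply: ler_wpM2l => //.
have mN' : m%:R + 1 <= N%:R :> R by rewrite natr1 ler_nat; case/andP: mN.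
have m1 : 1 <= m%:R :> R by rewrite ler1n; case/andP: mN.
have /andP[h1 h2] := y0_bounds; rewrite -(natr1 m).
rewrite ler0_norm ?ger0_norm; [|by lra|by lra].
move: (m%:R) (N%:R) mN' m1 => p q pq p1.
have : 0 <= (p - 1) * q by apply: mulr_ge0; lra.
by rewrite mulrBl; lra.
Qed.

(** The factors [(N + 3) / N] multiply to [M (M + 1) (M + 2)] over [(m + 1) (m + 2) (m + 3)], and
    the latter is at most [24 m^3], with equality at [m = 1]. Cubic growth makes up for the [m^-3]
    of the summand. *)
Lemma sine_val_ge_cubic M : (0 < m < M)%N ->
  2^-1 * `|y0| * M%:R ^+ 3 <= 24 * m%:R ^+ 3 * v M.
Proof.
move=> /andP[m0 mM].
have m1 : 1 <= m%:R :> R by rewrite ler1n.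
have M0 : 0 <= M%:R :> R by [].
set k := 2^-1 * `|y0|; have k0 : 0 <= k by rewrite mulr_ge0 ?invr_ge0.
suff H : k * (M%:R * (M%:R + 1) * (M%:R + 2)) <=
    (m%:R + 1) * (m%:R + 2) * (m%:R + 3) * v M.
  apply: le_trans (_ : k * (M%:R * (M%:R + 1) * (M%:R + 2)) <= _).
    apply: ler_wpM2l => //; move: (M%:R) M0 => q q0.
    have : 0 <= q * q by rewrite mulr_ge0.
    by lra.
  apply: le_trans H _; apply: ler_wpM2r => //; move: (m%:R) m1 => p p1.
  have : 0 <= (p - 1) * (23 * (p * p) + 17 * p + 6).
    rewrite mulr_ge0 ?subr_ge0 // !addr_ge0 ?mulr_ge0 //; lra.
  by lra.
elim: M mM {M0} => [|M IHM] // ; rewrite ltnS leq_eqVlt => /predU1P[<-|mM].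
  have -> : m.+1%:R * (m.+1%:R + 1) * (m.+1%:R + 2) =
      (m%:R + 1) * (m%:R + 2) * (m%:R + 3) :> R by rewrite -(natr1 m); ring.
  rewrite mulrC; apply: ler_wpM2l; last exact: sine_val_ge_base.
  by rewrite !mulr_ge0 // addr_ge0.
have M0 : 0 < M%:R :> R by rewrite ltr0n; lia.
rewrite -(ler_pM2r M0) -[leRHS]mulrA.
apply: le_trans (_ : (m%:R + 1) * (m%:R + 2) * (m%:R + 3) * (v M * (M%:R + 3)) <= _); last first.
  apply: ler_wpM2l; first by rewrite !mulr_ge0 // addr_ge0.
  by apply: v_step; rewrite m0.
have M3 : 0 < M%:R + 3 :> R by rewrite addr_gt0.
have := IHM mM; rewrite -(ler_pM2r M3) => H.
rewrite -(natr1 M) [leRHS]mulrA; apply: le_trans H.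
by rewrite le_eqVlt; apply/orP; left; apply/eqP; ring.
Qed.

End LowerBound.

Lemma sum_min_inv_sqr_le M n : (0 < M)%N ->
  \sum_(1 <= m < n) (if (m < M)%N then M%:R ^- 2 else m%:R ^- 2) <= 3 / M%:R :> R.
Proof.
move=> M0; have M0' : 0 < M%:R :> R by rewrite ltr0n.
suff H k : \sum_(1 <= m < k.+1) (if (m < M)%N then M%:R ^- 2 else m%:R ^- 2) <=
    if (k.+1 <= M)%N then k.+1%:R * M%:R ^- 2 else 3 / M%:R - 2 / k.+1%:R :> R.
  case: n => [|n]; first by rewrite big_geq // divr_ge0.
  apply: le_trans (H n) _; case: ifP => nM; last by rewrite gerBl divr_ge0.
  rewrite exprS expr1 invfM mulrA; apply: ler_wpM2r; first by rewrite invr_ge0.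
  rewrite ler_pdivrMr //; apply: le_trans (_ : M%:R <= _); first by rewrite ler_nat.
  by rewrite ler_peMl // ler1n.
elim: k => [|k IHk]; first by rewrite big_geq // M0 mulr_ge0 // invr_ge0 exprn_ge0.
rewrite big_nat_recr //=; apply: le_trans (lerD IHk (lexx _)) _.
have k0 : 0 < k.+1%:R :> R by [].
have k1 : 1 <= k.+1%:R :> R by rewrite ler1n.
have [kM|Mk] := ltnP k.+1 M.
  rewrite (ltnW kM) -[k.+2%:R]natr1 mulrDl mul1r; exact: lexx.
have step : k.+1%:R ^- 2 <= 2 / k.+1%:R - 2 / k.+2%:R :> R.
  rewrite -[k.+2%:R]natr1; move: (k.+1%:R) k0 k1 => q q0 q1.
  rewrite -subr_ge0 (_ : _ - _ = (q - 1) / (q ^+ 2 * (q + 1))).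
    by apply: divr_ge0; rewrite ?subr_ge0 //; apply: mulr_ge0; rewrite ?exprn_ge0 ?addr_ge0 // ltW.
  by field; rewrite !gt_eqF ?addr_gt0.
case: ifP => kM; last first.
  by move: step; move: (_ ^- 2) (2 / k.+1%:R) (2 / k.+2%:R) (3 / M%:R) => *; lra.
have {kM} kM : M = k.+1 by apply/eqP; rewrite eqn_leq Mk kM.
have -> : k.+1%:R * M%:R ^- 2 = k.+1%:R^-1 :> R.
  by rewrite kM exprS expr1 invfM mulrA mulfV ?mul1r // gt_eqF.
rewrite kM; move: step; move: (_ ^- 2) (k.+1%:R^-1) (2 / k.+2%:R) => *; lra.
Qed.

(** For [m < M] the cubic growth bounds the summand by a multiple of [M^-2]; for [m >= M]
    monotonicity alone gives a multiple of [m^-2]. *)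
Lemma zagier_poly_bound a y0 : 0 < `|y0| <= 2^-1 ->
  exists K, forall n M, (0 < M)%N -> `|(zagier_poly n (y0 + M%:R))`_a| <= K / M%:R.
Proof.
move=> y0_half; have /andP[y0_gt0 y0_le] := y0_half.
pose k := 2^-1 * `|y0|; have k0 : 0 < k by rewrite mulr_gt0 ?invr_gt0.
(* [2^a] bounds the coefficient of [P], and 48 is the 24 of the cubic bound times the 2 of [YM]. *)
pose C : R := 2 ^+ a * 48 / k.
have C0 : 0 <= C by apply: divr_ge0; [apply: mulr_ge0; rewrite ?exprn_ge0|apply: ltW].
exists (C * 3) => n M M0; have M0' : 0 < M%:R :> R by rewrite ltr0n.
apply: le_trans (_ : \sum_(1 <= m < n) C * (if (m < M)%N then M%:R ^- 2 else m%:R ^- 2) <= _);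
  last by rewrite -mulr_sumr -[leRHS]mulrA; apply: ler_wpM2l => //; apply: sum_min_inv_sqr_le.
rewrite coef_sum; apply: le_trans (ler_norm_sum _ _ _) _.
apply: ler_sum_nat => m /andP[m0 mn]; rewrite coefZ.
have m0' : 0 < m%:R :> R by rewrite ltr0n.
set Y := y0 + M%:R; have YZ : not_integer Y by apply: not_integer_half.
have Y0 : 0 < `|Y| by rewrite normr_gt0; case/andP: (YZ 0%N).
have v0 : 0 < `|sine_val m.+1 Y| by rewrite normr_gt0 sine_val_neq0.
have YM : `|Y| <= 2 * M%:R.
  have : 1 <= M%:R :> R by rewrite ler1n.
  move: y0_le; rewrite ler_norml => /andP[h1 h2] h3.
  by rewrite ler_norml /Y; apply/andP; split; lra.
rewrite !normrM normfV normrX normfV (ger0_norm (ltW m0')) -!mulrA.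
apply: le_trans (_ : m%:R ^- 3 * (`|sine_val m.+1 Y|^-1 * 2 ^+ a) <= _).
  rewrite ler_wpM2l ?inv_exp_ge0 // ler_wpM2l ?invr_ge0 //.
  exact: coef_sine_prod_le.
have base := sine_val_ge_base m y0_half M; rewrite -/Y -/k normrM in base.
have H : (`|Y| * `|sine_val m.+1 Y|)^-1 * `|Y| = `|sine_val m.+1 Y|^-1.
  by rewrite invfM mulrAC mulVf ?mul1r // gt_eqF.
rewrite -H; set v := `|Y| * _ in base *; have v1 : 0 < v by rewrite mulr_gt0.
have e0 : 0 <= 2 ^+ a :> R by rewrite exprn_ge0.
rewrite [leLHS](_ : _ = 2 ^+ a * (m%:R ^- 3 * v^-1 * `|Y|)); last by ring.
apply: ler_wpM2l => //.
case: ifP => mM.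
  have := sine_val_ge_cubic (m := m) y0_half (M := M); rewrite m0 mM => /(_ isT).
  rewrite -/Y -/k normrM -/v => cub.
  apply: le_trans (_ : 24 / (k * M%:R ^+ 3) * (2 * M%:R) <= _).
    apply: ler_pM => //; first by rewrite mulr_ge0 ?inv_exp_ge0 ?invr_ge0 ?ltW.
    have q0 : 0 < k * M%:R ^+ 3 by rewrite mulr_gt0 // exprn_gt0.
    have p0 : 0 < m%:R ^+ 3 * v by rewrite mulr_gt0 // exprn_gt0.
    by rewrite -invfM (ler_pdivlMr _ _ q0) mulrC (ler_pdivrMr _ _ p0) [leRHS]mulrA.
  rewrite le_eqVlt; apply/orP; left; apply/eqP; field.
  by rewrite !gt_eqF.
have {mM} mM : M%:R <= m%:R :> R by rewrite ler_nat leqNgt mM.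
apply: le_trans (_ : m%:R ^- 3 * k^-1 * (2 * m%:R) <= _).
  apply: ler_pM => //; first by rewrite mulr_ge0 ?inv_exp_ge0 ?invr_ge0 ?ltW.
    by apply: ler_wpM2l; [apply: inv_exp_ge0 | rewrite lef_pV2].
  by apply: le_trans YM _; apply: ler_wpM2l.
have -> : m%:R ^- 3 / k * (2 * m%:R) = 2 / k * m%:R ^- 2 by field; rewrite !gt_eqF.
rewrite mulrA; apply: ler_wpM2r; first exact: inv_exp_ge0.
by apply: ler_wpM2r; [rewrite invr_ge0 ltW | rewrite ler_nat].
Qed.

End ShiftBound.

(** * Comparison of coefficients *)

Section Expansions.
Variable R : realType.
Implicit Types (n b B s N M i : nat) (x u C K : R) (q : {poly R}).

Lemma sum_half_le n x : 0 <= x <= 2^-1 -> \sum_(i < n) x ^+ i <= 2.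
Proof.
move=> /andP[x0 x2]; suff : \sum_(i < n) x ^+ i <= 2 - 2^-1 ^+ n * 2.
  by move=> /le_trans; apply; rewrite gerBl mulr_ge0 ?exprn_ge0 ?invr_ge0.
elim: n => [|n IHn]; first by rewrite big_ord0 expr0 mul1r subrr.
rewrite big_ord_recr /=; have : x ^+ n <= 2^-1 ^+ n by rewrite lerXn2r ?nnegrE ?invr_ge0.
by rewrite exprS; move: IHn; move: (2^-1 ^+ n) => e; lra.
Qed.

Lemma poly_tail q C B x : (forall b, `|q`_b| <= C * 2 ^+ b) -> 0 <= x <= 4^-1 ->
  `|q.[x] - \sum_(b < B) q`_b * x ^+ b| <= 2 * C * (2 * x) ^+ B.
Proof.
move=> qC /andP[x0 x4].
have C0 : 0 <= C by have := qC 0%N; rewrite expr0 mulr1; apply: le_trans.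
rewrite (@horner_coef_wide _ (B + size q)) ?leq_addl // big_split_ord /= addrAC subrr add0r.
apply: le_trans (ler_norm_sum _ _ _) _.
apply: le_trans (_ : \sum_(i < size q) C * (2 * x) ^+ B * (2 * x) ^+ i <= _).
  apply: ler_sum => i _; rewrite normrM normrX (ger0_norm x0) -mulrA -exprD.
  by rewrite exprMn mulrA; apply: ler_wpM2r; rewrite ?exprn_ge0.
rewrite -mulr_sumr -(mulrA 2) mulrC; apply: ler_wpM2r.
  by rewrite mulr_ge0 // exprn_ge0 // mulr_ge0.
by apply: sum_half_le; apply/andP; split; lra.
Qed.

Lemma poly_bounded q : exists C, forall x, 0 <= x <= 1 -> `|q.[x]| <= C.
Proof.
exists (\sum_(i < size q) `|q`_i|) => x /andP[x0 x1]; rewrite horner_coef.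
apply: le_trans (ler_norm_sum _ _ _) _; apply: ler_sum => i _.
by rewrite normrM normrX (ger0_norm x0) ler_piMr // exprn_ile1.
Qed.

(** The constant coefficient is O(x), hence zero; then [X] is divided out. *)
Lemma poly_small_coef q K B :
  (forall x, 0 < x <= 2^-1 -> `|q.[x]| <= K * x ^+ B) ->
  forall b, (b < B)%N -> q`_b = 0.
Proof.
elim: B q => [|B IHB] q qK // b bB.
have [r rE] : exists r, q = q`_0 *: 1 + 'X * r.
  exists (drop_poly 1 q); rewrite -{1}(poly_take_drop 1 q) expr1 mulrC alg_polyC.
  by congr (_ + _); apply/polyP => -[|i]; rewrite coef_take_poly coefC.
have {}rE : q = (q`_0)%:P + 'X * r by rewrite {1}rE alg_polyC.
have q0 : q`_0 = 0.
  have [C rC] := poly_bounded r.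
  have C0 : 0 <= C by apply: le_trans (rC 0 _); rewrite ?lexx ?ler01.
  have K0 : 0 <= K.
    have := qK (2^-1) _; rewrite invr_gt0 lexx ltr0n => /(_ isT).
    by move=> /(le_trans (normr_ge0 _)); rewrite pmulr_lge0 // exprn_gt0 // invr_gt0.
  apply/eqP; rewrite -normr_eq0 eq_le normr_ge0 andbT; apply/ler_addgt0Pr => e e0.
  have CK : 0 < C + K + 1 by lra.
  pose x := Num.min 2^-1 (e / (C + K + 1)).
  have x0 : 0 < x by rewrite lt_min; apply/andP; split; [rewrite invr_gt0 | apply: divr_gt0].
  have x2 : x <= 2^-1 by rewrite ge_min lexx.
  have xe : x * (C + K + 1) <= e by rewrite -ler_pdivlMr // ge_min lexx orbT.
  have -> : q`_0 = q.[x] - x * r.[x].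
    by rewrite {2}rE hornerD hornerC hornerM hornerX addrK.
  rewrite add0r; apply: le_trans (ler_normB _ _) _; apply: le_trans xe.
  rewrite normrM (ger0_norm (ltW x0)).
  have h1 : `|q.[x]| <= K * x.
    apply: le_trans (qK x _) _; first by rewrite x0.
    by apply: ler_wpM2l => //; rewrite exprS ler_piMr ?(ltW x0) // exprn_ile1 ?(ltW x0) //; lra.
  have h2 : x * `|r.[x]| <= x * C.
    by apply: ler_wpM2l; [apply: ltW | apply: rC; rewrite (ltW x0) /=; lra].
  by rewrite !mulrDr; lra.
case: b bB => [|b] // bB; rewrite rE q0 coefD coefC coefXM /= add0r.
apply: IHB bB => x x0; have := qK x x0; rewrite rE q0 hornerD hornerC hornerM hornerX add0r.
case/andP: x0 => x0 _.
by rewrite normrM (gtr0_norm x0) exprS mulrCA ler_pM2l.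
Qed.

(** Dividing by [1 - x] replaces the coefficients by their partial sums [D], which is Pascal's rule,
    and leaves one extra term in [x^B]. *)
Lemma inv_pow_taylor s B : exists K, forall x, `|x| <= 2^-1 ->
  `|(1 - x) ^- s.+1 - \sum_(b < B) 'C(s + b, b)%:R * x ^+ b| <= K * `|x| ^+ B.
Proof.
have inv_le x : `|x| <= 2^-1 -> `|(1 - x)^-1| <= 2.
  rewrite ler_norml => /andP[h1 h2]; rewrite ger0_norm ?invr_ge0; last by lra.
  by rewrite -[2]invrK lef_pV2 ?posrE ?invr_gt0 //; lra.
have neq x : `|x| <= 2^-1 -> 1 - x != 0.
  by rewrite ler_norml => /andP[h1 h2]; rewrite gt_eqF //; lra.
elim: s => [|s [K IHs]].
  exists 2 => x x2; rewrite expr1.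
  have -> : (1 - x)^-1 - \sum_(b < B) 'C(0 + b, b)%:R * x ^+ b = (1 - x)^-1 * x ^+ B.
    apply: (mulfI (neq x x2)); rewrite mulrBr mulVKf ?neq // mulfV ?neq //.
    rewrite (eq_bigr (fun b : 'I_B => x ^+ b)); last by move=> b _; rewrite binn mul1r.
    by have /eqP := subrX1 x B; rewrite subr_eq => /eqP ->; ring.
  by rewrite normrM normrX; apply: ler_wpM2r; rewrite ?exprn_ge0 ?inv_le.
pose D n : R := if n is n'.+1 then 'C(s.+1 + n', n')%:R else 0.
have DE n : D n.+1 = 'C(s + n, n)%:R + D n.
  case: n => [|n]; first by rewrite /D !bin0 addr0.
  by rewrite /D addSn binS natrD addSnnS.
exists (2 * (K + `|D B|)) => x x2; have x0 := neq x x2.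
have -> : (1 - x) ^- s.+2 - \sum_(b < B) 'C(s.+1 + b, b)%:R * x ^+ b =
    (1 - x)^-1 * ((1 - x) ^- s.+1 - \sum_(b < B) 'C(s + b, b)%:R * x ^+ b + D B * x ^+ B).
  apply: (mulfI x0); rewrite mulVKf // mulrBr (exprS _ s.+1) invfM mulVKf //.
  rewrite -addrA; congr (_ + _).
  elim: B {IHs} => [|n IHn]; first by rewrite !big_ord0 mulr0 mul0r addr0.
  rewrite big_ord_recr [in RHS]big_ord_recr mulrDr opprD IHn -[X in X * x ^+ ord_max]/(D n.+1) DE.
  by rewrite [x ^+ n.+1]exprS /=; move: (D n) ('C(_, _)%:R) => d c; ring.
rewrite normrM -mulrA; apply: ler_pM => //; first exact: inv_le.
apply: le_trans (ler_normD _ _) _; rewrite mulrDl; apply: lerD; first exact: IHs.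
by rewrite normrM normrX.
Qed.

(** The factor [N^-2], available because [s.+1 >= 2], makes the errors summable over [N]. *)
Lemma inv_pow_expand s B : (0 < s)%N -> exists K, forall N x, (0 < N)%N -> `|x| <= 2^-1 ->
  `|(N%:R + x) ^- s.+1 - \sum_(b < B) ('C(s + b, b)%:R * (-1) ^+ b * N%:R ^- (s.+1 + b)) * x ^+ b|
    <= K * `|x| ^+ B * N%:R ^- 2.
Proof.
move=> s0; have [K HK] := inv_pow_taylor s B; exists K => N x N0 x2.
have N0' : 0 < N%:R :> R by rewrite ltr0n.
have N1 : 1 <= N%:R :> R by rewrite ler1n.
pose t := - x / N%:R.
have tx : `|t| <= `|x|.
  by rewrite /t normrM normrN normfV (ger0_norm (ltW N0')) ler_pdivrMr // ler_peMr.
have -> : (N%:R + x) ^- s.+1 - \sum_(b < B) ('C(s + b, b)%:R * (-1) ^+ b *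
      N%:R ^- (s.+1 + b)) * x ^+ b =
    ((1 - t) ^- s.+1 - \sum_(b < B) 'C(s + b, b)%:R * t ^+ b) * N%:R ^- s.+1.
  rewrite mulrBl; congr (_ - _).
    by rewrite -invfM -exprMn; congr (_ ^- _); rewrite /t; field; rewrite gt_eqF.
  rewrite mulr_suml; apply: eq_bigr => b _.
  by rewrite /t exprMn (exprNn x) exprVn (exprD _ s.+1 b) invfM; ring.
rewrite normrM [X in _ * X <= _]ger0_norm ?inv_exp_ge0 //.
have K0 : 0 <= K * `|t| ^+ B by apply: le_trans (HK t (le_trans tx x2)).
apply: le_trans (_ : K * `|t| ^+ B * N%:R ^- s.+1 <= _).
  by apply: ler_wpM2r; [apply: inv_exp_ge0 | apply/HK/(le_trans tx x2)].
apply: ler_pM => //; [exact: inv_exp_ge0| |exact: inv_exp_le].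
have K0' : 0 <= K.
  have := HK (2^-1) _; rewrite ger0_norm ?invr_ge0 // => /(_ (lexx _)).
  by move=> /(le_trans (normr_ge0 _)); rewrite pmulr_lge0 // exprn_gt0 // invr_gt0.
by apply: ler_wpM2l => //; rewrite lerXn2r ?nnegrE.
Qed.

End Expansions.

Section ZagierBound.
Variables (R : realType) (a : nat).
Implicit Types (m n N M b B i s t : nat) (u y q : R).
Local Notation P := (sine_prod R 1).
Local Notation sine_val := (@sine_val R).
Local Notation zagier_poly := (@zagier_poly R).

Definition sine_coef i : R := (-1) ^+ i * mzv R (nseq i 2%N).

Definition zagier_coef b : R :=
  (-1) ^+ (a + b) * mzv R (nseq a 2%N ++ 3%N :: nseq b 2%N).

Definition zagier_gf n : {poly R} :=
  \sum_(1 <= m < n) (m%:R ^- 3 * (P m)`_a) *: sine_prod R m.+1 n.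

Let natR_neq0 n : (0 < n)%N -> n%:R != 0 :> R.
Proof. by rewrite pnatr_eq0 lt0n. Qed.

Lemma coef_zagier_gf n b : (zagier_gf n)`_b =
  (-1) ^+ (a + b) * mhs R false n (nseq b 2%N ++ 3%N :: nseq a 2%N).
Proof.
rewrite mhs_twos_three_twos mulrA -exprMn mulrNN mulr1 expr1n mul1r coef_sum.
by apply: eq_bigr => m _; rewrite coefZ.
Qed.

Lemma coef_zagier_gf_le n b : `|(zagier_gf n)`_b| <= 2 ^+ a.+1 * 2 ^+ b.
Proof.
rewrite coef_zagier_gf normrM normrX normrN1 expr1n mul1r ger0_norm ?mhs_ge0 //.
apply: le_trans (mhs_le _ _ _ _) _; first by rewrite all_cat /= !all_nseq !orbT.
by rewrite size_cat /= !size_nseq -exprD (addnC b) addSnnS addnC addSn addnC.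
Qed.

Lemma tendsto_coef_zagier_gf b : tendsto (fun n => (zagier_gf n)`_b) (zagier_coef b).
Proof.
have := tendsto_mzv_rev R (k := nseq b 2%N ++ 3%N :: nseq a 2%N).
rewrite all_cat /= !all_nseq !orbT rev_cat rev_cons !rev_nseq cat_rcons => /(_ isT) H.
by apply: tendsto_ext (tendstoZ ((-1) ^+ (a + b)) H) _ => n; rewrite coef_zagier_gf.
Qed.

Lemma zagier_gf_val n u : not_integer u ->
  (zagier_gf n).[u ^+ 2] = sine_val n u * (zagier_poly n u)`_a.
Proof.
move=> uZ; rewrite horner_sum coef_sum mulr_sumr; apply: eq_big_nat => m /andP[m0 mn].
rewrite hornerZ coefZ.
have -> : sine_val n u = sine_val m.+1 u * (sine_prod R m.+1 n).[u ^+ 2].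
  by rewrite -[sine_val m.+1 u]/(P m.+1).[u ^+ 2] -hornerM /sine_prod -big_cat_nat.
have := sine_val_neq0 natR_neq0 m.+1 uZ; move: (sine_val m.+1 u) => v v0.
have m0' := natR_neq0 m0.
by move: (m%:R : R) m0' => x x0; field; rewrite v0 x0.
Qed.

(** By the repeated sign change, the denominator, [y + N] times the limit of the product at [y + N],
    is [(-1)^N y q]. *)
Definition zagier_shift q y N : R :=
  \sum_(i < a.+1) ((y + N%:R) ^- (2 * (a - i) + 2) - (y + N.+1%:R) ^- (2 * (a - i) + 2)) *
    (sine_coef i / ((-1) ^+ N * (y * q))) -
  (y + N%:R) ^- (2 * a + 3) - (y + N.+1%:R) ^- (2 * a + 3).

Lemma tendsto_zagier_shift q y N : 0 < `|y| <= 2^-1 -> q != 0 ->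
  tendsto (fun n => sine_val n y) q ->
  tendsto (fun n => (zagier_poly n.+1 (y + N%:R) - zagier_poly n.+1 (y + N.+1%:R))`_a)
    (zagier_shift q y N).
Proof.
move=> y_half q0 yq.
have y0 : y != 0 by rewrite -normr_gt0; case/andP: y_half.
have yN0 n : y + n%:R != 0 by case/andP: (not_integer_half n y_half 0%N).
have lim : tendsto (fun n => sine_val n.+1 (y + N%:R)) ((-1) ^+ N * (y * q) / (y + N%:R)).
  elim: N => [|N IHN].
    rewrite addr0 mul1r mulrAC mulfV // mul1r.
    exact: (iffLR (tendstoS _ _) yq).
  have := sine_val_shift_lim (not_integer_half N y_half) IHN.
  rewrite -addrA natr1; congr tendsto.
  by rewrite exprS mulN1r !mulNr mulrCA mulfV // mulr1.
have := zagier_poly_shift_lim a (not_integer_half N y_half) _ lim.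
rewrite -addrA natr1 /zagier_shift; set l := _ / _ => /(_ _).
have -> : (y + N%:R) * l = (-1) ^+ N * (y * q) by rewrite /l mulrCA mulfV // mulr1.
apply; rewrite /l mulf_neq0 ?invr_eq0 // !mulf_neq0 //.
by rewrite expf_neq0 // oppr_eq0 oner_eq0.
Qed.

(** [zagier_poly] is even in [y], so the telescopings from [u] and from [- u] start at the same
    value, hence the factor 2. [K / M] bounds the two remainders and may depend on [u], since [M]
    goes to infinity first; the other error cuts the series at [B], where [(2 u^2)^B <= u^B]. *)
Lemma zagier_truncated u q : 0 < u <= 2^-1 -> tendsto (fun n => sine_val n u) q ->
  2^-1 <= q <= 1 ->
  exists K, forall M B, (0 < M)%N ->
  `|2 * u * (\sum_(b < B) zagier_coef b * (u ^+ 2) ^+ b) -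
    u * q * \sum_(0 <= N < M) (zagier_shift q u N + zagier_shift q (- u) N)| <=
  K / M%:R + 4 * 2 ^+ a.+1 * u ^+ B.
Proof.
move=> /andP[u0 u2] uq /andP[q1 q2].
have q0 : q != 0 by rewrite gt_eqF //; lra.
have u_half : 0 < `|u| <= 2^-1 by rewrite gtr0_norm // u0.
have Nu_half : 0 < `|- u| <= 2^-1 by rewrite normrN.
have uZ : not_integer u by have := not_integer_half 0 u_half; rewrite addr0.
have [K1 HK1] := zagier_poly_bound a u_half.
have [K2 HK2] := zagier_poly_bound a Nu_half.
exists (K1 + K2) => M B M0.
pose D n y N := (zagier_poly n.+1 (y + N%:R) - zagier_poly n.+1 (y + N.+1%:R))`_a.
apply: (@tendsto_bound _ (fun n => 2 * u * (\sum_(b < B) (zagier_gf n.+1)`_b * (u ^+ 2) ^+ b) -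
    u * sine_val n.+1 u * \sum_(0 <= N < M) (D n u N + D n (- u) N)) _ _ 0).
  apply: tendstoB.
    apply: tendstoZ; apply: (tendsto_sum _ (f := fun (b : 'I_B) n => _)) => b _.
    apply: tendstoM (tendsto_cst _).
    exact: (iffLR (tendstoS _ _) (tendsto_coef_zagier_gf b)).
  apply: tendstoM.
    by apply: tendstoZ; apply: (iffLR (tendstoS _ _) uq).
  apply: (tendsto_sum _ (f := fun N n => _)) => N _.
  apply: tendstoD; apply: tendsto_zagier_shift => //.
  by apply: tendsto_ext uq _ => n; rewrite sine_val_opp.
move=> n _.
have tele y : \sum_(0 <= N < M) D n y N =
    (zagier_poly n.+1 y)`_a - (zagier_poly n.+1 (y + M%:R))`_a.
  elim: (M) => [|N IHN]; first by rewrite big_geq // addr0 subrr.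
  by rewrite big_nat_recr //= IHN /D coefB; ring.
rewrite big_split /= !tele zagier_poly_opp.
have /andP[p1 p2] := @sine_val_bounds R n.+1 u (ltac:(by rewrite gtr0_norm)).
have tail := @poly_tail R (zagier_gf n.+1) (2 ^+ a.+1) B (u ^+ 2)
  (coef_zagier_gf_le n.+1) (ltac:(by apply/andP; split; nra)).
rewrite zagier_gf_val // in tail.
move: (sine_val n.+1 u) p1 p2 tail => p p1 p2.
move: (\sum_(b < B) _) => S; set Z := (zagier_poly n.+1 u)`_a => tail.
set Z1 := (zagier_poly _ (u + _))`_a; set Z2 := (zagier_poly _ (- u + _))`_a.
have -> : 2 * u * S - u * p * (Z - Z1 + (Z - Z2)) =
  u * p * (Z1 + Z2) - 2 * u * (p * Z - S) by ring.
apply: le_trans (ler_normB _ _) _; apply: lerD.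
  rewrite normrM [`|u * p|]ger0_norm; last by rewrite mulr_ge0 //; lra.
  apply: le_trans (_ : 1 * `|Z1 + Z2| <= _).
    by apply: ler_wpM2r => //; nra.
  rewrite mul1r mulrDl; apply: le_trans (ler_normD _ _) _.
  by apply: lerD; [apply: HK1 | apply: HK2].
rewrite normrM [`|2 * u|]ger0_norm; last by rewrite mulr_ge0 // ltW.
apply: le_trans (_ : 1 * (2 * 2 ^+ a.+1 * (2 * u ^+ 2) ^+ B) <= _).
  by apply: ler_pM => //; [rewrite mulr_ge0 // ltW | lra].
rewrite mul1r; apply: ler_pM.
- by rewrite mulr_ge0 ?exprn_ge0.
- by rewrite exprn_ge0 // mulr_ge0 // exprn_ge0 // ltW.
- by apply: ler_wpM2r; rewrite ?exprn_ge0 // ler_nat.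
- rewrite lerXn2r ?nnegrE ?mulr_ge0 ?exprn_ge0 ?(ltW u0) //.
  by rewrite exprS expr1; nra.
Qed.

(** For even [s] the two powers at [N = 0] cancel, so nothing singular in [u] remains; likewise in
    [symmetric_sum] for odd [t]. *)
Definition alternating_diff s u M : R :=
  \sum_(0 <= N < M) (-1) ^+ N * ((N%:R + u) ^- s - (N%:R - u) ^- s).

Definition symmetric_sum t u M : R :=
  \sum_(0 <= N < M) ((N%:R + u) ^- t + (N%:R - u) ^- t).

(** The sign [(-1)^N] turns the differences between [N] and [N + 1] into two alternating sums, up to
    [M] and up to [M + 1]; the opposite denominators at [u] and [- u] supply the minus sign inside
    them. *)
Lemma sum_zagier_shift u q M : u != 0 -> q != 0 ->
  u * q * \sum_(0 <= N < M) (zagier_shift q u N + zagier_shift q (- u) N) =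
  \sum_(i < a.+1) sine_coef i * (alternating_diff (2 * (a - i) + 2) u M +
    alternating_diff (2 * (a - i) + 2) u M.+1) -
  u * q * (symmetric_sum (2 * a + 3) u M + symmetric_sum (2 * a + 3) u M.+1).
Proof.
move=> u0 q0; elim: M => [|M IHM].
  have symm0 : symmetric_sum (2 * a + 3) u 1 = 0.
    rewrite /symmetric_sum big_nat1 add0r sub0r (exprNn u) -signr_odd.
    rewrite (_ : odd _ = true); last by lia.
    by rewrite expr1 mulN1r invrN subrr.
  have alt0 i : alternating_diff (2 * (a - i) + 2) u 1 = 0.
    rewrite /alternating_diff big_nat1 add0r sub0r (exprNn u) -[X in X * u ^+ _]signr_odd.
    rewrite (_ : odd _ = false); last by lia.
    by rewrite !mul1r subrr.
  rewrite big_geq // mulr0 symm0 /symmetric_sum big_geq // addr0 mulr0 subr0.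
  rewrite big1 // => i _.
  by rewrite alt0 /alternating_diff big_geq // addr0 mulr0.
rewrite big_nat_recr //= mulrDr IHM.
have altS s N : alternating_diff s u N.+1 = alternating_diff s u N +
    (-1) ^+ N * ((N%:R + u) ^- s - (N%:R - u) ^- s).
  by rewrite /alternating_diff big_nat_recr.
have symS t N : symmetric_sum t u N.+1 = symmetric_sum t u N +
    ((N%:R + u) ^- t + (N%:R - u) ^- t).
  by rewrite /symmetric_sum big_nat_recr.
have sgn0 : (-1) ^+ M != 0 :> R by rewrite expf_neq0 // oppr_eq0 oner_eq0.
pose e := (-1) ^+ M : R.
have shiftE : u * q * (zagier_shift q u M + zagier_shift q (- u) M) =
    \sum_(i < a.+1) sine_coef i * (e *
      ((M%:R + u) ^- (2 * (a - i) + 2) - (M%:R - u) ^- (2 * (a - i) + 2)) -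
      e * ((M.+1%:R + u) ^- (2 * (a - i) + 2) - (M.+1%:R - u) ^- (2 * (a - i) + 2))) -
    u * q * ((M%:R + u) ^- (2 * a + 3) + (M%:R - u) ^- (2 * a + 3) +
     ((M.+1%:R + u) ^- (2 * a + 3) + (M.+1%:R - u) ^- (2 * a + 3))).
  have ee : e^-1 = e.
    by apply: (mulfI sgn0); rewrite mulfV // /e -exprMn mulrNN mulr1 expr1n.
  rewrite /zagier_shift -/e ![u + _]addrC ![- u + _]addrC.
  set Bu := _ ^- (2 * a + 3); set Cu := _ ^- (2 * a + 3).
  set Bv := _ ^- (2 * a + 3); set Cv := _ ^- (2 * a + 3).
  set Au := \sum_(i < a.+1) _; set Av := \sum_(i < a.+1) _.
  rewrite (_ : _ * (_ + _) = u * q * Au + u * q * Av - u * q * (Bu + Bv + (Cu + Cv))); last by ring.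
  congr (_ - _); rewrite /Au /Av !mulr_sumr -big_split; apply: eq_bigr => i _ /=.
  rewrite !(invfM e) ee.
  move: ((M%:R + u) ^- _) ((M.+1%:R + u) ^- _) ((M%:R - u) ^- _) ((M.+1%:R - u) ^- _).
  by move=> x1 x2 x3 x4; field; rewrite ?oppr_eq0 u0 q0.
rewrite shiftE.
rewrite [in RHS](eq_bigr (fun i : 'I_a.+1 => sine_coef i *
   (alternating_diff (2 * (a - i) + 2) u M +
     alternating_diff (2 * (a - i) + 2) u M.+1) + sine_coef i * (e *
      ((M%:R + u) ^- (2 * (a - i) + 2) - (M%:R - u) ^- (2 * (a - i) + 2)) -
      e * ((M.+1%:R + u) ^- (2 * (a - i) + 2) - (M.+1%:R - u) ^- (2 * (a - i) + 2))))).
  rewrite big_split /= !symS.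
  move: (\sum_(i < a.+1) _) (\sum_(i < a.+1) _) => S T; ring.
move=> i _; rewrite !altS exprS mulN1r -/e -mulrDr; congr (_ * _).
by rewrite mulNr; ring.
Qed.

End ZagierBound.

Section LimitsOfSums.
Variable R : realType.
Implicit Types (n b B s N M w : nat) (x u c l : R).

Lemma tendsto_bound_harmonic (v : nat -> R) l K c :
  tendsto v l -> (forall M, (0 < M)%N -> `|v M| <= K / M%:R + c) -> `|l| <= c.
Proof.
move=> vl vK; apply/ler_addgt0Pr => e e0.
have /tendstoP/(_ e e0)[N NP] : tendsto (fun n => `|K| / n.+1%:R) 0.
  by apply: (@tendsto_harmonic _ _ _ `|K|) => n; rewrite subr0 ger0_norm // divr_ge0.
apply: (tendsto_bound (N0 := N.+1) vl) => -[|M] // NM.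
apply: le_trans (vK _ _) _ => //; rewrite addrC lerD2l.
have := NP M NM; rewrite subr0; apply: le_trans; apply: le_trans (ler_norm _).
by apply: ler_wpM2r; [rewrite invr_ge0 | apply: ler_norm].
Qed.

Lemma tendsto_power_sum w : (1 < w)%N ->
  tendsto (fun M => \sum_(1 <= N < M) (N%:R : R) ^- w) (mzv R [:: w]).
Proof.
move=> w1; have := @tendsto_mzv R [:: w]; rewrite /= andbT => /(_ w1) H.
by apply: tendsto_ext H _ => M; apply: eq_bigr => N _; rewrite mulr1.
Qed.

(** Adding the plain sum doubles the even terms and removes the odd ones. *)
Lemma alternating_power_sum w M :
  \sum_(1 <= N < M) (-1) ^+ N * (N%:R : R) ^- w =
  2 / 2 ^+ w * \sum_(1 <= N < uphalf M) N%:R ^- w - \sum_(1 <= N < M) N%:R ^- w.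
Proof.
case: M => [|M]; first by rewrite !big_geq // mulr0 subr0.
elim: M => [|M IHM]; first by rewrite !big_geq // mulr0 subr0.
rewrite big_nat_recr // [X in _ = _ - X]big_nat_recr // IHM -signr_odd oddS.
have [k [kM|kM]] : exists k, M = k.*2 \/ M = k.*2.+1.
  by exists M./2; have := odd_double_half M; case: (odd M); lia.
  have U1 : uphalf M.+1 = k.+1 by rewrite uphalf_half; lia.
  have U2 : uphalf M.+2 = k.+1 by rewrite uphalf_half; lia.
  rewrite U1 U2.
  rewrite kM odd_double /= expr1.
  by move: (\sum_(1 <= N < _) _) (\sum_(1 <= N < _) _) => A B; ring.
have U1 : uphalf M.+1 = k.+1 by rewrite uphalf_half; lia.
have U2 : uphalf M.+2 = k.+2 by rewrite uphalf_half; lia.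
rewrite U1 U2.
rewrite (_ : odd M = true) /=; last by rewrite kM /= odd_double.
rewrite [X in _ = 2 / _ * X - _]big_nat_recr //= expr0.
rewrite (_ : M.+1 = 2 * k.+1)%N; last by lia.
rewrite natrM (exprMn w 2) invfM.
have: (2 : R) ^+ w != 0 by rewrite expf_neq0 // pnatr_eq0.
have: (k.+1%:R : R) ^+ w != 0 by rewrite expf_neq0 // pnatr_eq0.
move: (\sum_(1 <= N < _) _) (\sum_(1 <= N < _) _) (_ ^+ w) (2 ^+ w) => A B C D c0 d0.
by field; rewrite c0 d0.
Qed.

Lemma tendsto_alternating_power_sum w : (1 < w)%N ->
  tendsto (fun M => \sum_(1 <= N < M) (-1) ^+ N * (N%:R : R) ^- w)
    ((2 / 2 ^+ w - 1) * mzv R [:: w]).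
Proof.
move=> w1; rewrite mulrBl mul1r.
apply: tendsto_ext; last by move=> M; rewrite alternating_power_sum.
apply: tendstoB (tendsto_power_sum w1); apply: tendstoZ.
apply/tendstoP => e e0; have /tendstoP/(_ e e0)[N NP] := tendsto_power_sum w1.
by exists N.*2 => n Nn; apply: NP; rewrite uphalf_half; lia.
Qed.

Lemma sum_expand s B (eps : nat -> R) (sg : R) : (0 < s)%N ->
  (forall N, `|eps N| <= 1) -> `|sg| <= 1 ->
  exists K, forall M u, 0 < u <= 2^-1 ->
  `|\sum_(1 <= N < M) eps N * ((N%:R + u) ^- s.+1 + sg * (N%:R - u) ^- s.+1) -
    (\poly_(b < B) ('C(s + b, b)%:R * ((-1) ^+ b + sg) *
       \sum_(1 <= N < M) eps N * N%:R ^- (s.+1 + b))).[u]| <= K * u ^+ B.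
Proof.
move=> s0 eps1 sg1; have [K HK] := @inv_pow_expand R s B s0; exists (4 * K) => M u /andP[u0 u2].
have K0 : 0 <= K.
  have := HK 1%N u isT; rewrite gtr0_norm // => /(_ u2)/(le_trans (normr_ge0 _)).
  by rewrite expr1n invr1 mulr1 pmulr_lge0 // exprn_gt0.
rewrite horner_poly.
have -> : \sum_(b < B) 'C(s + b, b)%:R * ((-1) ^+ b + sg) *
     (\sum_(1 <= N < M) eps N * N%:R ^- (s.+1 + b)) * u ^+ b =
  \sum_(1 <= N < M) eps N *
    (\sum_(b < B) ('C(s + b, b)%:R * (-1) ^+ b * N%:R ^- (s.+1 + b)) * u ^+ b +
     sg * \sum_(b < B) ('C(s + b, b)%:R * (-1) ^+ b * N%:R ^- (s.+1 + b)) * (- u) ^+ b).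
  under eq_bigr do rewrite mulr_sumr mulr_suml.
  rewrite exchange_big /=; apply: eq_bigr => N _.
  rewrite mulr_sumr -big_split mulr_sumr; apply: eq_bigr => b _ /=.
  have -> : (- u) ^+ b = (-1) ^+ b * u ^+ b by rewrite (exprNn u).
  have : (-1) ^+ b * (-1) ^+ b = 1 :> R by rewrite -(exprMn b) mulrNN mulr1 expr1n.
  move: ((-1) ^+ b) (_ ^- _) => e v ee.
  transitivity ('C(s + b, b)%:R * eps N * v * u ^+ b * (e + sg * (e * e))); last by ring.
  by rewrite ee; ring.
rewrite -sumrB; apply: le_trans (ler_norm_sum _ _ _) _.
apply: le_trans (_ : \sum_(1 <= N < M) 2 * K * u ^+ B * N%:R ^- 2 <= _).
  apply: ler_sum_nat => N /andP[N0 _]; rewrite -mulrBr normrM.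
  apply: le_trans (_ : 1 * `|_| <= _); first by apply: ler_wpM2r.
  rewrite mul1r opprD addrACA -mulrBr; apply: le_trans (ler_normD _ _) _.
  have H1 := HK N u N0; have H2 := HK N (- u) N0; rewrite normrN in H2.
  rewrite gtr0_norm // in H1 H2.
  rewrite (_ : 2 * K * _ * _ = K * u ^+ B * N%:R ^- 2 + K * u ^+ B * N%:R ^- 2); last by ring.
  apply: lerD; first exact: H1.
  rewrite normrM; apply: le_trans (_ : 1 * `|_| <= _); first by apply: ler_wpM2r.
  by rewrite mul1r; apply: H2.
rewrite -mulr_sumr (_ : 4 * K * _ = 2 * K * u ^+ B * 2); last by ring.
apply: ler_wpM2l (sum_inv_sqr_le R M).
by rewrite !mulr_ge0 // exprn_ge0 // ltW.
Qed.

End LimitsOfSums.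

Section GeneratingIdentity.
Variables (R : realType) (B : nat).
Implicit Types (n N M b s : nat) (u c q : R) (p : {poly R}) (f : R -> nat -> R).

(* [K] is uniform in [u] and [M]: coefficients are compared only after [M] goes to infinity. *)
Definition expands_to f p : Prop :=
  exists K, forall u, 0 < u <= 2^-1 -> exists2 v : nat -> R, tendsto v p.[u] &
    forall M, (0 < M)%N -> `|f u M - v M| <= K * u ^+ B.

Lemma expands_to0 : expands_to (fun _ _ => 0) 0.
Proof.
exists 0 => u u0; exists (fun=> 0); first by rewrite horner0; apply: tendsto_cst.
by move=> M _; rewrite subrr normr0 mul0r.
Qed.

Lemma expands_toD f g p (q : {poly R}) : expands_to f p -> expands_to g q ->
  expands_to (fun u M => f u M + g u M) (p + q).
Proof.
move=> [K Kf] [L Lg]; exists (K + L) => u u2.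
have [v vp Kv] := Kf u u2; have [w wq Lw] := Lg u u2.
exists (fun M => v M + w M); first by rewrite hornerD; apply: tendstoD.
move=> M M0; rewrite opprD addrACA mulrDl; apply: le_trans (ler_normD _ _) _.
by apply: lerD; [apply: Kv | apply: Lw].
Qed.

Lemma expands_toZ c f p : expands_to f p -> expands_to (fun u M => c * f u M) (c *: p).
Proof.
move=> [K Kf]; exists (`|c| * K) => u u2; have [v vp Kv] := Kf u u2.
exists (fun M => c * v M); first by rewrite hornerZ; apply: tendstoZ.
by move=> M M0; rewrite -mulrBr normrM -mulrA; apply: ler_wpM2l => //; apply: Kv.
Qed.

Lemma expands_to_sum n (f : 'I_n -> R -> nat -> R) (p : 'I_n -> {poly R}) :
  (forall i, expands_to (f i) (p i)) ->
  expands_to (fun u M => \sum_(i < n) f i u M) (\sum_(i < n) p i).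
Proof.
elim: n f p => [|n IHn] f p fp.
  rewrite big_ord0; have [K HK] := expands_to0.
  by exists K => u /HK[v vp Kv]; exists v => // M; rewrite big_ord0; apply: Kv.
rewrite big_ord_recr /=.
have [K HK] := expands_toD (IHn _ _ (fun i => fp (widen_ord (leqnSn n) i))) (fp ord_max).
by exists K => u /HK[v vp Kv]; exists v => // M; rewrite big_ord_recr; apply: Kv.
Qed.

Lemma expands_toS f p : expands_to f p -> expands_to (fun u M => f u M + f u M.+1) (p + p).
Proof.
move=> [K Kf]; exists (K + K) => u u2; have [v vp Kv] := Kf u u2.
exists (fun M => v M + v M.+1).
  by rewrite hornerD; apply: tendstoD => //; apply: (iffLR (tendstoS _ _) vp).
move=> M M0; rewrite opprD addrACA mulrDl; apply: le_trans (ler_normD _ _) _.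
by apply: lerD; apply: Kv.
Qed.

Lemma expands_to_power_sum s (eps L : nat -> R) (sg : R) :
  (0 < s)%N -> (forall N, `|eps N| <= 1) -> `|sg| <= 1 ->
  (forall w, (1 < w)%N -> tendsto (fun M => \sum_(1 <= N < M) eps N * N%:R ^- w) (L w)) ->
  expands_to (fun u M => \sum_(1 <= N < M) eps N *
      ((N%:R + u) ^- s.+1 + sg * (N%:R - u) ^- s.+1))
    (\poly_(b < B) ('C(s + b, b)%:R * ((-1) ^+ b + sg) * L (s.+1 + b)%N)).
Proof.
move=> s0 eps1 sg1 Llim; have [K HK] := sum_expand B s0 eps1 sg1.
exists K => u u2; exists (fun M => (\poly_(b < B) ('C(s + b, b)%:R * ((-1) ^+ b + sg) *
       \sum_(1 <= N < M) eps N * N%:R ^- (s.+1 + b))).[u]); last by move=> M _; apply: HK.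
rewrite horner_poly; apply: tendsto_ext.
  apply: (tendsto_sum _ (f := fun (b : 'I_B) M => 'C(s + b, b)%:R * ((-1) ^+ b + sg) *
       (\sum_(1 <= N < M) eps N * N%:R ^- (s.+1 + b)) * u ^+ b)) => b _.
  apply: tendstoM (tendsto_cst _); apply: tendstoZ; apply: Llim; lia.
by move=> M; rewrite horner_poly.
Qed.

Definition alternating_poly s : {poly R} := \poly_(b < B) ('C(s + b, b)%:R *
  ((-1) ^+ b + -1) * ((2 / 2 ^+ (s.+1 + b) - 1) * mzv R [:: (s.+1 + b)%N])).

Definition symmetric_poly s : {poly R} :=
  \poly_(b < B) ('C(s + b, b)%:R * ((-1) ^+ b + 1) * mzv R [:: (s.+1 + b)%N]).

Lemma expands_to_alternating s : odd s ->
  expands_to (alternating_diff s.+1) (alternating_poly s).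
Proof.
move=> s_odd; have := @expands_to_power_sum s (fun N => (-1) ^+ N) _ (-1)
  (odd_gt0 s_odd) _ _ (fun w => @tendsto_alternating_power_sum R w).
case=> [N||K HK]; [by rewrite normrX normrN1 expr1n | by rewrite normrN1 |].
exists K => u u2; have [v vp Kv] := HK u u2; exists v => // M M0.
rewrite /alternating_diff big_ltn // add0r sub0r (exprNn u).
rewrite -(signr_odd _ s.+1) /= s_odd /= !mul1r subrr add0r.
rewrite (eq_bigr (fun N => (-1) ^+ N * ((N%:R + u) ^- s.+1 + -1 * (N%:R - u) ^- s.+1))).
  exact: Kv.
by move=> N _; rewrite mulN1r.
Qed.

Lemma expands_to_symmetric s : (0 < s)%N -> ~~ odd s ->
  expands_to (symmetric_sum s.+1) (symmetric_poly s).
Proof.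
move=> s0 s_even; have := @expands_to_power_sum s (fun=> 1) (fun w => mzv R [:: w]) 1 s0.
case=> [N||w w1|K HK]; [by rewrite normr1 | by rewrite normr1 | |].
  by apply: tendsto_ext (tendsto_power_sum R w1) _ => M; apply: eq_bigr => N _; rewrite mul1r.
exists K => u u2; have [v vp Kv] := HK u u2; exists v => // M M0.
rewrite /symmetric_sum big_ltn // add0r sub0r (exprNn u).
rewrite -(signr_odd _ s.+1) /= s_even /= expr1 mulN1r invrN subrr add0r.
rewrite (eq_bigr (fun N => 1 * ((N%:R + u) ^- s.+1 + 1 * (N%:R - u) ^- s.+1))).
  exact: Kv.
by move=> N _; rewrite !mul1r.
Qed.

Lemma sine_val_expand u q : 0 < u <= 2^-1 -> tendsto (fun n => sine_val n u) q ->
  `|q - ((\poly_(b < B) sine_coef R b) \Po 'X^2).[u]| <= 2 * u ^+ B.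
Proof.
move=> /andP[u0 u2] uq; rewrite horner_comp hornerXn horner_poly.
apply: (@tendsto_bound _ (fun n => sine_val n u -
    \sum_(b < B) (sine_prod R 1 n)`_b * (u ^+ 2) ^+ b) _ _ 0).
  apply: tendstoB => //; apply: (tendsto_sum _ (f := fun (b : 'I_B) n => _)) => b _.
  exact: tendstoM (tendsto_coef_sine_prod R b) (tendsto_cst _).
move=> n _; have := @poly_tail R (sine_prod R 1 n) 1 B (u ^+ 2).
move=> /(_ _ _)/le_trans; apply.
- by move=> b; rewrite mul1r; apply: coef_sine_prod_le.
- by apply/andP; split; nra.
rewrite mulr1; apply: ler_wpM2l => //.
rewrite lerXn2r ?nnegrE ?mulr_ge0 ?exprn_ge0 ?(ltW u0) //.
by rewrite exprS expr1; nra.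
Qed.

(** Half of the limiting identity, because the sums up to [M] and up to [M + 1] have the same limit.
    The product is left untruncated: only coefficients below [B] are compared. *)
Definition zagier_identity_poly a : {poly R} :=
  'X * ((\poly_(b < B) zagier_coef R a b) \Po 'X^2) -
  \sum_(i < a.+1) sine_coef R i *: alternating_poly (2 * (a - i) + 1) +
  'X * (((\poly_(b < B) sine_coef R b) \Po 'X^2) * symmetric_poly (2 * a + 2)).

Lemma zagier_identity_poly_small a : exists K, forall u, 0 < u <= 2^-1 ->
  `|(zagier_identity_poly a).[u]| <= K * u ^+ B.
Proof.
have [K1 HK1] : expands_to (fun u M => \sum_(i < a.+1) sine_coef R i *
    (alternating_diff (2 * (a - i) + 2) u M + alternating_diff (2 * (a - i) + 2) u M.+1))
   (\sum_(i < a.+1) sine_coef R i *: (alternating_poly (2 * (a - i) + 1) +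
     alternating_poly (2 * (a - i) + 1))).
  apply: expands_to_sum => i; apply: expands_toZ; apply: expands_toS.
  by rewrite (addnS _ 1); apply: expands_to_alternating; lia.
have [K2 HK2] : expands_to (fun u M => symmetric_sum (2 * a + 3) u M +
    symmetric_sum (2 * a + 3) u M.+1)
   (symmetric_poly (2 * a + 2) + symmetric_poly (2 * a + 2)).
  by apply: expands_toS; rewrite (addnS _ 2); apply: expands_to_symmetric; lia.
have [C HC] := poly_bounded (symmetric_poly (2 * a + 2)).
exists (4 * 2 ^+ a.+1 + K1 + K2 + 2 * C) => u u2.
have [u0 u2'] := andP u2.
have [q uq q12] := sine_val_lim (ltac:(by rewrite gtr0_norm) : `|u| <= 2^-1).
have [K0 HK0'] := zagier_truncated a u2 uq q12; have HK0 M := HK0' M B.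
have [v1 v1l Kv1] := HK1 u u2; have [v2 v2l Kv2] := HK2 u u2.
have Kq := sine_val_expand u2 uq.
have /andP[q1 q2] := q12.
have Cu : `|(symmetric_poly (2 * a + 2)).[u]| <= C by apply: HC; lra.
rewrite /zagier_identity_poly 2!hornerD hornerN 2!hornerM hornerM hornerX.
set G := \sum_(b < B) _ in HK0; set V1 := (\sum_(i < a.+1) _).[u] in v1l.
have -> : ((\poly_(b < B) zagier_coef R a b) \Po 'X^2).[u] = G.
  by rewrite horner_comp hornerXn horner_poly.
set A := (\sum_(i < a.+1) _).[u].
have V1E : V1 = A + A.
  rewrite /V1 /A -hornerD -big_split; congr _.[_]; apply: eq_bigr => i _.
  by rewrite scalerDr.
rewrite hornerD in v2l.
set Q := (_ \Po _).[u] in Kq *; set S := (symmetric_poly _).[u] in Cu v2l *.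
have uq1 : 0 <= u * q <= 1 by apply/andP; split; nra.
(* Here [M] goes to infinity with [u] fixed, which removes [K0 / M]. *)
have bound : `|2 * u * G - V1 + u * q * (S + S)| <= (4 * 2 ^+ a.+1 + K1 + K2) * u ^+ B.
  apply: (@tendsto_bound_harmonic _ (fun M => 2 * u * G - v1 M + u * q * v2 M) _ K0).
    apply: tendstoD; last exact: tendstoZ.
    by apply: tendstoB v1l; apply: tendsto_cst.
  move=> M M0; have H0 := HK0 M M0; have H1 := Kv1 M M0; have H2 := Kv2 M M0.
  rewrite sum_zagier_shift ?gt_eqF // in H0; last by lra.
  move: H0 H1 H2; rewrite -/G; set F1 := \sum_(i < a.+1) _; set F2 := (_ + _ : R) => H0 H1 H2.
  have -> : 2 * u * G - v1 M + u * q * v2 M =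
    (2 * u * G - (F1 - u * q * F2)) + (F1 - v1 M) - u * q * (F2 - v2 M) by ring.
  have {}H2 : `|u * q * (F2 - v2 M)| <= K2 * u ^+ B.
    rewrite normrM ger0_norm; last by case/andP: uq1.
    by apply: le_trans H2; rewrite ler_piMl //; case/andP: uq1.
  apply: le_trans (ler_normB _ _) _.
  apply: le_trans (lerD (ler_normD _ _) (lexx _)) _.
  have -> : (4 * 2 ^+ a.+1 + K1 + K2) * u ^+ B =
    4 * 2 ^+ a.+1 * u ^+ B + K1 * u ^+ B + K2 * u ^+ B by ring.
  by lra.
have -> : u * G - A + u * (Q * S) =
    (2 * u * G - V1 + u * q * (S + S)) / 2 - u * (q - Q) * S by rewrite V1E; field.
have uB : 0 <= u ^+ B by rewrite exprn_ge0 // ltW.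
have {}bound : `|(2 * u * G - V1 + u * q * (S + S)) / 2| <=
    (4 * 2 ^+ a.+1 + K1 + K2) * u ^+ B.
  apply: le_trans bound; rewrite normrM [`|2^-1|]ger0_norm ?invr_ge0 //.
  by rewrite ler_piMr //; lra.
apply: le_trans (ler_normB _ _) _; rewrite [leRHS]mulrDl; apply: lerD => //.
rewrite !normrM (gtr0_norm u0) (_ : 2 * C * _ = 1 * (2 * u ^+ B) * C); last by ring.
apply: ler_pM => //; first by rewrite mulr_ge0 // ltW.
apply: ler_pM => //; [exact: ltW | lra].
Qed.

End GeneratingIdentity.

Section SymmetricTwosThreeTwos.
Variable R : realType.
Implicit Types (a b i j w : nat).
Local Notation zeta := (mzvZ R).

Lemma mzvalB (x y : mzvalg R) : mzval (x - y) = mzval x - mzval y. Proof. by []. Qed.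

Lemma sum_even (F : nat -> R) n : (forall j, odd j -> F j = 0) ->
  \sum_(j < (2 * n).+1) F j = \sum_(j < n.+1) F (2 * j)%N.
Proof.
move=> F0; elim: n => [|n IHn]; first by rewrite !big_ord1.
rewrite mulnS add2n big_ord_recr big_ord_recr [RHS]big_ord_recr /= IHn F0 ?addr0 //=.
  by rewrite mulnS add2n.
by rewrite oddM.
Qed.

(** The coefficient in [alternating_poly] at an odd power, where [(-1)^b - 1 = -2]. *)
Definition zagier_alt_coef w b : rat := 'C(w.-1, b)%:R * - 2 * (2 / 2 ^+ w - 1).

(** Zagier's evaluation, read off at [u^(2b+1)]; hence the expansion to order [2b + 2]. *)
Lemma zagier_coefE a b : zagier_coef R a b =
  \sum_(i < a.+1) sine_coef R i * (ratr (zagier_alt_coef (2 * (a - i) + 2 * b + 3) (2 * b + 1)) *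
    mzv R [:: (2 * (a - i) + 2 * b + 3)%N]) -
  \sum_(j < b.+1) sine_coef R j * ('C(2 * a + 2 + 2 * (b - j), 2 * (b - j))%:R * 2 *
    mzv R [:: (2 * a + 3 + 2 * (b - j))%N]).
Proof.
have [K HK] := zagier_identity_poly_small R (2 * b + 2) a.
have := poly_small_coef HK (ltac:(lia) : (2 * b + 1 < 2 * b + 2)%N).
rewrite /zagier_identity_poly !coefD coefN (addn1 (2 * b)) 2!coefXM /=.
rewrite coef_comp_poly_Xn // dvdn_mulr // mulKn // coef_poly (_ : (b < _)%N = true); last by lia.
move=> /eqP; rewrite -addrA addr_eq0 => /eqP ->; rewrite opprD opprK; congr (_ - _).
  rewrite coef_sum; apply: eq_bigr => i _; rewrite coefZ coef_poly.
  rewrite (_ : (_ < _)%N = true); last by lia.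
  rewrite -(signr_odd _ (2 * b).+1) /= oddM /= expr1.
  rewrite (_ : (2 * (a - i) + 1).+1 + (2 * b).+1 = 2 * (a - i) + 2 * b + 3)%N; last by lia.
  rewrite /zagier_alt_coef !rmorphM rmorphB rmorphM rmorphN fmorphV rmorphXn !rmorph_nat.
  rewrite (_ : 2 * (a - i) + 1 + (2 * b).+1 = (2 * (a - i) + 2 * b + 3).-1)%N; last by lia.
  by congr (_ * _); rewrite -opprD -[1 + 1]/2 rmorph1 !mulrA.
rewrite coefM.
rewrite (@sum_even (fun j => (_ \Po 'X^2)`_j * (symmetric_poly _ _ _)`_(2 * b - j))); last first.
  by move=> j j_odd; rewrite coef_comp_poly_Xn // dvdn2 j_odd mul0r.
apply: eq_bigr => j _; rewrite coef_comp_poly_Xn // dvdn_mulr // mulKn // !coef_poly.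
have jb := ltn_ord j.
have lt1 : (j < 2 * b + 2)%N by lia.
have lt2 : (2 * b - 2 * j < 2 * b + 2)%N by lia.
rewrite lt1 lt2 -mulnBr -(signr_odd _ (2 * _)) oddM expr0.
by rewrite (_ : (2 * a + 2).+1 = 2 * a + 3)%N //; lia.
Qed.

(** In [zagier_coefE], the terms with [i > 0] or [j > 0] contain a value at a nonempty string of
    twos. *)
Lemma zeta_twos_three_twos_ideal a b : let w := (2 * a + 2 * b + 3)%N in
  zeta2_ideal ((-1) ^+ (a + b) * zeta (nseq a 2%N ++ 3%N :: nseq b 2%N) -
    (zagier_alt_coef w (2 * b + 1) - 2 * 'C(w.-1, 2 * b)%:R) *: zeta [:: w]).
Proof.
move=> w; pose s i : mzvalg R := (-1) ^+ i * zeta (nseq i 2%N).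
have sE i : mzval (s i) = sine_coef R i by rewrite mzvalM mzval_sign.
have s0 : s 0%N = 1 by rewrite /s mul1r zeta_nil.
have s_ideal i x : (0 < i)%N -> zeta2_ideal (s i * x).
  by move=> i0; rewrite mulrC; apply/zeta2_idealM/zeta2_idealM/zeta_twos_ideal.
have -> : (-1) ^+ (a + b) * zeta (nseq a 2%N ++ 3%N :: nseq b 2%N) =
  \sum_(i < a.+1) s i * (zagier_alt_coef (2 * (a - i) + 2 * b + 3) (2 * b + 1) *:
    zeta [:: (2 * (a - i) + 2 * b + 3)%N]) -
  \sum_(j < b.+1) s j * (('C(2 * a + 2 + 2 * (b - j), 2 * (b - j))%:R * 2) *:
    zeta [:: (2 * a + 3 + 2 * (b - j))%N]).
  apply: val_inj; rewrite [LHS]mzvalM mzval_sign -[LHS]/(zagier_coef R a b) zagier_coefE.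
  rewrite [RHS]mzvalB !mzval_sum.
  congr (_ - _); apply: eq_bigr => i _; rewrite mzvalM sE mzval_scale //.
  by rewrite rmorphM !rmorph_nat.
rewrite !big_ord_recl /= s0 !mul1r !subn0 -/w.
have -> : (2 * a + 3 + 2 * b = w)%N by rewrite /w; lia.
have -> : (2 * a + 2 + 2 * b = w.-1)%N by rewrite /w; lia.
set x := \sum_(i < a) _; set y := \sum_(i < b) _.
have -> : zagier_alt_coef w (2 * b + 1) *: zeta [:: w] + x -
    (('C(w.-1, 2 * b)%:R * 2) *: zeta [:: w] + y) -
    (zagier_alt_coef w (2 * b + 1) - 2 * 'C(w.-1, 2 * b)%:R) *: zeta [:: w] = x - y.
  by rewrite scalerBl (mulrC 2); move: (_ *: _) (_ *: _) => c d; ring.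
by apply: zeta2_idealD; [|apply: zeta2_idealN]; apply: zeta2_ideal_sum => i _; apply: s_ideal.
Qed.

End SymmetricTwosThreeTwos.

(** Complementation gives [C(w-1, 2b+1) = C(w-1, 2a+1)], so the part with [2 / 2^w] cancels;
    Pascal's rule turns what remains into binomials of [w]. *)
Lemma coef_int_diff a b (w := (2 * a + 2 * b + 3)%N) :
  (coef_int a b)%:~R = (-1) ^+ (a + b) * ((zagier_alt_coef w (2 * b + 1) - 2 * 'C(w.-1, 2 * b)%:R) -
    (zagier_alt_coef w (2 * a + 1) - 2 * 'C(w.-1, 2 * a)%:R)) :> rat.
Proof.
rewrite coef_intE -/w -mulrA; congr (_ * _); rewrite /zagier_alt_coef.
have -> : 'C(w.-1, 2 * b + 1) = 'C(w.-1, 2 * a + 1).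
  by rewrite -bin_sub; [congr 'C(_, _)|]; rewrite /w; lia.
have binE c d : (w = 2 * c + 2 * d + 3)%N ->
    'C(w, 2 * d + 2) = ('C(w.-1, 2 * c) + 'C(w.-1, 2 * d + 1))%N.
  move=> wE; have {1}-> : w = w.-1.+1 by rewrite wE; lia.
  rewrite (addnS _ 1) binS; congr addn.
  by rewrite -bin_sub; [congr 'C(_, _)|]; rewrite wE; lia.
rewrite (binE a b) // (binE b a); last by rewrite /w; lia.
have -> : 'C(w.-1, 2 * b + 1) = 'C(w.-1, 2 * a + 1).
  by rewrite -bin_sub; [congr 'C(_, _)|]; rewrite /w; lia.
by rewrite !natrD; ring.
Qed.

Lemma coef_int_sym a b : coef_int b a = - coef_int a b.
Proof.
by rewrite /coef_int (addnC b) (addnC (2 * b)) -mulrN opprB.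
Qed.

Lemma coef_int_star a b :
  ((-1) ^+ (a + b) * coef_int b a)%:~R = - ((-1) ^+ (a + b) * (coef_int a b)%:~R) :> rat.
Proof. by rewrite coef_int_sym mulrN mulrNz intrM rmorphXn rmorphN1. Qed.

Lemma scale_sign (R : realType) n (c : rat) (x : mzvalg R) :
  ((-1) ^+ n * c) *: x = (-1) ^+ n * (c *: x).
Proof.
apply: val_inj; rewrite [LHS]mzval_scale [RHS]mzvalM mzval_sign mzval_scale.
by rewrite rmorphM rmorphXn rmorphN1 /= -mulrA.
Qed.

Lemma zeta_twos_three_twos_sub_rev (R : realType) a b (k := nseq a 2%N ++ 3%N :: nseq b 2%N) :
  zeta2_ideal (mzvZ R k - mzvZ R (rev k) -
    (coef_int a b)%:~R *: mzvZ R [:: (2 * a + 2 * b + 3)%N]).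
Proof.
set w := (2 * a + 2 * b + 3)%N.
have kr : rev k = nseq b 2%N ++ 3%N :: nseq a 2%N.
  by rewrite /k rev_cat rev_cons !rev_nseq cat_rcons.
have := zeta_twos_three_twos_ideal R b a.
rewrite -kr (addnC b) (addnC (2 * b)) -/w => /zeta2_idealN Ib.
have Ia := zeta_twos_three_twos_ideal R a b; rewrite -/k -/w in Ia.
have := zeta2_idealM ((-1) ^+ (a + b)) (zeta2_idealD Ia Ib).
congr zeta2_ideal; rewrite coef_int_diff -/w.
set c := (_ - _ : rat); set d := (_ - _ : rat); set e := (-1) ^+ _.
have ee : e * e = 1 by rewrite -expr2 sqrr_sign.
have -> : ((-1) ^+ (a + b) * (c - d)) *: mzvZ R [:: w] =
    e * (c *: mzvZ R [:: w] - d *: mzvZ R [:: w]).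
  by rewrite -scalerBl -scale_sign.
move: (mzvZ R k) (mzvZ R (rev k)) (c *: _ : mzvalg R) (d *: _ : mzvalg R) => x y z t.
transitivity (e * e * x - e * e * y - e * (z - t)); first by ring.
by rewrite ee !mul1r.
Qed.

Unset Implicit Arguments.

Theorem theorem3p10 (R : realType) (reg : regularization) (a b : nat) :
  let k : seq nat := nseq a 2%N ++ 3%N :: nseq b 2%N in
  let w : nat := (2 * a + 2 * b + 3)%N in
  let binomial : rat := 'C(w, 2 * b + 2)%:R in
  let c : rat :=
    (-1) ^+ (a + b) * (2 * (a%:R - b%:R)) / (a%:R + 1) * binomial in
  let c_star : rat := 2 * (b%:R - a%:R) / (a%:R + 1) * binomial in
  [/\ zetaA1 k = c *: frakZ_A1 w,
      zeta_starA1 k = c_star *: frakZ_A1 w,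
      zetaS1 R reg k = c *: frakZ_S1 R w
    & zeta_starS1 R reg k = c_star *: frakZ_S1 R w].
Proof.
move=> k w binomial c c_star.
have cE : c = (coef_int a b)%:~R.
  by rewrite coef_intE -mulrA -coef_three_twos /c !mulrA.
have c_starE : c_star = ((-1) ^+ (a + b) * coef_int b a)%:~R.
  rewrite coef_int_star -cE /c -!mulrA.
  by rewrite signrMK /c_star; ring.
split.
- by rewrite zetaA1_twos_three_twos -cE.
- by rewrite zeta_starA1_twos_three_twos -c_starE.
- rewrite zetaS1_twos_three_twos -/k [RHS]scale_to_mzvbar cE.
  exact/to_mzvbar_eq/zeta_twos_three_twos_sub_rev.
- rewrite zeta_starS1_twos_three_twos -/k [RHS]scale_to_mzvbar c_starE.
  have I := zeta_twos_three_twos_sub_rev R a b; rewrite -/k -/w in I.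
  apply/to_mzvbar_eq; move: (zeta2_idealN (zeta2_idealM ((-1) ^+ (a + b)) I)).
  congr zeta2_ideal; rewrite coef_int_star scaleNr opprK.
  by rewrite scale_sign; ring.
Qed.
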